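(* Let $\beta\in(0,1)$ and $a\in\mathbf R$. Let $B_2\subset B_1\subset B$ and $B_{2b}\subset B_{1b}\subset B_b$ be two Banach triples with norms $\|\cdot\|_2,\|\cdot\|_1,\|\cdot\|$ and $\|\cdot\|_{2b},\|\cdot\|_{1b},\|\cdot\|_b$, and let $B^{con}$ be another Banach space with norm $\|\cdot\|_{con}$. Assume: (i) $D=(D_1,\dots,D_n)$ and $D^b=(D_{1b},\dots,D_{nb})$, where $D_i\in\mathcal L(B_1,B)\cap\mathcal L(B_2,B_1)$ and $D_{ib}\in\mathcal L(B_{1b},B_b)\cap\mathcal L(B_{2b},B_{1b})$, all these operators having norms bounded by $1$ in the respective spaces. (ii) $A\in\mathcal L(B_2,B)$ generates a strongly continuous semigroup $e^{At}$ in both $B$ and $B_1$, with $\|e^{At}\|_{B\to B}\le Me^{mt}$, $\|e^{At}\|_{B_1\to B_1}\le M_1e^{m_1t}$ for nonnegative constants $M,m,M_1,m_1$, and $B_2$ is an invariant core for this semigroup in $B$. Likewise $A^b\in\mathcal L(B_{2b},B_b)$ generates a strongly continuous semigroup $e^{A^bt}$ in both $B_b$ and $B_{1b}$, with $\|e^{A^bt}\|_{B_b\to B_b}\le M_be^{m_bt}$, $\|e^{A^bt}\|_{B_{1b}\to B_{1b}}\le M_{1b}e^{m_{1b}t}$ for nonnegative constants $M_b,m_b,M_{1b},m_{1b}$, and $B_{2b}$ is an invariant core for this semigroup in $B_b$. (iii) $H:\mathbf R\times B\times B^n\times B^{con}\to B$ is continuous and, for some constants $L_H,L_H',L_H^{par}$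 and all arguments, $$\|H(t,b_0,\dots,b_n,u)-H(t,\tilde b_0,\dots,\tilde b_n,u)\|\le L_H\sum_{j=0}^n\|b_j-\tilde b_j\|\Big(1+L_H'\sum_{j=1}^n\|b_j\|\Big),$$ $$\|H(t,b_0,\dots,b_n,u)-H(t,b_0,\dots,b_n,\tilde u)\|\le L_H^{par}\|u-\tilde u\|_{con}\Big(1+\sum_{j=1}^n\|b_j\|\Big),$$ $$\|H(t,b_0,\dots,b_n,u)\|\le L_H\sum_{j=1}^n\|b_j\|.$$ $H^b:\mathbf R\times B_b\times(B_b)^n\times C([a,T],B)\to B_b$ is continuous, $H^b(t,f_0,\dots,f_n,b(\cdot))$ depends on the curve $b(\cdot)$ only through its future values $b_{\ge t}=\{b(s):s\in[t,T]\}$, and, for some constants $L_H^b,(L_H^b)'$ and all arguments, $$\|H^b(t,f_0,\dots,f_n,b(\cdot))-H^b(t,\tilde f_0,\dots,\tilde f_n,b(\cdot))\|_b\le L^b_H\sum_{j=0}^n\|f_j-\tilde f_j\|_b\Big(1+(L_H^b)'\sum_{j=1}^n\|f_j\|_b\Big),$$ $$\|H^b(t,f_0,\dots,f_n,b(\cdot))-H^b(t,f_0,\dots,f_n,\tilde b(\cdot))\|_b\le L^b_H\|b-\tilde b\|_{C([a,T],B)}\Big(1+\sum_{j=0}^n\|f_j\|_b\Big),$$ $$\|H^b(t,f_0,\dots,f_n,b(\cdot))\|_b\le L^b_H\sum_{j=1}^n\|f_j\|_b.$$ (iv) $u:\mathbf R\times B_b\times(B_b)^n\to B^{con}$ is continuous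 and, for some constant $L_u$, $$\|u(t,f_0,\dots,f_n)-u(t,\tilde f_0,\dots,\tilde f_n)\|_{con}\le L_u\sum_{j=0}^n\|f_j-\tilde f_j\|_b.$$ (v) For $t>0$, $e^{At}$ takes $B$ to $B_1$ and $e^{A^bt}$ takes $B_b$ to $B_{1b}$, and for $t\in(0,1]$ one has $\|e^{At}\|_{B\to B_1}\le\varkappa t^{-\omega}$ and $\|e^{A^bt}\|_{B_b\to B_{1b}}\le\varkappa t^{-\omega}$ with some constants $\varkappa>0$, $\omega\in(0,1)$. Then for any $Y\in B_1$, $Z\in B_{1b}$ there exists $T_0$ such that the fractional forward-backward system $$\begin{cases}D^\beta_{a+*}b(t)=Ab(t)+H(t,b(t),Db(t),u(t,f(t),D^bf(t))),& b(a)=Y,\\ D^\beta_{T-*}f(t)=-A^bf(t)+H^b(t,f(t),D^bf(t),b_{\ge t}),& f(T)=Z,\end{cases}\qquad t\in[a,T],$$ has a unique mild solution $(b(t),f(t))$ for all $T<T_0$ (with $T>a$), which depends locally Lipschitz on $Y$ and $Z$.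
   Context: $\mathcal L(B,C)$ is the Banach space of bounded linear operators $B\to C$ with operator norm $\|\cdot\|_{B\to C}$. $C([a,T],B)$ is the Banach space of continuous functions $[a,T]\to B$ with the sup-norm. A Banach triple is a sequence of embedded Banach spaces $B_2\subset B_1\subset B$ with norms satisfying $\|\cdot\|_2\ge\|\cdot\|_1\ge\|\cdot\|$ (on the spaces where they are defined), such that $B_2$ is dense in $B_1$ in the topology of $B_1$ and $B_1$ is dense in $B$ in the topology of $B$. $Db=(D_1b,\dots,D_nb)$, $D^bf=(D_{1b}f,\dots,D_{nb}f)$. The left and right Caputo–Dzherbashyan derivatives of order $\beta$ are $$D^{\beta}_{a+*}b(t)=\frac1{\Gamma(-\beta)}\int_0^{t-a}\frac{b(t-z)-b(t)}{z^{1+\beta}}dz+\frac{b(t)-b(a)}{\Gamma(1-\beta)(t-a)^\beta},$$ $$D^{\beta}_{T-*}b(t)=\frac1{\Gamma(-\beta)}\int_0^{T-t}\frac{b(t+z)-b(t)}{z^{1+\beta}}dz+\frac{b(t)-b(T)}{\Gamma(1-\beta)(T-t)^\beta}.$$ $E_\beta(x)=\sum_{k\ge0}x^k/\Gamma(\beta k+1)$ is the Mittag-Leffler function. For a generator $A$ of a semigroup $e^{At}$ and $\tau\ge0$ one defines $$E_\beta(A\tau)=\frac1\beta\int_0^\infty e^{A\tau x}x^{-1-1/\beta}G_\beta(1,x^{-1/\beta})\,dx,\qquad E'_\beta(A\tau)=\frac1\beta\int_0^\infty e^{A\tau x}x^{-1/\beta}G_\beta(1,x^{-1/\beta})\,dx,$$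 where $G_\beta(t,x)=\frac1\pi\,\mathrm{Re}\int_0^\infty\exp\{ipx-tp^\beta e^{i\pi\beta/2}\}\,dp$. A mild solution of the system is a pair $(b,f)\in C([a,T],B_1)\times C([a,T],B_{1b})$ satisfying, for $t\in[a,T]$, the forward mild equation $$b(t)=E_\beta(A(t-a)^\beta)Y+\beta\int_a^t(t-s)^{\beta-1}E'_\beta(A(t-s)^\beta)H(s,b(s),Db(s),u(s,f(s),D^bf(s)))\,ds$$ and its backward counterpart (the fractional version of the mild form of $\dot f=-A^bf+H^b$, $f(T)=Z$) $$f(t)=E_\beta(A^b(T-t)^\beta)Z-\beta\int_t^T(s-t)^{\beta-1}E'_\beta(A^b(s-t)^\beta)H^b(s,f(s),D^bf(s),b_{\ge s})\,ds.$$ ''Locally Lipschitz'' means Lipschitz when $Y$ and $Z$ are taken from bounded sets. *)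

(* Defs.v *)
(* Stdlib reals and Coquelicot: Banach spaces are complete normed modules over
   R, vector-valued integrals are (improper) Riemann integrals.  MathComp is
   used only for the index type 'I_n and finite sums. *)
From Stdlib Require Export Reals.
From mathcomp Require Export ssreflect ssrfun ssrbool eqtype fintype bigop.
From Coquelicot Require Export Coquelicot.
Open Scope R_scope.
Set Implicit Arguments.
Unset Strict Implicit.
Unset Printing Implicit Defensive.

Notation banach := (CompleteNormedModule R_AbsRing).

Section Operators.
Variables U V : banach.

(* L belongs to L(U, V) and its operator norm is at most K. *)
Definition op_norm_le (L : U -> V) (K : R) : Prop :=
  is_linear L /\ forall x, norm (L x) <= K * norm x.

Definition embedding (j : U -> V) : Prop :=
  is_linear j /\ injective j /\ (forall x, norm (j x) <= norm x).

Definition dense_image (j : U -> V) : Prop :=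
  forall (y : V) (eps : R), 0 < eps -> exists x, norm (minus (j x) y) < eps.

End Operators.

(* For subspaces jU : U' -> U and jV : V' -> V, the map L : U -> V takes U' to
   V', with norm at most K as a map U' -> V'. *)
Definition restriction_norm_le (U' U V' V : banach) (jU : U' -> U)
    (jV : V' -> V) (L : U -> V) (K : R) : Prop :=
  forall x : U', exists y : V', jV y = L (jU x) /\ norm y <= K * norm x.

Definition banach_triple (B2 B1 B : banach) (j2 : B2 -> B1) (j1 : B1 -> B) :
    Prop :=
  embedding j2 /\ embedding j1 /\ dense_image j2 /\ dense_image j1.

Section Curves.
Variables (V : banach) (a T : R).

Definition on_interval (t : R) : Prop := a <= t <= T.

(* A member of C([a,T], V) is represented by any function R -> V that is
   continuous on [a,T]; its values off [a,T] are irrelevant, and two such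
   functions are identified when they agree on [a,T]. *)
Definition curve (b : R -> V) : Prop := continuous_on on_interval b.

Definition sup_norm (b : R -> V) : R :=
  real (Lub_Rbar (fun r => exists t, on_interval t /\ r = norm (b t))).

Definition curve_dist (b c : R -> V) : R :=
  sup_norm (fun t => minus (b t) (c t)).

End Curves.

Definition sum_norm (V : banach) (n : nat) (v : 'I_n -> V) : R :=
  \big[Rplus/0]_(i < n) norm (v i).

Definition vdist (V : banach) (n : nat) (v w : 'I_n -> V) : R :=
  sum_norm (fun i => minus (v i) (w i)).

Definition gradient (B2 B1 B : banach) (j2 : B2 -> B1) (j1 : B1 -> B) (n : nat)
    (D : 'I_n -> B1 -> B) : Prop :=
  forall i, op_norm_le (D i) 1 /\ restriction_norm_le j2 j1 (D i) 1.

Section Semigroups.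

Definition strongly_continuous_semigroup (V : banach) (E : R -> V -> V) :
    Prop :=
  (forall t, 0 <= t -> is_linear (E t)) /\
  (forall x, E 0 x = x) /\
  (forall s t x, 0 <= s -> 0 <= t -> E (s + t) x = E s (E t x)) /\
  (forall x, continuous_on (fun t => 0 <= t) (fun t => E t x)).

(* x is in the domain of the generator of E, which maps it to y. *)
Definition generator_at (V : banach) (E : R -> V -> V) (x y : V) : Prop :=
  filterlim (fun h => scal (/ h) (minus (E h x) x)) (at_right 0) (locally y).

(* The generator of E extends A, and the subspace j : B2 -> B is a core of it
   invariant under E. *)
Definition generates_with_invariant_core (B2 B : banach) (j : B2 -> B)
    (A : B2 -> B) (E : R -> B -> B) : Prop :=
  (forall x : B2, generator_at E (j x) (A x)) /\
  (forall (t : R) (x : B2), 0 <= t -> exists y : B2, j y = E t (j x)) /\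
  (forall x y : B, generator_at E x y -> forall eps, 0 < eps ->
     exists z : B2, norm (minus (j z) x) < eps /\ norm (minus (A z) y) < eps).

(* E is exp(At) on B and E1 is its restriction to B1.  The generator of E1 is
   then necessarily the part in B1 of the generator of E. *)
Definition generated_semigroup (B2 B1 B : banach) (j2 : B2 -> B1)
    (j1 : B1 -> B) (A : B2 -> B) (E : R -> B -> B) (E1 : R -> B1 -> B1)
    (M m M1 m1 : R) : Prop :=
  is_linear A /\
  strongly_continuous_semigroup E /\
  strongly_continuous_semigroup E1 /\
  (forall t x, 0 <= t -> j1 (E1 t x) = E t (j1 x)) /\
  generates_with_invariant_core (fun x => j1 (j2 x)) A E /\
  (0 <= M /\ 0 <= m /\ 0 <= M1 /\ 0 <= m1) /\
  (forall t, 0 <= t -> op_norm_le (E t) (M * exp (m * t))) /\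
  (forall t, 0 <= t -> op_norm_le (E1 t) (M1 * exp (m1 * t))).

Definition smoothing (B1 B : banach) (j1 : B1 -> B) (E : R -> B -> B)
    (kappa omega : R) : Prop :=
  (forall t, 0 < t -> forall x, exists y : B1, j1 y = E t x) /\
  (forall t, 0 < t <= 1 ->
     restriction_norm_le id j1 (E t) (kappa * Rpower t (- omega))).

End Semigroups.

Section MittagLeffler.

(* Rpower 0 p is 1, hence the explicit value at 0. *)
Definition power (x p : R) : R := if Rlt_dec 0 x then Rpower x p else 0.

Definition Cexp (z : C) : C :=
  (exp (Re z) * cos (Im z), exp (Re z) * sin (Im z)).

Definition stable_density (beta t x : R) : R :=
  / PI * Re (RInt_gen (V := C_R_CompleteNormedModule)
    (fun p => Cexp (Ci * RtoC (p * x)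
                    - RtoC (t * Rpower p beta) * Cexp (Ci * RtoC (PI * beta / 2)))%C)
    (at_right 0) (Rbar_locally p_infty)).

Variables (V : banach) (beta : R) (E : R -> V -> V).

(* E_beta(A tau) and E'_beta(A tau), for E the semigroup exp(At). *)
Definition mittag_leffler (tau : R) (v : V) : V :=
  scal (/ beta) (RInt_gen
    (fun x => scal (Rpower x (- 1 - / beta)
                    * stable_density beta 1 (Rpower x (- / beta)))
                   (E (tau * x) v))
    (at_right 0) (Rbar_locally p_infty)).

Definition mittag_leffler' (tau : R) (v : V) : V :=
  scal (/ beta) (RInt_gen
    (fun x => scal (Rpower x (- / beta)
                    * stable_density beta 1 (Rpower x (- / beta)))
                   (E (tau * x) v))
    (at_right 0) (Rbar_locally p_infty)).

(* The integral of g over (s, t), s <= t, improper at both ends, exists and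
   equals v.  The filters at_right s and at_left s do not describe an empty
   interval, so s = t is treated separately. *)
Definition is_integral (g : R -> V) (s t : R) (v : V) : Prop :=
  (s < t /\ is_RInt_gen g (at_right s) (at_left t) v) \/ (s = t /\ v = zero).

(* The curve x is the value on [a,T] of the mild formula with initial value y
   and source g. *)
Definition forward_mild (a T : R) (y : V) (g x : R -> V) : Prop :=
  forall t, a <= t <= T -> exists v,
    is_integral (fun s => scal (Rpower (t - s) (beta - 1))
                            (mittag_leffler' (power (t - s) beta) (g s))) a t v /\
    x t = plus (mittag_leffler (power (t - a) beta) y) (scal beta v).

Definition backward_mild (a T : R) (z : V) (g x : R -> V) : Prop :=
  forall t, a <= t <= T -> exists v,
    is_integral (fun s => scal (Rpower (s - t) (beta - 1))
                            (mittag_leffler' (power (s - t) beta) (g s))) t T v /\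
    x t = minus (mittag_leffler (power (T - t) beta) z) (scal beta v).

End MittagLeffler.

(* B^n is 'I_n -> B; the topology of fct_UniformSpace on it, that of uniform
   convergence, is the product topology as 'I_n is finite. *)
Definition forward_source (B Bcon : banach) (n : nat)
    (H : R -> B -> ('I_n -> B) -> Bcon -> B) (L L' Lpar : R) : Prop :=
  (forall p : R * B * ('I_n -> B) * Bcon,
     continuous (U := B)
       (fun q => H (fst (fst (fst q))) (snd (fst (fst q))) (snd (fst q)) (snd q))
       p) /\
  (forall t b0 b c0 c u,
     norm (minus (H t b0 b u) (H t c0 c u))
     <= L * (norm (minus b0 c0) + vdist b c) * (1 + L' * sum_norm b)) /\
  (forall t b0 b u w,
     norm (minus (H t b0 b u) (H t b0 b w))
     <= Lpar * norm (minus u w) * (1 + sum_norm b)) /\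
  (forall t b0 b u, norm (H t b0 b u) <= L * sum_norm b).

(* Here T is fixed, and the last argument of Hb is a curve in C([a,T], B). *)
Definition backward_source (B Bb : banach) (n : nat) (a T : R)
    (Hb : R -> Bb -> ('I_n -> Bb) -> (R -> B) -> Bb) (L L' : R) : Prop :=
  (forall t f0 f b, curve a T b -> forall eps, 0 < eps ->
     exists delta, 0 < delta /\
       forall s g0 g c, curve a T c ->
         Rabs (s - t) < delta -> norm (minus g0 f0) < delta ->
         vdist g f < delta -> curve_dist a T c b < delta ->
         norm (minus (Hb s g0 g c) (Hb t f0 f b)) < eps) /\
  (forall t f0 f b c, curve a T b -> curve a T c ->
     (forall s, a <= s <= T -> t <= s -> b s = c s) ->
     Hb t f0 f b = Hb t f0 f c) /\
  (forall t f0 f g0 g b, curve a T b ->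
     norm (minus (Hb t f0 f b) (Hb t g0 g b))
     <= L * (norm (minus f0 g0) + vdist f g) * (1 + L' * sum_norm f)) /\
  (forall t f0 f b c, curve a T b -> curve a T c ->
     norm (minus (Hb t f0 f b) (Hb t f0 f c))
     <= L * curve_dist a T b c * (1 + (norm f0 + sum_norm f))) /\
  (forall t f0 f b, curve a T b -> norm (Hb t f0 f b) <= L * sum_norm f).

Definition control (Bb Bcon : banach) (n : nat)
    (u : R -> Bb -> ('I_n -> Bb) -> Bcon) (L : R) : Prop :=
  (forall p : R * Bb * ('I_n -> Bb),
     continuous (U := Bcon) (fun q => u (fst (fst q)) (snd (fst q)) (snd q)) p) /\
  (forall t f0 f g0 g,
     norm (minus (u t f0 f) (u t g0 g)) <= L * (norm (minus f0 g0) + vdist f g)).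

(* The curves b, f take values in B1, B1b; the mild equations are identities in
   B, Bb, of which B1, B1b are subspaces through j1, j1b. *)
Definition mild_solution (B1 B B1b Bb Bcon : banach)
    (j1 : B1 -> B) (j1b : B1b -> Bb) (n : nat)
    (D : 'I_n -> B1 -> B) (Db : 'I_n -> B1b -> Bb)
    (E : R -> B -> B) (Eb : R -> Bb -> Bb)
    (H : R -> B -> ('I_n -> B) -> Bcon -> B)
    (Hb : R -> Bb -> ('I_n -> Bb) -> (R -> B) -> Bb)
    (u : R -> Bb -> ('I_n -> Bb) -> Bcon)
    (beta a T : R) (Y : B1) (Z : B1b) (b : R -> B1) (f : R -> B1b) : Prop :=
  curve a T b /\ curve a T f /\
  forward_mild beta E a T (j1 Y)
    (fun s => H s (j1 (b s)) (fun i => D i (b s))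
                (u s (j1b (f s)) (fun i => Db i (f s))))
    (fun t => j1 (b t)) /\
  backward_mild beta Eb a T (j1b Z)
    (fun s => Hb s (j1b (f s)) (fun i => Db i (f s)) (fun r => j1 (b r)))
    (fun t => j1b (f t)).

Definition has_unique_curves (B1 B1b : banach) (a T : R)
    (P : (R -> B1) -> (R -> B1b) -> Prop) : Prop :=
  (exists b f, P b f) /\
  (forall b f c g, P b f -> P c g ->
     forall t, a <= t <= T -> b t = c t /\ f t = g t).

Definition bounded_set (V : banach) (K : V -> Prop) : Prop :=
  exists r : R, forall x, K x -> norm x <= r.

(* Main.v *)
Require Import Defs.
From Stdlib Require Import Lra Classical ClassicalEpsilon.
Set Implicit Arguments.
Unset Strict Implicit.
Unset Printing Implicit Defensive.

(** With psi(z) = z^(-1-1/beta) G_beta(1, z^(-1/beta)), the operators E_beta(A tau) and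
    E'_beta(A tau) are averages of e^(A tau z) with weights psi(z) / beta and
    z psi(z) / beta, so everything rests on the bound |psi(z)| <= C exp(-l z).  It is
    obtained by moving the line of integration of the oscillatory integral defining
    G_beta(1, x) from Re s = 0 to Re s = 1/x and integrating twice by parts there,
    which gives |G_beta(1, x)| <= C x^(-1-beta) exp(-l x^(-beta)).  Averaging the smoothing
    estimate then bounds E'_beta(A tau) from B to B1 by C tau^(-omega) for small tau,
    the kernel of the mild equation has the integrable singularity
    (t - s)^(beta (1 - omega) - 1), and Picard iteration converges on a short interval.
    Since H and H^b grow linearly in the gradients, every mild solution on that
    interval lies in the ball where the iteration contracts: hence uniqueness and the
    Lipschitz dependence. *)

(** On the line Re s = 1/x the modulus of exp(s x) is the constant e while |s| >= 1/x, so that Re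
    s^beta >= cos(pi beta / 2) |s|^beta yields the factor exp(-l x^(-beta)), half of that decay
    being spent on powers of s. The integrations by parts supply x^(-2) and leave an integrand of
    size |s|^(beta-2), whose integral is of order x^(1-beta). The resulting power x^(-1-beta)
    cancels z^(-1-1/beta) exactly when x = z^(-1/beta). Complex analysis is replaced by real and
    imaginary parts: by the Cauchy-Riemann equations, the derivative in c of the integral along Re s
    = c is a difference of two endpoint values. The mild equations are identities in B, whereas the
    estimates live in B1. The integrals are therefore built in B1 and carried to B by the embedding,
    which commutes with integration and is injective. The growth exp(m1 tau z) of the semigroup must
    be beaten by the weight exp(-l z), which confines the linear theory to small tau. The integrals
    being improper Riemann integrals, dominated convergence is obtained from compactness instead of
    measure theory. *)

Lemma compact_uniform (T : Type) (G : (T -> Prop) -> Prop) {FG : Filter G}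
    (P : T -> R -> Prop) (x y : R) :
  x <= y ->
  (forall z, x <= z <= y -> exists d, 0 < d /\
     G (fun t => forall z', Rabs (z' - z) < d -> P t z')) ->
  G (fun t => forall z, x <= z <= y -> P t z).
Proof.
intros Hxy HP.
(* Compactness by a supremum: S collects the s for which one member of G serves all of [x, s]. At
   the supremum, two members of G are intersected to go further. *)
set (S := fun s => x <= s <= y /\ G (fun t => forall z, x <= z <= s -> P t z)).
assert (Sx : S x).
{ split; [lra|].
  destruct (HP x) as [d [Hd Hx]]; [lra|].
  apply: filter_imp Hx => t Ht z Hz.
  apply Ht; replace z with x by lra; rewrite Rminus_diag_eq // Rabs_R0; lra. }
destruct (completeness S) as [m [Hub Hlub]].
{ exists y; intros s [Hs _]; lra. }
{ by exists x. }
assert (Hm : x <= m <= y).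
{ split; [by apply Hub | apply Hlub; intros s [Hs _]; lra]. }
destruct (HP m Hm) as [d [Hd Gd]].
assert (exists s, S s /\ m - d < s) as [s [[Hs Gs] Hsm]].
{ apply NNPP => Hn.
  assert (m <= m - d); [apply Hlub => s Hs | lra].
  apply Rnot_lt_le => Hl; apply Hn; by exists s. }
assert (s <= m) by (apply Hub; split; auto).
assert (HS : forall s', m <= s' <= y -> s' < m + d -> S s').
{ intros s' H1 H2; split; [lra|].
  apply: (filter_imp _ _ _ (filter_and _ _ Gs Gd)) => t [Ha Hb] z Hz.
  destruct (Rle_dec z s) as [Hzs|Hzs]; [apply Ha; lra|].
  apply Hb, Rabs_lt_between'; lra. }
destruct (Rlt_dec m y) as [Hmy|Hmy].
- assert (Rmin y (m + d / 2) <= m); [|].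
  { apply Hub, HS; unfold Rmin; destruct Rle_dec; lra. }
  revert H0; unfold Rmin; destruct Rle_dec; lra.
- destruct (HS y) as [_ Hy]; [lra|lra|]. done.
Qed.

Lemma minus_split4 (V : NormedModule R_AbsRing) (p q r : V) :
  minus (plus p (plus q r)) q = plus p r.
Proof.
unfold minus. by rewrite (plus_comm q r) plus_assoc -(plus_assoc (plus p r)) plus_opp_r plus_zero_r.
Qed.

Lemma filterlim_norm (T : Type) (F : (T -> Prop) -> Prop) {FF : Filter F}
    (V : NormedModule R_AbsRing) (f : T -> V) (y : V) :
  filterlim f F (locally y) <->
  (forall eps, 0 < eps -> F (fun t => norm (minus (f t) y) < eps)).
Proof.
split => [Hf eps He|Hf].
- exact: (proj1 (filterlim_locally_ball_norm _ _) Hf (mkposreal _ He)).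
- apply/(proj2 (filterlim_locally_ball_norm _ _)) => eps; by case: eps => e He; apply Hf.
Qed.

Lemma norm_minus_trans (V : NormedModule R_AbsRing) (y x z : V) :
  norm (minus x z) <= norm (minus x y) + norm (minus y z).
Proof. rewrite (minus_trans y x z); exact: norm_triangle. Qed.

Lemma norm_minus_sym (V : NormedModule R_AbsRing) (x y : V) :
  norm (minus x y) = norm (minus y x).
Proof. by rewrite -norm_opp opp_minus. Qed.

Lemma ball_Rabs (x y e : R) : ball x e y -> Rabs (y - x) < e.
Proof. done. Qed.

(** * Improper Riemann integrals dominated by an integrable function *)

Section Improper.

(** The range and its two end filters stay abstract because two ranges occur: (0, oo) for averages
    over the semigroup and (0, 1) for the convolution in time. *)
Variables (I : R -> Prop) (Fa Fb : (R -> Prop) -> Prop).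
Context {FFa : ProperFilter Fa} {FFb : ProperFilter Fb}.
Hypothesis Iconv : forall x y z, I x -> I y -> x <= z <= y -> I z.
Hypothesis IFa : Fa I.
Hypothesis IFb : Fb I.
Hypothesis Ile : filter_prod Fa Fb (fun p => fst p <= snd p).

Definition dominated (V : banach) (phi : R -> R) (f : R -> V) : Prop :=
  forall x, I x -> continuous f x /\ norm (f x) <= phi x.

Lemma dominated_ex_RInt (V : banach) (f : R -> V) (x y : R) :
  (forall x, I x -> continuous f x) -> I x -> I y -> ex_RInt f x y.
Proof.
intros Hf Ix Iy; apply: ex_RInt_continuous => z Hz; apply Hf.
revert Hz; unfold Rmin, Rmax; destruct Rle_dec => Hz; eauto.
Qed.

Lemma is_RInt_gen_antiderivative (F f : R -> R) (la lb : R) :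
  (forall x, I x -> is_derive F x (f x)) -> (forall x, I x -> continuous f x) ->
  filterlim F Fa (locally la) -> filterlim F Fb (locally lb) ->
  is_RInt_gen f Fa Fb (lb - la).
Proof.
intros HF Hf Ha Hb.
apply/filterlimi_locally => eps.
assert (He : 0 < eps / 2) by (destruct eps; simpl; lra).
assert (A := proj1 (filterlim_locally _ _) Ha (mkposreal _ He)).
assert (B := proj1 (filterlim_locally _ _) Hb (mkposreal _ He)).
apply: (Filter_prod _ _ _ _ _ (filter_and _ _ IFa A) (filter_and _ _ IFb B)).
intros x y [Ix Hx] [Iy Hy]; exists (F y - F x); simpl; split.
- assert (HI : forall z, Rmin x y <= z <= Rmax x y -> I z).
  { intros z; unfold Rmin, Rmax; destruct Rle_dec => Hz; eauto. }
  apply: (is_RInt_derive (V := R_CompleteNormedModule) F); auto.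
- unfold ball in *; simpl in *; unfold AbsRing_ball, abs, minus, plus, opp in *; simpl in *.
  apply Rabs_def2 in Hx, Hy. apply Rabs_def1; lra.
Qed.

Variables (phi : R -> R) (l : R).
Hypothesis phi_cont : forall x, I x -> continuous phi x.
Hypothesis phi_int : is_RInt_gen phi Fa Fb l.

Lemma norm_RInt_dominated (V : banach) (f : R -> V) (x y : R) :
  dominated phi f -> I x -> I y ->
  norm (RInt f x y) <= Rabs (RInt phi x y).
Proof.
intros Hf.
assert (Hle : forall x y, I x -> I y -> x <= y ->
  norm (RInt f x y) <= Rabs (RInt phi x y)).
{ intros x' y' Ix Iy Hxy; apply Rle_trans with (2 := Rle_abs _).
  apply: (norm_RInt_le f phi) Hxy _ _ _.
  - intros z Hz; apply Hf; eauto.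
  - apply: RInt_correct; apply: dominated_ex_RInt => // z Iz; by apply Hf.
  - apply: RInt_correct; by apply: dominated_ex_RInt. }
intros Ix Iy; destruct (Rle_dec x y) as [H|H]; [by apply Hle|].
assert (E1 : ex_RInt f y x).
{ apply: dominated_ex_RInt => // z Iz; by apply Hf. }
assert (E2 : ex_RInt phi y x) by by apply: dominated_ex_RInt.
rewrite -(opp_RInt_swap f) // -(opp_RInt_swap phi) // norm_opp.
change (opp (RInt phi y x)) with (- RInt phi y x); rewrite Rabs_Ropp.
apply Hle => //; lra.
Qed.

(* The ends P, Q carry at most eps of the mass of phi, hence of any function
   dominated by phi. *)
Lemma dominated_tails (eps : R) : 0 < eps ->
  exists P Q, Fa P /\ Fb Q /\ (forall x, P x -> I x) /\ (forall x, Q x -> I x) /\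
    (forall x y, P x -> Q y -> x <= y) /\
    forall (V : banach) (f : R -> V), dominated phi f ->
    forall x x' y y', P x -> P x' -> Q y -> Q y' ->
    norm (minus (RInt f x' y') (RInt f x y)) <= eps.
Proof.
intros He.
(* Two integrals of [phi] within eps / 4 of l differ by less than eps / 2, and such a difference is
   the mass of one end piece. *)
assert (He4 : 0 < eps / 4) by lra.
destruct (proj1 (filterlimi_locally _ _) phi_int (mkposreal _ He4))
  as [P1 Q1 HP1 HQ1 H1].
destruct Ile as [P2 Q2 HP2 HQ2 H2].
exists (fun x => P1 x /\ P2 x /\ I x), (fun x => Q1 x /\ Q2 x /\ I x).
split; [by repeat apply filter_and|].
split; [by repeat apply filter_and|].
split; [tauto|]. split; [tauto|].
split; [intros x y [_ [Hx _]] [_ [Hy _]]; apply (H2 x y Hx Hy)|].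
intros V f Hf x x' y y' [Hx1 [_ Ix]] [Hx1' [_ Ix']] [Hy1 [_ Iy]] [Hy1' [_ Iy']].
assert (Cf : forall x, I x -> continuous f x) by (intros z Iz; by apply Hf).
assert (Hphi : forall x y, P1 x -> Q1 y -> Rabs (RInt phi x y - l) < eps / 4).
{ intros u v Hu Hv; destruct (H1 u v Hu Hv) as [z [Hz1 Hz2]].
  cbn in Hz1; rewrite (is_RInt_unique _ _ _ _ Hz1); exact Hz2. }
assert (E : forall u v, I u -> I v -> ex_RInt f u v)
  by (intros; by apply: dominated_ex_RInt).
assert (Ep : forall u v, I u -> I v -> ex_RInt phi u v)
  by (intros; by apply: dominated_ex_RInt).
rewrite -(RInt_Chasles f x' x y') //; try by apply E.
rewrite -(RInt_Chasles f x y y') //; try by apply E.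
rewrite (plus_comm (RInt f x y)) (plus_comm _ (RInt f x y)).
rewrite minus_split4.
apply: Rle_trans; [apply: norm_triangle|].
assert (Ha := norm_RInt_dominated Hf Ix' Ix).
assert (Hb := norm_RInt_dominated Hf Iy Iy').
assert (Hc := RInt_Chasles phi x' x y (Ep _ _ Ix' Ix) (Ep _ _ Ix Iy)).
assert (Hd := RInt_Chasles phi x y y' (Ep _ _ Ix Iy) (Ep _ _ Iy Iy')).
unfold plus in Hc, Hd; simpl in Hc, Hd.
assert (A1 := Hphi x' y Hx1' Hy1). assert (A2 := Hphi x y Hx1 Hy1).
assert (A3 := Hphi x y' Hx1 Hy1').
apply Rabs_def2 in A1, A2, A3.
assert (Rabs (RInt phi x' x) <= eps / 2) by (apply Rabs_le; lra).
assert (Rabs (RInt phi y y') <= eps / 2) by (apply Rabs_le; lra).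
lra.
Qed.

(** Convergence is the Cauchy criterion: moving the endpoints within the sets given by
    [dominated_tails] changes the integral by at most eps. *)
Lemma dominated_is_RInt_gen (V : banach) (f : R -> V) :
  dominated phi f ->
  is_RInt_gen f Fa Fb (RInt_gen f Fa Fb) /\ norm (RInt_gen f Fa Fb) <= l.
Proof.
intros Hf.
assert (Cf : forall x, I x -> continuous f x) by (intros z Iz; by apply Hf).
assert (Hex : ex_RInt_gen f Fa Fb).
{ apply (filterlimi_locally_cauchy (U := V)
    (fun ab : R * R => is_RInt f (fst ab) (snd ab))).
  { apply: (Filter_prod _ _ _ I I) => // x y Ix Iy; split.
    - by apply: dominated_ex_RInt.
    - intros v1 v2 h1 h2.
      by rewrite -(is_RInt_unique _ _ _ _ h1) -(is_RInt_unique _ _ _ _ h2). }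
  intros eps.
  assert (He : 0 < eps / 2) by (destruct eps; simpl; lra).
  destruct (dominated_tails He) as [P [Q [HP [HQ [_ [_ [_ Ht]]]]]]].
  exists (fun p => P (fst p) /\ Q (snd p)); split.
  { by apply: (Filter_prod _ _ _ P Q). }
  intros [x y] [x' y'] [Hx Hy] [Hx' Hy'] v v' Hv Hv'; simpl in *.
  apply: norm_compat1.
  rewrite -(is_RInt_unique _ _ _ _ Hv) -(is_RInt_unique _ _ _ _ Hv').
  apply: Rle_lt_trans; [by apply: (Ht V f Hf)|]. destruct eps; simpl in *; lra. }
assert (Hi := RInt_gen_correct f Hex).
split; [exact Hi|].
apply: (RInt_gen_norm f phi _ _ Ile _ Hi phi_int).
apply: (Filter_prod _ _ _ I I) => // x y Ix Iy z Hz; apply Hf.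
by apply: Iconv Hz.
Qed.

(** The truncation points depend on [phi] and eps alone, so that one compact interval serves a whole
    family of functions. *)
Lemma dominated_tail_RInt_gen (eps : R) : 0 < eps ->
  exists x y, I x /\ I y /\ x <= y /\
    forall (V : banach) (f : R -> V), dominated phi f ->
    norm (minus (RInt_gen f Fa Fb) (RInt f x y)) <= eps.
Proof.
intros He. assert (He2 : 0 < eps / 2) by lra.
destruct (dominated_tails He2) as [P [Q [HP [HQ [HPI [HQI [Hle Ht]]]]]]].
destruct (filter_ex _ HP) as [x Px]. destruct (filter_ex _ HQ) as [y Qy].
exists x, y; split; [auto|split; [auto|split;[auto|]]].
intros V f Hf.
destruct (dominated_is_RInt_gen Hf) as [Hi _].
(* Balls of the uniform structure and norm balls agree only up to [norm_factor], hence the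
   division. *)
assert (Hn : 0 < eps / 2 / @norm_factor _ V).
{ apply Rdiv_lt_0_compat => //. apply: norm_factor_gt_0. }
destruct (proj1 (filterlimi_locally _ _) Hi (mkposreal _ Hn)) as [P' Q' HP' HQ' H'].
destruct (filter_ex _ (filter_and _ _ HP HP')) as [x' [Px' Px'']].
destruct (filter_ex _ (filter_and _ _ HQ HQ')) as [y' [Qy' Qy'']].
destruct (H' x' y' Px'' Qy'') as [v [Hv Hb]]; simpl in Hv.
rewrite -(is_RInt_unique _ _ _ _ Hv) in Hb.
assert (Hb' := norm_compat2 _ _ _ Hb); simpl in Hb'.
assert (Hf0 := @norm_factor_gt_0 _ V).
replace (norm_factor * (eps / 2 / norm_factor)) with (eps / 2) in Hb' by (field; lra).
assert (Ht' := Ht V f Hf x x' y y' Px Px' Qy Qy').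
set (u := RInt_gen f Fa Fb) in *. set (w := RInt f x' y') in *.
apply: (Rle_trans _ _ _ (norm_minus_trans w _ _)).
apply Rle_trans with (eps / 2 + eps / 2); [|lra].
apply Rplus_le_compat; [rewrite norm_minus_sym; left; exact Hb'|exact Ht'].
Qed.

(** The tails are uniformly small, and on the remaining compact interval [compact_uniform] upgrades
    local closeness to uniform closeness. *)
Lemma dominated_convergence (T : Type) (G : (T -> Prop) -> Prop) {FG : Filter G}
    (V : banach) (F : T -> R -> V) (f : R -> V) :
  dominated phi f -> G (fun t => dominated phi (F t)) ->
  (forall x eps, I x -> 0 < eps -> exists d, 0 < d /\
     G (fun t => forall x', Rabs (x' - x) < d ->
          I x' -> norm (minus (F t x') (f x')) < eps)) ->
  filterlim (fun t => RInt_gen (F t) Fa Fb) G (locally (RInt_gen f Fa Fb)).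
Proof.
intros Hf HF Hloc.
apply/filterlim_norm => eps Heps.
assert (He3 : 0 < eps / 4) by lra.
destruct (dominated_tail_RInt_gen He3) as [x [y [Ix [Iy [Hxy Ht]]]]].
(* The summand 1 avoids a division by zero when x = y. *)
assert (He' : 0 < eps / 4 / (y - x + 1)) by (apply Rdiv_lt_0_compat; lra).
assert (HG : G (fun t => forall z, x <= z <= y ->
    (fun t z => I z -> norm (minus (F t z) (f z)) < eps / 4 / (y - x + 1)) t z)).
{ apply: compact_uniform => // z Hz. apply Hloc => //. eauto. }
apply: (filter_imp _ _ _ (filter_and _ _ HF HG)) => t [Hd Hu].
assert (C1 : forall x, I x -> continuous f x) by (intros z Iz; by apply Hf).
assert (C2 : forall x, I x -> continuous (F t) x) by (intros z Iz; by apply Hd).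
assert (E1 : ex_RInt f x y) by by apply: dominated_ex_RInt.
assert (E2 : ex_RInt (F t) x y) by by apply: dominated_ex_RInt.
assert (N3 : norm (minus (RInt (F t) x y) (RInt f x y)) <= eps / 4).
{ apply: Rle_trans.
  - apply: (norm_RInt_le_const (fun z => minus (F t z) (f z)) x y _ (eps / 4 / (y - x + 1))) => //.
    + intros z Hz; apply Rlt_le, Hu => //; eauto.
    + apply: is_RInt_minus; by apply: RInt_correct.
  - apply Rle_trans with ((y - x + 1) * (eps / 4 / (y - x + 1))).
    + apply Rmult_le_compat_r; lra.
    + right; field; lra. }
assert (N1 := Ht V f Hf). assert (N2 := Ht V (F t) Hd).
rewrite norm_minus_sym in N1.
apply: (Rle_lt_trans _ _ _ (norm_minus_trans (RInt (F t) x y) _ _)).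
apply Rle_lt_trans with (eps / 4 + (eps / 4 + eps / 4)); [|lra].
apply Rplus_le_compat; [exact N2|].
apply: (Rle_trans _ _ _ (norm_minus_trans (RInt f x y) _ _)).
apply Rplus_le_compat; [exact N3|exact N1].
Qed.

Lemma dominated_convergence_prod (T : Type) (G : (T -> Prop) -> Prop) {FG : Filter G}
    (V : banach) (F : T -> R -> V) (f : R -> V) :
  dominated phi f -> G (fun t => dominated phi (F t)) ->
  (forall x, I x -> filterlim (fun p => F (fst p) (snd p))
     (filter_prod G (locally x)) (locally (f x))) ->
  filterlim (fun t => RInt_gen (F t) Fa Fb) G (locally (RInt_gen f Fa Fb)).
Proof.
intros Hf HF Hlim. apply: dominated_convergence => // x eps Ix He.
assert (He2 : 0 < eps / 2) by lra.
destruct (proj1 (filterlim_norm _ _) (Hlim x Ix) _ He2) as [P Q HP HQ H].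
destruct (filter_and _ _ HQ (proj1 (filterlim_norm _ _) (proj1 (Hf x Ix)) _ He2)) as [d Hd].
exists d; split; [apply cond_pos|].
apply: filter_imp HP => t Pt x' Hx' Ix'.
destruct (Hd x' Hx') as [Qx Hfx].
apply: (Rle_lt_trans _ _ _ (norm_minus_trans (f x) _ _)).
rewrite (norm_minus_sym (f x)).
replace eps with (eps / 2 + eps / 2) by field.
apply Rplus_lt_compat; [exact (H t x' Pt Qx)|exact Hfx].
Qed.

End Improper.

(** * Integrals under linear maps and affine substitutions *)

Lemma is_RInt_linear (U V : banach) (L : U -> V) (f : R -> U) (a b : R) (v : U) :
  is_linear L -> is_RInt f a b v -> is_RInt (fun x => L (f x)) a b (L v).
Proof.
intros HL Hf. unfold is_RInt in *.
assert (L0 : L zero = zero).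
{ assert (H := linear_scal _ HL 0 zero). by rewrite !scal_zero_l in H. }
(* L commutes with every Riemann sum and, since [is_linear] includes boundedness, with their
   limit. *)
apply filterlim_ext with (fun ptd => L (scal (sign (b - a)) (Riemann_sum f ptd))).
{ intros ptd; rewrite (linear_scal _ HL); f_equal.
  apply (SF_cons_ind (fun ptd => L (Riemann_sum f ptd) = Riemann_sum (fun x => L (f x)) ptd)).
  - intros x; exact L0.
  - intros h s IH. rewrite !Riemann_sum_cons (linear_plus _ HL) (linear_scal _ HL) IH //. }
apply: filterlim_comp Hf _. by apply: (linear_cont L).
Qed.

Lemma is_RInt_gen_linear (U V : banach) (L : U -> V) (f : R -> U) Fa Fb
    {FFa : Filter Fa} {FFb : Filter Fb} (v : U) :
  is_linear L -> is_RInt_gen f Fa Fb v -> is_RInt_gen (fun x => L (f x)) Fa Fb (L v).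
Proof.
intros HL Hf P HP.
assert (HP' := linear_cont L v HL P HP).
destruct (Hf _ HP') as [A B HA HB H].
apply: (Filter_prod _ _ _ A B) => // x y Hx Hy.
destruct (H x y Hx Hy) as [w [H1 H2]].
exists (L w); split => //. by apply: is_RInt_linear.
Qed.

Lemma is_RInt_gen_comp_lin (V : banach) (f : R -> V) (u v : R) Fa Fb Ga Gb
    {FFa : Filter Fa} {FFb : Filter Fb} {FGa : Filter Ga} {FGb : Filter Gb} (l : V) :
  filterlim (fun x => u * x + v) Ga Fa -> filterlim (fun x => u * x + v) Gb Fb ->
  is_RInt_gen f Fa Fb l -> is_RInt_gen (fun y => scal u (f (u * y + v))) Ga Gb l.
Proof.
intros Ha Hb Hf P HP. destruct (Hf P HP) as [A B HA HB H].
apply: (Filter_prod _ _ _ (fun x => A (u * x + v)) (fun y => B (u * y + v))); [exact: (Ha A HA)|exact: (Hb B HB)|] => x y Hx Hy.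
destruct (H _ _ Hx Hy) as [w [H1 H2]]. exists w; split => //. by apply: is_RInt_comp_lin.
Qed.

(** * Modulus and argument of s = c + i p in the upper half plane *)

Definition log_mod (c p : R) : R := ln (c ^ 2 + p ^ 2) / 2.
(** The argument of c + i p for p > 0, in a form that is smooth across c = 0, where the original
    line of integration lies. *)
Definition angle (c p : R) : R := PI / 2 - atan (c / p).

Lemma ex_derive_continuity_pt (f : R -> R) (y : R) : ex_derive f y -> continuity_pt f y.
Proof. move=> Hf; apply/continuity_pt_filterlim; exact: ex_derive_continuous Hf. Qed.

Lemma sum_sq_pos (c p : R) : 0 < p -> 0 < c ^ 2 + p ^ 2.
Proof. intros; nra. Qed.

(** With the next three lemmas, the real form of the fact that log s has derivative 1 / s = (c - i
    p) / |s|^2. *)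
Lemma is_derive_log_mod_im (c p : R) : 0 < p ->
  is_derive (log_mod c) p (p / (c ^ 2 + p ^ 2)).
Proof.
intros Hp; assert (H := sum_sq_pos c Hp). unfold log_mod.
auto_derive; [lra|field; lra].
Qed.

Lemma is_derive_log_mod_re (c p : R) : 0 < p ->
  is_derive (fun c => log_mod c p) c (c / (c ^ 2 + p ^ 2)).
Proof.
intros Hp; assert (H := sum_sq_pos c Hp). unfold log_mod.
auto_derive; [lra|field; lra].
Qed.

Lemma is_derive_angle_im (c p : R) : 0 < p ->
  is_derive (angle c) p (c / (c ^ 2 + p ^ 2)).
Proof.
intros Hp; assert (H := sum_sq_pos c Hp). unfold angle.
auto_derive; [lra|]. unfold Rsqr. field; repeat split; try lra; nra.
Qed.

Lemma is_derive_angle_re (c p : R) : 0 < p ->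
  is_derive (fun c => angle c p) c (- p / (c ^ 2 + p ^ 2)).
Proof.
intros Hp; assert (H := sum_sq_pos c Hp). unfold angle.
auto_derive; [lra|]. unfold Rsqr. field; repeat split; try lra; nra.
Qed.

Lemma exp_log_mod (c p : R) : 0 < p -> exp (log_mod c p) = sqrt (c ^ 2 + p ^ 2).
Proof.
intros Hp; assert (H := sum_sq_pos c Hp).
rewrite -(sqrt_Rsqr (exp (log_mod c p))); [|left; apply exp_pos].
f_equal. unfold Rsqr, log_mod. rewrite -exp_plus.
replace (ln (c ^ 2 + p ^ 2) / 2 + ln (c ^ 2 + p ^ 2) / 2) with (ln (c ^ 2 + p ^ 2)) by field.
by apply exp_ln.
Qed.

Lemma sqrt_1_sqr (c p : R) : 0 < p ->
  sqrt (1 + (c / p)²) = sqrt (c ^ 2 + p ^ 2) / p.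
Proof.
intros Hp; assert (H := sum_sq_pos c Hp).
replace (1 + (c / p)²) with ((c ^ 2 + p ^ 2) / p ^ 2) by (unfold Rsqr; field; lra).
rewrite sqrt_div_alt; [|nra]. rewrite sqrt_pow2; lra.
Qed.

Lemma cos_angle (c p : R) : 0 < p ->
  exp (- log_mod c p) * cos (angle c p) = c / (c ^ 2 + p ^ 2).
Proof.
intros Hp; assert (H := sum_sq_pos c Hp).
unfold angle. rewrite cos_shift sin_atan sqrt_1_sqr // exp_Ropp exp_log_mod //.
assert (Hs := sqrt_lt_R0 _ H). rewrite -{3}(sqrt_sqrt (c ^ 2 + p ^ 2)); [|lra].
field; lra.
Qed.

Lemma sin_angle (c p : R) : 0 < p ->
  exp (- log_mod c p) * sin (angle c p) = p / (c ^ 2 + p ^ 2).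
Proof.
intros Hp; assert (H := sum_sq_pos c Hp).
unfold angle. rewrite sin_shift cos_atan sqrt_1_sqr // exp_Ropp exp_log_mod //.
assert (Hs := sqrt_lt_R0 _ H). rewrite -{3}(sqrt_sqrt (c ^ 2 + p ^ 2)); [|lra].
field; lra.
Qed.

Lemma atan_le (y : R) : 0 <= y -> atan y <= y.
Proof.
intros Hy.
destruct (MVT_gen atan 0 y (fun z => / (1 + z²))) as [z [Hz He]].
- intros z _; apply is_derive_atan.
- intros z _; apply derivable_continuous_pt, derivable_pt_atan.
- rewrite atan_0 in He.
  assert (/ (1 + z²) <= 1); [|nra].
  rewrite -[X in _ <= X]Rinv_1; apply Rinv_le_contravar; [lra|].
  assert (H := Rle_0_sqr z); lra.
Qed.

Lemma angle_range (c p : R) : 0 <= c -> 0 < p -> 0 <= angle c p <= PI / 2.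
Proof.
intros Hc Hp. unfold angle.
assert (0 <= c / p) by (apply Rdiv_le_0_compat; lra).
assert (H1 := atan_bound (c / p)).
assert (0 <= atan (c / p)); [|lra].
rewrite -atan_0; destruct (Req_dec (c / p) 0) as [->|Hn]; [lra|].
left; apply atan_increasing; lra.
Qed.

(** If p <= c, the argument is atan(p / c) <= p / c and |s| <= 2 c. Otherwise |s| <= 2 p, and the
    crude bound pi / 2 <= 2 is enough. The estimate controls the short side of the contour near the
    real axis. *)
Lemma angle_small (c p : R) : 0 <= c -> 0 < p ->
  angle c p <= 4 * p * exp (- log_mod c p).
Proof.
intros Hc Hp; assert (H := sum_sq_pos c Hp).
rewrite exp_Ropp exp_log_mod //.
assert (Hs := sqrt_lt_R0 _ H).
assert (Hss := sqrt_sqrt (c ^ 2 + p ^ 2) (Rlt_le _ _ H)).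
set (s := sqrt (c ^ 2 + p ^ 2)) in *.
apply (Rmult_le_reg_r s) => //.
rewrite Rmult_assoc Rinv_l; [|lra].
destruct (angle_range Hc Hp) as [Ha1 Ha2].
assert (HPI := PI_4).
destruct (Rle_dec p c) as [Hpc|Hpc].
- assert (Hcp : 0 < c) by lra.
  assert (angle c p <= p / c).
  { unfold angle. rewrite -atan_inv; [|apply Rdiv_lt_0_compat; lra].
    replace (/ (c / p)) with (p / c) by (field; lra).
    apply atan_le, Rdiv_le_0_compat; lra. }
  assert (s <= 2 * c) by nra.
  apply Rle_trans with (p / c * (2 * c)).
  + apply Rmult_le_compat; lra.
  + replace (p / c * (2 * c)) with (2 * p) by (field; lra). lra.
- assert (s <= 2 * p) by nra.
  apply Rle_trans with (2 * (2 * p)); [|lra].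
  apply Rmult_le_compat; lra.
Qed.

Lemma log_mod_ge_im (c p : R) : 0 < p -> ln p <= log_mod c p.
Proof.
intros Hp. unfold log_mod.
assert (ln (p ^ 2) <= ln (c ^ 2 + p ^ 2)).
{ apply ln_le; nra. }
replace (p ^ 2) with (p * p) in H at 1 by ring. rewrite ln_mult // in H. lra.
Qed.

Lemma log_mod_ge_re (c p : R) : 0 < c -> ln c <= log_mod c p.
Proof.
intros Hp. unfold log_mod.
assert (ln (c ^ 2) <= ln (c ^ 2 + p ^ 2)).
{ apply ln_le; nra. }
replace (c ^ 2) with (c * c) in H at 1 by ring. rewrite ln_mult // in H. lra.
Qed.

(** Replaces |s| by an affine function of p, whose powers have an explicit antiderivative. *)
Lemma log_mod_ge_mean (c p : R) : 0 < c -> 0 < p -> ln ((c + p) / 2) <= log_mod c p.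
Proof.
intros Hc Hp. unfold log_mod.
assert (0 < (c + p) / 2) by lra.
assert (ln (((c + p) / 2) * ((c + p) / 2)) <= ln (c ^ 2 + p ^ 2)).
{ apply ln_le; nra. }
rewrite ln_mult // in H0. lra.
Qed.

(** * The integrand exp(s x - s^beta) s^g: contour shift and integration by parts *)

Section Stable.

Variable beta : R.
Hypothesis Hbeta : 0 < beta < 1.

(* With s = c + i p: exp(s x - s^beta) s^g has modulus exp (re_exponent x g c p)
   and argument im_exponent x g c p. *)
Definition re_exponent (x g c p : R) : R :=
  c * x - exp (beta * log_mod c p) * cos (beta * angle c p) + g * log_mod c p.
Definition im_exponent (x g c p : R) : R :=
  p * x - exp (beta * log_mod c p) * sin (beta * angle c p) + g * angle c p.
Definition re_integrand (x g c p : R) : R :=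
  exp (re_exponent x g c p) * cos (im_exponent x g c p).
Definition im_integrand (x g c p : R) : R :=
  exp (re_exponent x g c p) * sin (im_exponent x g c p).

(** Lowering g by one is a division by s, that is, a multiplication by (c - i p) / |s|^2. *)
Lemma re_integrand_div (x g c p : R) : 0 < p ->
  re_integrand x (g - 1) c p =
  exp (re_exponent x g c p) *
    (cos (im_exponent x g c p) * (c / (c ^ 2 + p ^ 2)) +
     sin (im_exponent x g c p) * (p / (c ^ 2 + p ^ 2))).
Proof.
intros Hp. unfold re_integrand.
replace (re_exponent x (g - 1) c p) with (re_exponent x g c p + - log_mod c p)
  by (unfold re_exponent; ring).
replace (im_exponent x (g - 1) c p) with (im_exponent x g c p - angle c p)
  by (unfold im_exponent; ring).
rewrite exp_plus cos_minus -(cos_angle c Hp) -(sin_angle c Hp). ring.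
Qed.

(* The complex derivative of exp(s x - s^beta) s^g. *)
Definition re_derivative (x g c p : R) : R :=
  x * re_integrand x g c p - beta * re_integrand x (g + beta - 1) c p
  + g * re_integrand x (g - 1) c p.

Lemma re_derivative_eq (x g c p : R) : 0 < p ->
  let r := c ^ 2 + p ^ 2 in
  let K := exp (re_exponent x g c p) in
  let C := cos (im_exponent x g c p) in
  let S := sin (im_exponent x g c p) in
  let B := exp (beta * log_mod c p) in
  re_derivative x g c p =
  x * K * C
  - beta * (K * B * ((C * cos (beta * angle c p) - S * sin (beta * angle c p)) * (c / r)
      + (S * cos (beta * angle c p) + C * sin (beta * angle c p)) * (p / r)))
  + g * (K * (C * (c / r) + S * (p / r))).
Proof.
intros Hp r K C S B. unfold re_derivative.
rewrite !re_integrand_div //.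
replace (re_exponent x (g + beta) c p) with (re_exponent x g c p + beta * log_mod c p)
  by (unfold re_exponent; ring).
replace (im_exponent x (g + beta) c p) with (im_exponent x g c p + beta * angle c p)
  by (unfold im_exponent; ring).
rewrite exp_plus cos_plus sin_plus. unfold re_integrand. fold r K C S B. ring.
Qed.

(** Cauchy-Riemann: for a holomorphic F, the p-derivative of Im F and the c-derivative of Re F are
    both Re F'. This agreement with [is_derive_re_integrand] is what makes the contour movable. *)
Lemma is_derive_im_integrand (x g c p : R) : 0 < p ->
  is_derive (im_integrand x g c) p (re_derivative x g c p).
Proof.
intros Hp.
assert (HL := is_derive_log_mod_im c Hp). assert (HA := is_derive_angle_im c Hp).
rewrite re_derivative_eq //. unfold im_integrand, re_exponent, im_exponent.
auto_derive.
- repeat split; by eexists; eassumption.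
- change (fun x0 => log_mod c x0) with (log_mod c).
  change (fun x0 => angle c x0) with (angle c).
  rewrite (is_derive_unique _ _ _ HL) (is_derive_unique _ _ _ HA).
  unfold Rdiv, Rminus. ring.
Qed.

Lemma is_derive_re_integrand (x g c p : R) : 0 < p ->
  is_derive (fun c => re_integrand x g c p) c (re_derivative x g c p).
Proof.
intros Hp.
assert (HL := is_derive_log_mod_re c Hp). assert (HA := is_derive_angle_re c Hp).
rewrite re_derivative_eq //. unfold re_integrand, re_exponent, im_exponent.
auto_derive.
- repeat split; by eexists; eassumption.
- rewrite (is_derive_unique _ _ _ HL) (is_derive_unique _ _ _ HA).
  unfold Rdiv, Rminus. ring.
Qed.

Lemma continuity_2d_log_mod (c p : R) : 0 < p -> continuity_2d_pt log_mod c p.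
Proof.
intros Hp. unfold log_mod, Rdiv.
apply continuity_2d_pt_mult; [|apply continuity_2d_pt_const].
apply (continuity_1d_2d_pt_comp ln (fun c p => c ^ 2 + p ^ 2)).
- apply continuity_pt_filterlim, continuous_ln. by apply sum_sq_pos.
- apply continuity_2d_pt_plus.
  + apply (continuity_1d_2d_pt_comp (fun x => x ^ 2) (fun c p => c)).
    * apply derivable_continuous_pt, derivable_pt_pow.
    * apply continuity_2d_pt_id1.
  + apply (continuity_1d_2d_pt_comp (fun x => x ^ 2) (fun c p => p)).
    * apply derivable_continuous_pt, derivable_pt_pow.
    * apply continuity_2d_pt_id2.
Qed.

Lemma continuity_2d_angle (c p : R) : 0 < p -> continuity_2d_pt angle c p.
Proof.
intros Hp. unfold angle, Rdiv.
apply continuity_2d_pt_minus; [apply continuity_2d_pt_const|].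
apply (continuity_1d_2d_pt_comp atan (fun c p => c * / p)).
- apply derivable_continuous_pt, derivable_pt_atan.
- apply continuity_2d_pt_mult; [apply continuity_2d_pt_id1|].
  apply continuity_2d_pt_inv; [apply continuity_2d_pt_id2|lra].
Qed.

Lemma continuity_2d_re_integrand (x g c p : R) : 0 < p ->
  continuity_2d_pt (re_integrand x g) c p.
Proof.
intros Hp.
assert (HL := continuity_2d_log_mod c Hp). assert (HA := continuity_2d_angle c Hp).
unfold re_integrand.
apply continuity_2d_pt_mult.
- apply (continuity_1d_2d_pt_comp exp (re_exponent x g)).
  { apply derivable_continuous_pt, derivable_pt_exp. }
  apply continuity_2d_pt_plus.
  + apply continuity_2d_pt_minus.
    * apply continuity_2d_pt_mult; [apply continuity_2d_pt_id1|apply continuity_2d_pt_const].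
    * apply continuity_2d_pt_mult.
      -- by apply (continuity_1d_2d_pt_comp (fun y => exp (beta * y)) log_mod); [apply ex_derive_continuity_pt; auto_derive|].
      -- by apply (continuity_1d_2d_pt_comp (fun y => cos (beta * y)) angle); [apply ex_derive_continuity_pt; auto_derive|].
  + apply continuity_2d_pt_mult; [apply continuity_2d_pt_const|done].
- apply (continuity_1d_2d_pt_comp cos (im_exponent x g)).
  { apply derivable_continuous_pt, derivable_pt_cos. }
  apply continuity_2d_pt_plus.
  + apply continuity_2d_pt_minus.
    * apply continuity_2d_pt_mult; [apply continuity_2d_pt_id2|apply continuity_2d_pt_const].
    * apply continuity_2d_pt_mult.
      -- by apply (continuity_1d_2d_pt_comp (fun y => exp (beta * y)) log_mod); [apply ex_derive_continuity_pt; auto_derive|].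
      -- by apply (continuity_1d_2d_pt_comp (fun y => sin (beta * y)) angle); [apply ex_derive_continuity_pt; auto_derive|].
  + apply continuity_2d_pt_mult; [apply continuity_2d_pt_const|done].
Qed.

Lemma continuous_re_integrand (x g c p : R) : 0 < p -> continuous (re_integrand x g c) p.
Proof.
intros Hp.
have /continuity_2d_pt_filterlim H := continuity_2d_re_integrand x g c Hp.
apply: (filterlim_comp _ _ _ (fun p => (c, p)) (fun z => re_integrand x g z.1 z.2)); [|exact H].
move=> P [eps HP]; exists eps => y Hy; apply HP; split; [apply: ball_center|exact Hy].
Qed.

Lemma cos_beta_pos : 0 < cos (PI * beta / 2).
Proof. assert (H := PI_RGT_0). apply cos_gt_0; nra. Qed.

(** For c >= 0 the argument of s lies in [0, pi / 2], so the real part of s^beta is at least cos(pi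
    beta / 2) |s|^beta. *)
Lemma re_exponent_le (x g c p : R) : 0 <= c -> 0 < p ->
  re_exponent x g c p <=
  c * x - cos (PI * beta / 2) * exp (beta * log_mod c p) + g * log_mod c p.
Proof.
intros Hc Hp. unfold re_exponent.
assert (H := PI_RGT_0). assert (Ha := angle_range Hc Hp).
assert (H1 : 0 <= beta * angle c p <= PI * beta / 2) by (split; nra).
assert (H2 : PI * beta / 2 <= PI) by nra.
assert (cos (PI * beta / 2) <= cos (beta * angle c p)) by (apply cos_decr_1; lra).
assert (He := exp_pos (beta * log_mod c p)). nra.
Qed.

(** The middle term is |s|^beta sin(beta arg s) <= |s|^beta arg s <= 4 p |s|^(beta-1) <= 4 p^beta,
    by [angle_small]. For g = 0 the whole bound vanishes as p tends to 0, uniformly in c. *)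
Lemma im_exponent_le (x g c p : R) : 0 < x -> 0 <= c -> 0 < p ->
  Rabs (im_exponent x g c p) <=
  x * p + 4 * exp (beta * ln p) + Rabs g * (4 * p * exp (- log_mod c p)).
Proof.
intros Hx Hc Hp. unfold im_exponent.
assert (Ha := angle_range Hc Hp). assert (Hs := angle_small Hc Hp).
assert (HPI := PI_RGT_0). assert (HPI4 := PI_4).
assert (E1 : 0 <= exp (beta * log_mod c p) * sin (beta * angle c p) <= 4 * exp (beta * ln p)).
{ assert (H1 : 0 <= beta * angle c p <= PI) by (split; nra).
  assert (0 <= sin (beta * angle c p)) by (apply sin_ge_0; lra).
  assert (sin (beta * angle c p) <= beta * angle c p).
  { destruct (Req_dec (angle c p) 0) as [->|Hn]; [rewrite Rmult_0_r sin_0; lra|].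
    left; apply sin_lt_x; nra. }
  assert (He := exp_pos (beta * log_mod c p)).
  split; [apply Rmult_le_pos; lra|].
  apply Rle_trans with (exp (beta * log_mod c p) * (4 * p * exp (- log_mod c p))).
  { assert (beta * angle c p <= angle c p) by nra.
    apply Rmult_le_compat_l; lra. }
  replace (exp (beta * log_mod c p) * (4 * p * exp (- log_mod c p)))
    with (4 * (p * exp ((beta - 1) * log_mod c p))).
  2: { replace ((beta - 1) * log_mod c p) with (beta * log_mod c p + - log_mod c p) by ring.
       rewrite exp_plus; ring. }
  apply Rmult_le_compat_l; [lra|].
  rewrite -{1}(exp_ln p) // -exp_plus.
  assert (Hl := log_mod_ge_im c Hp).
  destruct (Req_dec (log_mod c p) (ln p)) as [->|Hn].
  - right; f_equal; ring.
  - left; apply exp_increasing; nra. }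
assert (E2 : Rabs (g * angle c p) <= Rabs g * (4 * p * exp (- log_mod c p))).
{ rewrite Rabs_mult (Rabs_pos_eq (angle c p)); [|lra].
  apply Rmult_le_compat_l => //; apply Rabs_pos. }
apply: Rle_trans; [apply Rabs_triang|].
apply Rplus_le_compat => //.
assert (0 < x * p) by nra.
assert (0 < exp (beta * ln p)) by apply exp_pos.
apply Rabs_le; nra.
Qed.

Lemma Rabs_sin_le (y : R) : Rabs (sin y) <= Rabs y.
Proof.
assert (H : forall y, 0 <= y -> Rabs (sin y) <= y).
{ clear y; intros y Hy.
  destruct (Rle_dec 1 y) as [H1|H1].
  - apply Rle_trans with (2 := H1); apply Rabs_le, SIN_bound.
  - assert (HPI := PI2_1).
    rewrite Rabs_pos_eq; [|apply sin_ge_0; lra].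
    destruct (Req_dec y 0) as [->|Hn]; [rewrite sin_0; lra|left; apply sin_lt_x; lra]. }
destruct (Rle_dec 0 y) as [H1|H1].
- rewrite (Rabs_pos_eq y) //; auto.
- rewrite -(Rabs_Ropp y) -(Rabs_Ropp (sin y)) -sin_neg (Rabs_pos_eq (- y)); [|lra].
  apply H; lra.
Qed.

Lemma Rabs_im_integrand_le (x g c p : R) :
  Rabs (im_integrand x g c p) <= exp (re_exponent x g c p) * Rabs (im_exponent x g c p).
Proof.
unfold im_integrand. rewrite Rabs_mult (Rabs_pos_eq (exp _)); [|left; apply exp_pos].
apply Rmult_le_compat_l; [left; apply exp_pos|apply Rabs_sin_le].
Qed.

Lemma Rabs_im_integrand_le_exp (x g c p : R) :
  Rabs (im_integrand x g c p) <= exp (re_exponent x g c p).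
Proof.
unfold im_integrand. rewrite Rabs_mult (Rabs_pos_eq (exp _)); [|left; apply exp_pos].
rewrite -{2}(Rmult_1_r (exp _)).
apply Rmult_le_compat_l; [left; apply exp_pos|apply Rabs_le, SIN_bound].
Qed.

Lemma Rabs_re_integrand_le_exp (x g c p : R) :
  Rabs (re_integrand x g c p) <= exp (re_exponent x g c p).
Proof.
unfold re_integrand. rewrite Rabs_mult (Rabs_pos_eq (exp _)); [|left; apply exp_pos].
rewrite -{2}(Rmult_1_r (exp _)).
apply Rmult_le_compat_l; [left; apply exp_pos|apply Rabs_le, COS_bound].
Qed.

Lemma continuous_re_derivative (x g c p : R) : 0 < p -> continuous (re_derivative x g c) p.
Proof.
intros Hp. unfold re_derivative.
apply: continuous_plus; [apply: continuous_minus|];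
  apply: continuous_scal_r; by apply continuous_re_integrand.
Qed.

Lemma RInt_re_derivative (x g c e r : R) : 0 < e -> e < r ->
  is_RInt (re_derivative x g c) e r (im_integrand x g c r - im_integrand x g c e).
Proof.
intros He Hr.
apply: (is_RInt_derive (V := R_CompleteNormedModule) (im_integrand x g c)).
- intros p Hp; apply is_derive_im_integrand.
  rewrite Rmin_left in Hp; lra.
- intros p Hp; apply continuous_re_derivative. rewrite Rmin_left in Hp; lra.
Qed.

Lemma ex_RInt_re_integrand (x g c e r : R) : 0 < e -> e < r ->
  ex_RInt (re_integrand x g c) e r.
Proof.
intros He Hr. apply: ex_RInt_continuous => p Hp; apply continuous_re_integrand.
rewrite Rmin_left in Hp; lra.
Qed.

(** Cauchy's theorem for a rectangle in infinitesimal form: differentiation under the integral gives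
    Re F', which is also the p-derivative of Im F and integrates to endpoint values. *)
Lemma is_derive_RInt_re_integrand (x c e r : R) : 0 < e -> e < r ->
  is_derive (fun c => RInt (re_integrand x 0 c) e r) c
    (im_integrand x 0 c r - im_integrand x 0 c e).
Proof.
intros He Hr.
assert (Hm : forall p, Rmin e r <= p <= Rmax e r -> 0 < p).
{ intros p Hp; rewrite Rmin_left in Hp; lra. }
rewrite -(is_RInt_unique _ _ _ _ (@RInt_re_derivative x 0 c e r He Hr)).
rewrite -(RInt_ext (fun p => Derive (fun c => re_integrand x 0 c p) c)).
2: { intros p Hp; apply is_derive_unique, is_derive_re_integrand, Hm; lra. }
apply: is_derive_RInt_param.
- apply: filter_forall => c' p Hp. eexists; by apply is_derive_re_integrand, Hm.
- intros p Hp.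
  apply continuity_2d_pt_ext_loc with (re_derivative x 0).
  { exists (mkposreal _ (Hm p Hp)) => /= c' p' _ Hp'. symmetry.
    apply is_derive_unique, is_derive_re_integrand. apply Rabs_def2 in Hp'; lra. }
  specialize (Hm p Hp).
  unfold re_derivative. apply continuity_2d_pt_plus; [apply continuity_2d_pt_minus|];
   (apply continuity_2d_pt_mult; [apply continuity_2d_pt_const|by apply continuity_2d_re_integrand]).
- apply: filter_forall => c'. by apply ex_RInt_re_integrand.
Qed.

(* Shifting the line of integration from Re s = 0 to Re s = c changes the
   integral only by the two short sides of the rectangle. *)
Lemma RInt_shift (x c e r : R) : 0 < x -> 0 < c -> 0 < e -> e < r ->
  Rabs (RInt (re_integrand x 0 0) e r) <=
  Rabs (RInt (re_integrand x 0 c) e r) +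
  c * (exp (c * x) * (exp (- cos (PI * beta / 2) * exp (beta * ln r)) +
       x * e + 4 * exp (beta * ln e))).
Proof.
intros Hx Hc He Hr.
(* The mean value theorem yields an unknown abscissa d in [0, c]; the bounds on the two short sides
   below therefore hold for every such d. *)
destruct (MVT_gen (fun c => RInt (re_integrand x 0 c) e r) 0 c
  (fun c => im_integrand x 0 c r - im_integrand x 0 c e)) as [d [Hd Hm]].
- intros d _. by apply is_derive_RInt_re_integrand.
- intros d _. apply ex_derive_continuity_pt.
  eexists; by apply is_derive_RInt_re_integrand.
- rewrite Rmin_left in Hd; [|lra]. rewrite Rmax_right in Hd; [|lra].
  assert (Hk := cos_beta_pos).
  assert (Hcx : exp (d * x) <= exp (c * x)).
  { destruct (Req_dec d c) as [->|Hn]; [lra|left; apply exp_increasing; nra]. }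
  assert (Hr' : Rabs (im_integrand x 0 d r) <=
    exp (c * x) * exp (- cos (PI * beta / 2) * exp (beta * ln r))).
  { apply: Rle_trans; [apply Rabs_im_integrand_le_exp|].
    rewrite -exp_plus.
    assert (Hrr : 0 < r) by lra.
    assert (H1 := re_exponent_le x 0 (proj1 Hd) Hrr).
    assert (H2 := log_mod_ge_im d Hrr).
    assert (exp (beta * ln r) <= exp (beta * log_mod d r)).
    { destruct (Req_dec (ln r) (log_mod d r)) as [->|Hn]; [lra|left; apply exp_increasing; nra]. }
    assert (re_exponent x 0 d r <= c * x + - cos (PI * beta / 2) * exp (beta * ln r)) by nra.
    destruct H0 as [H0| ->]; [left; by apply exp_increasing|lra]. }
  assert (He' : Rabs (im_integrand x 0 d e) <= exp (c * x) * (x * e + 4 * exp (beta * ln e))).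
  { apply: Rle_trans; [apply Rabs_im_integrand_le|].
    assert (H1 := re_exponent_le x 0 (proj1 Hd) He).
    assert (H2 := im_exponent_le 0 Hx (proj1 Hd) He).
    rewrite Rabs_R0 in H2.
    assert (H3 := exp_pos (beta * log_mod d e)).
    apply Rmult_le_compat; [left; apply exp_pos|apply Rabs_pos| |lra].
    apply Rle_trans with (2 := Hcx).
    assert (re_exponent x 0 d e <= d * x) by nra.
    destruct H as [H| ->]; [left; by apply exp_increasing|lra]. }
  rewrite Rminus_0_r in Hm.
  set (J0 := RInt (re_integrand x 0 0) e r) in *.
  set (J1 := RInt (re_integrand x 0 c) e r) in *.
  replace J0 with (J1 - (im_integrand x 0 d r - im_integrand x 0 d e) * c) by lra.
  apply: Rle_trans; [apply Rabs_triang|].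
  apply Rplus_le_compat_l.
  rewrite Rabs_Ropp Rabs_mult (Rabs_pos_eq c); [|lra].
  rewrite Rmult_comm. apply Rmult_le_compat_l; [lra|].
  apply: Rle_trans; [apply Rabs_triang|]. rewrite Rabs_Ropp. lra.
Qed.

(** Both integrations by parts at once: x times the identity of [RInt_re_derivative] for g = 0 plus
    beta times the one for g = beta - 1, in which the terms with s^(beta-1) cancel. *)
Lemma RInt_by_parts (x c e r : R) : 0 < e -> e < r ->
  x ^ 2 * RInt (re_integrand x 0 c) e r =
  (x * im_integrand x 0 c r + beta * im_integrand x (beta - 1) c r)
  - (x * im_integrand x 0 c e + beta * im_integrand x (beta - 1) c e)
  + RInt (fun p => beta ^ 2 * re_integrand x (2 * beta - 2) c p
                   + beta * (1 - beta) * re_integrand x (beta - 2) c p) e r.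
Proof.
intros He Hr.
assert (I0 := @RInt_re_derivative x 0 c e r He Hr).
assert (I1 := @RInt_re_derivative x (beta - 1) c e r He Hr).
assert (E : forall g, ex_RInt (re_integrand x g c) e r).
{ intros g. by apply ex_RInt_re_integrand. }
set (J := fun p => beta ^ 2 * re_integrand x (2 * beta - 2) c p
                   + beta * (1 - beta) * re_integrand x (beta - 2) c p).
assert (I2 : is_RInt J e r (RInt J e r)).
{ apply: RInt_correct. apply: ex_RInt_plus; apply: ex_RInt_scal; apply: E. }
apply (is_RInt_scal _ _ _ x) in I0.
apply (is_RInt_scal _ _ _ beta) in I1.
assert (I3 := is_RInt_plus _ _ _ _ _ _ (is_RInt_plus _ _ _ _ _ _ I0 I1) I2).
assert (I4 : is_RInt (fun p => scal (x ^ 2) (re_integrand x 0 c p)) e r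
  (scal (x ^ 2) (RInt (re_integrand x 0 c) e r))).
{ apply: is_RInt_scal. apply: RInt_correct; apply: E. }
assert (H : is_RInt (fun p => scal (x ^ 2) (re_integrand x 0 c p)) e r
  (plus (plus (scal x (im_integrand x 0 c r - im_integrand x 0 c e))
     (scal beta (im_integrand x (beta - 1) c r - im_integrand x (beta - 1) c e))) (RInt J e r))).
{ apply: is_RInt_ext I3 => p _. unfold J, re_derivative, plus, scal; simpl; unfold mult; simpl.
  replace (0 + beta - 1) with (beta - 1) by ring.
  replace (beta - 1 + beta - 1) with (2 * beta - 2) by ring.
  replace (beta - 1 - 1) with (beta - 2) by ring. ring. }
assert (H1 := is_RInt_unique _ _ _ _ H). assert (H2 := is_RInt_unique _ _ _ _ I4).
unfold plus, scal in H1, H2; simpl in H1, H2; unfold mult in H1, H2; simpl in H1, H2.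
simpl. lra.
Qed.

Lemma exp_le (y z : R) : y <= z -> exp y <= exp z.
Proof. intros [H| ->]; [left; by apply exp_increasing|lra]. Qed.

(** Half of the decay pays for the factor y. With y = |s|^beta this trades the power s^(2 beta - 2)
    for s^(beta-2). *)
Lemma mul_exp_le (k y : R) : 0 < k -> y * exp (- k * y) <= 2 / k * exp (- k / 2 * y).
Proof.
intros Hk.
replace (- k * y) with (- k / 2 * y + - k / 2 * y) by field. rewrite exp_plus.
assert (H := exp_ineq1_le (k / 2 * y)).
assert (H1 := exp_pos (- k / 2 * y)).
assert (y * exp (- k / 2 * y) <= 2 / k); [|nra].
replace (- k / 2 * y) with (- (k / 2 * y)) by field. rewrite exp_Ropp.
apply (Rmult_le_reg_r (exp (k / 2 * y) * k)); [apply Rmult_lt_0_compat; [apply exp_pos|lra]|].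
assert (H2 := exp_pos (k / 2 * y)).
replace (y * / exp (k / 2 * y) * (exp (k / 2 * y) * k)) with (2 * (k / 2 * y)) by (field; lra).
replace (2 / k * (exp (k / 2 * y) * k)) with (2 * exp (k / 2 * y)) by (field; lra).
lra.
Qed.

(** Since c x = 1, the factor exp(c x) is e. Half of the decay in |s|^beta is kept and, by |s| >= c,
    becomes a constant in p; |s| >= (c + p) / 2 bounds the remaining power. *)
Lemma by_parts_integrand_le (x c p : R) : 0 < c -> 0 < p -> c * x = 1 ->
  let k := cos (PI * beta / 2) in
  Rabs (beta ^ 2 * re_integrand x (2 * beta - 2) c p
        + beta * (1 - beta) * re_integrand x (beta - 2) c p) <=
  (2 / k + 1) * exp 1 * exp (- k / 2 * exp (beta * ln c))
  * exp ((beta - 2) * ln ((c + p) / 2)).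
Proof.
intros Hc Hp Hcx k. assert (Hk : 0 < k) by apply cos_beta_pos.
set (l := log_mod c p). set (y := exp (beta * l)).
assert (Hy : 0 < y) by apply exp_pos.
assert (Hl := log_mod_ge_re p Hc). assert (Hm := log_mod_ge_mean Hc Hp).
fold l in Hl, Hm.
assert (Hyc : exp (beta * ln c) <= y) by (apply exp_le; nra).
assert (Hm' : exp ((beta - 2) * l) <= exp ((beta - 2) * ln ((c + p) / 2))) by (apply exp_le; nra).
assert (Hky : exp (- k / 2 * y) <= exp (- k / 2 * exp (beta * ln c))) by (apply exp_le; nra).
assert (Hc0 : 0 <= c) by lra.
assert (H1 : Rabs (re_integrand x (2 * beta - 2) c p) <=
   2 / k * exp 1 * exp (- k / 2 * y) * exp ((beta - 2) * l)).
{ apply: Rle_trans; [apply Rabs_re_integrand_le_exp|].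
  apply: Rle_trans; [apply exp_le, re_exponent_le => //|]. fold k l y.
  replace (c * x - k * y + (2 * beta - 2) * l)
    with (1 + (- k * y) + (beta * l) + (beta - 2) * l) by lra.
  rewrite !exp_plus. fold y.
  assert (H := mul_exp_le y Hk).
  assert (H0 := exp_pos 1). assert (H2 := exp_pos ((beta - 2) * l)).
  assert (H3 : exp 1 * exp ((beta - 2) * l) * (y * exp (- k * y)) <=
     exp 1 * exp ((beta - 2) * l) * (2 / k * exp (- k / 2 * y))).
  { apply Rmult_le_compat_l => //; nra. }
  lra. }
assert (H2 : Rabs (re_integrand x (beta - 2) c p) <=
   exp 1 * exp (- k / 2 * y) * exp ((beta - 2) * l)).
{ apply: Rle_trans; [apply Rabs_re_integrand_le_exp|].
  apply: Rle_trans; [apply exp_le, re_exponent_le => //|]. fold k l y.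
  rewrite -!exp_plus. apply exp_le. nra. }
set (Q := exp 1 * exp (- k / 2 * y) * exp ((beta - 2) * l)) in *.
assert (HQ : 0 < Q) by (repeat apply Rmult_lt_0_compat; apply exp_pos).
assert (H2k : 0 < 2 / k) by (apply Rdiv_lt_0_compat; lra).
apply Rle_trans with ((2 / k + 1) * Q).
- apply: Rle_trans; [apply Rabs_triang|].
  rewrite (Rabs_mult (beta ^ 2)) (Rabs_mult (beta * (1 - beta))).
  rewrite (Rabs_pos_eq (beta ^ 2)); [|nra]. rewrite (Rabs_pos_eq (beta * (1 - beta))); [|nra].
  replace (2 / k * exp 1 * exp (- k / 2 * y) * exp ((beta - 2) * l))
    with (2 / k * Q) in H1 by (unfold Q; ring).
  assert (beta ^ 2 <= 1) by nra. assert (0 <= beta * (1 - beta) <= 1) by nra.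
  assert (A1 := Rabs_pos (re_integrand x (2 * beta - 2) c p)).
  assert (A2 := Rabs_pos (re_integrand x (beta - 2) c p)).
  assert (0 <= 2 / k * Q) by nra.
  nra.
- replace ((2 / k + 1) * exp 1 * exp (- k / 2 * exp (beta * ln c)) * exp ((beta - 2) * ln ((c + p) / 2)))
   with ((2 / k + 1) * (exp 1 * exp (- k / 2 * exp (beta * ln c)) * exp ((beta - 2) * ln ((c + p) / 2)))) by ring.
  apply Rmult_le_compat_l; [lra|]. unfold Q.
  apply Rmult_le_compat => //; try (left; apply exp_pos).
  + apply Rmult_le_pos; left; apply exp_pos.
  + apply Rmult_le_compat_l => //; left; apply exp_pos.
Qed.

Lemma RInt_power_le (c e r : R) : 0 < c -> 0 < e -> e < r ->
  exists v, is_RInt (fun p => exp ((beta - 2) * ln ((c + p) / 2))) e r v /\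
    v <= 4 / (1 - beta) * exp ((beta - 1) * ln c).
Proof.
intros Hc He Hr.
set (F := fun p => - 2 / (1 - beta) * exp ((beta - 1) * ln ((c + p) / 2))).
exists (F r - F e). split.
- apply: (is_RInt_derive (V := R_CompleteNormedModule) F).
  + intros p Hp; rewrite Rmin_left in Hp; [|lra]. unfold F.
    assert (0 < (c + p) / 2) by lra.
    auto_derive; [lra|].
    replace ((beta - 2) * ln ((c + p) / 2)) with ((beta - 1) * ln ((c + p) * / 2) + - ln ((c + p) / 2))
      by (unfold Rdiv; ring).
    rewrite exp_plus exp_Ropp exp_ln //. field. lra.
  + intros p Hp; rewrite Rmin_left in Hp; [|lra].
    apply: ex_derive_continuous. auto_derive. lra.
- unfold F.
  (* One factor 2 of the constant 4 is 2^(1 - beta) <= 2; the other comes from the antiderivative in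
     (c + p) / 2. *)
  assert (H1 : exp ((beta - 1) * ln ((c + e) / 2)) <= 2 * exp ((beta - 1) * ln c)).
  { rewrite -{2}(exp_ln 2); [|lra]. rewrite -exp_plus. apply exp_le.
    assert (ln (c / 2) <= ln ((c + e) / 2)) by (apply ln_le; lra).
    rewrite ln_div in H; [|lra|lra].
    assert (0 < ln 2) by (rewrite -ln_1; apply ln_increasing; lra). nra. }
  assert (H2 := exp_pos ((beta - 1) * ln ((c + r) / 2))).
  assert (H3 : 0 < 2 / (1 - beta)) by (apply Rdiv_lt_0_compat; lra).
  replace (-2 / (1 - beta)) with (- (2 / (1 - beta))) by (field; lra).
  replace (4 / (1 - beta)) with (2 * (2 / (1 - beta))) by (field; lra).
  nra.
Qed.

(** Only K survives the limit e -> 0, r -> oo, so only K has to be uniform in x; all boundary terms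
    are collected in A, which may depend on x. The power is x^(-2) from the integrations by parts
    times c^(beta-1) = x^(1-beta). *)
Lemma RInt_re_integrand_le : exists K, 0 <= K /\ forall x, 0 < x ->
  exists A, 0 <= A /\ forall e r, 0 < e <= 1 -> 1 < r ->
  Rabs (RInt (re_integrand x 0 0) e r) <=
  K * (/ x ^ 2 * exp ((1 - beta) * ln x)
       * exp (- cos (PI * beta / 2) / 2 * exp (- beta * ln x)))
  + A * (exp (beta * ln e) + exp (- cos (PI * beta / 2) * exp (beta * ln r))).
Proof.
set (k := cos (PI * beta / 2)). assert (Hk : 0 < k) by apply cos_beta_pos.
assert (H2k : 0 < 2 / k) by (apply Rdiv_lt_0_compat; lra).
assert (H4b : 0 < 4 / (1 - beta)) by (apply Rdiv_lt_0_compat; lra).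
assert (He1 := exp_pos 1).
exists ((2 / k + 1) * exp 1 * (4 / (1 - beta))). split.
{ repeat apply Rmult_le_pos; lra. }
intros x Hx.
set (c := / x). assert (Hc : 0 < c) by by apply Rinv_0_lt_compat.
assert (Hcx : c * x = 1) by (unfold c; field; lra).
assert (Hx2 : 0 < / x ^ 2) by (apply Rinv_0_lt_compat; nra).
set (q := exp ((beta - 1) * ln c)). assert (Hq : 0 < q) by apply exp_pos.
exists (c * exp 1 * (x + 4) + / x ^ 2 * exp 1 * ((x + q) * (x + 4 + 4 * x) + (x + 1))).
split.
{ apply Rplus_le_le_0_compat; repeat apply Rmult_le_pos; try lra.
  apply Rplus_le_le_0_compat; [apply Rmult_le_pos|]; lra. }
intros e r [He He'] Hr. assert (Her : e < r) by lra. assert (Hr0 : 0 < r) by lra.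
set (rho := exp (beta * ln e)). set (s := exp (- k * exp (beta * ln r))).
assert (Hs : 0 < s) by apply exp_pos.
assert (Herho : e <= rho).
{ rewrite -{1}(exp_ln e) //. apply exp_le.
  assert (ln e <= 0) by (rewrite -ln_1; by apply ln_le). nra. }
assert (Hsh := RInt_shift Hx Hc He Her). fold k rho s in Hsh.
rewrite Hcx in Hsh.
assert (Hbp := RInt_by_parts x c He Her).
destruct (RInt_power_le Hc He Her) as [v [Hv1 Hv2]].
set (X := RInt (fun p => beta ^ 2 * re_integrand x (2 * beta - 2) c p
                   + beta * (1 - beta) * re_integrand x (beta - 2) c p) e r) in *.
set (w := exp (- k / 2 * exp (beta * ln c))).
assert (Hw : 0 < w) by apply exp_pos.
assert (HX : Rabs X <= (2 / k + 1) * exp 1 * w * v).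
{ apply: (norm_RInt_le (V := R_NormedModule) _ (fun p => (2 / k + 1) * exp 1 * w * exp ((beta - 2) * ln ((c + p) / 2)))
     e r X ((2 / k + 1) * exp 1 * w * v)); first lra.
  - intros p Hp. assert (Hp0 : 0 < p) by lra. exact: (by_parts_integrand_le Hc Hp0 Hcx).
  - apply: RInt_correct. apply: ex_RInt_plus; apply: ex_RInt_scal; by apply: ex_RInt_re_integrand.
  - apply: is_RInt_scal. exact Hv1. }
assert (HX' : Rabs X <= (2 / k + 1) * exp 1 * (4 / (1 - beta)) * (q * w)).
{ apply: Rle_trans; [exact HX|].
  replace ((2 / k + 1) * exp 1 * (4 / (1 - beta)) * (q * w)) with
    ((2 / k + 1) * exp 1 * w * (4 / (1 - beta) * q)) by ring.
  apply Rmult_le_compat_l => //. repeat apply Rmult_le_pos; lra. }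
assert (Hc0 : 0 <= c) by lra.
assert (HVr : forall g, g <= 0 -> Rabs (im_integrand x g c r) <= exp 1 * s).
{ intros g Hg. apply: Rle_trans; [apply Rabs_im_integrand_le_exp|].
  unfold s; rewrite -exp_plus. apply exp_le.
  apply: Rle_trans; [by apply re_exponent_le|]. fold k. rewrite Hcx.
  assert (Hl := log_mod_ge_im c Hr0).
  assert (0 < ln r) by (rewrite -ln_1; apply ln_increasing; lra).
  assert (exp (beta * ln r) <= exp (beta * log_mod c r)) by (apply exp_le; nra).
  nra. }
(* Near the real axis |s| >= c bounds |s|^g by c^g and 1 / |s| by x; the small argument provides the
   factor e^beta. *)
assert (HVe : forall g, -1 <= g <= 0 ->
   Rabs (im_integrand x g c e) <= exp 1 * exp (g * ln c) * ((x + 4 + 4 * x) * rho)).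
{ intros g Hg. apply: Rle_trans; [apply Rabs_im_integrand_le|].
  assert (Hl := log_mod_ge_re e Hc).
  apply Rmult_le_compat; [left; apply exp_pos|apply Rabs_pos| |].
  - rewrite -exp_plus; apply exp_le.
    apply: Rle_trans; [by apply re_exponent_le|]. fold k. rewrite Hcx.
    assert (H := Rmult_lt_0_compat _ _ Hk (exp_pos (beta * log_mod c e))).
    assert (g * log_mod c e <= g * ln c) by nra. lra.
  - apply: Rle_trans; [by apply im_exponent_le|]. fold rho.
    assert (exp (- log_mod c e) <= x).
    { rewrite -(exp_ln x) //. apply exp_le.
      assert (ln c = - ln x) by by apply ln_Rinv. lra. }
    assert (H0 := exp_pos (- log_mod c e)).
    assert (Rabs g <= 1) by (apply Rabs_le; lra).
    assert (Rabs g * (4 * e * exp (- log_mod c e)) <= 1 * (4 * rho * x)).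
    { apply Rmult_le_compat => //; [apply Rabs_pos|nra|].
      apply Rmult_le_compat; nra. }
    nra. }
assert (V1 := HVr 0 (Rle_refl _)). assert (V2 : Rabs (im_integrand x (beta - 1) c r) <= exp 1 * s) by (apply HVr; lra).
assert (V3 : Rabs (im_integrand x 0 c e) <= exp 1 * ((x + 4 + 4 * x) * rho)).
{ replace (exp 1) with (exp 1 * exp (0 * ln c)) by (rewrite Rmult_0_l exp_0; ring). apply HVe; lra. }
assert (V4 : Rabs (im_integrand x (beta - 1) c e) <= exp 1 * q * ((x + 4 + 4 * x) * rho)) by (apply HVe; lra).
set (J := RInt (re_integrand x 0 c) e r) in *.
assert (HJ : x ^ 2 * Rabs J <= (2 / k + 1) * exp 1 * (4 / (1 - beta)) * (q * w)
  + exp 1 * ((x + q) * (x + 4 + 4 * x) * rho + (x + 1) * s)).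
{ rewrite -(Rabs_pos_eq (x ^ 2)); [|nra]. rewrite -Rabs_mult Hbp.
  assert (Hb : forall y z, Rabs (x * y + beta * z) <= x * Rabs y + Rabs z).
  { intros y z. apply: Rle_trans; [apply Rabs_triang|]. rewrite !Rabs_mult (Rabs_pos_eq x) ?(Rabs_pos_eq beta); try lra.
    assert (H := Rabs_pos z). nra. }
  apply: Rle_trans; [apply Rabs_triang|]. rewrite Rplus_comm.
  apply Rplus_le_compat => //.
  apply: Rle_trans; [apply Rabs_triang|]. rewrite Rabs_Ropp.
  assert (B1 := Hb (im_integrand x 0 c r) (im_integrand x (beta - 1) c r)).
  assert (B2 := Hb (im_integrand x 0 c e) (im_integrand x (beta - 1) c e)).
  assert (x * Rabs (im_integrand x 0 c r) <= x * (exp 1 * s)) by (apply Rmult_le_compat_l; lra).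
  assert (x * Rabs (im_integrand x 0 c e) <= x * (exp 1 * ((x + 4 + 4 * x) * rho))) by (apply Rmult_le_compat_l; lra).
  lra. }
assert (HJ' : Rabs J <= / x ^ 2 * ((2 / k + 1) * exp 1 * (4 / (1 - beta)) * (q * w)
  + exp 1 * ((x + q) * (x + 4 + 4 * x) * rho + (x + 1) * s))).
{ apply (Rmult_le_reg_l (x ^ 2)); [nra|]. rewrite -Rmult_assoc Rinv_r; [lra|nra]. }
replace (exp ((1 - beta) * ln x)) with q.
2: { unfold q, c. rewrite ln_Rinv //. f_equal; ring. }
replace (exp (- k / 2 * exp (- beta * ln x))) with w.
2: { unfold w, c. rewrite ln_Rinv //. do 3 f_equal; ring. }
assert (P1 : c * (exp 1 * (s + x * e + 4 * rho)) <= c * exp 1 * (x + 4) * (rho + s)).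
{ rewrite !Rmult_assoc. apply Rmult_le_compat_l => //. apply Rmult_le_compat_l; [lra|]. nra. }
assert (P2 : / x ^ 2 * (exp 1 * ((x + q) * (x + 4 + 4 * x) * rho + (x + 1) * s)) <=
  / x ^ 2 * exp 1 * ((x + q) * (x + 4 + 4 * x) + (x + 1)) * (rho + s)).
{ rewrite !Rmult_assoc. apply Rmult_le_compat_l; [lra|]. apply Rmult_le_compat_l; [lra|].
  assert (0 < (x + q) * (x + 4 + 4 * x)) by (apply Rmult_lt_0_compat; lra). nra. }
rewrite Rmult_plus_distr_l in HJ'.
lra.
Qed.

End Stable.

(** * Model improper integrals on the half line *)

Definition positive (x : R) : Prop := 0 < x.

Lemma positive_convex (x y z : R) : positive x -> positive y -> x <= z <= y -> positive z.
Proof. unfold positive; lra. Qed.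

Lemma at_right_positive : at_right 0 positive.
Proof. by exists (mkposreal _ Rlt_0_1). Qed.

Lemma p_infty_positive : Rbar_locally p_infty positive.
Proof. by exists 0. Qed.

Lemma at_right_lt (x y : R) : x < y -> at_right x (fun z => z < y).
Proof.
intros H. assert (Hd : 0 < y - x) by lra. exists (mkposreal _ Hd) => z Hz _.
apply Rabs_def2 in Hz; unfold minus, plus, opp in Hz; simpl in Hz; lra.
Qed.

Lemma at_left_gt (x y : R) : y < x -> at_left x (fun z => y < z).
Proof.
intros H. assert (Hd : 0 < x - y) by lra. exists (mkposreal _ Hd) => z Hz _.
apply Rabs_def2 in Hz; unfold minus, plus, opp in Hz; simpl in Hz; lra.
Qed.

Lemma positive_ends_le :
  filter_prod (at_right 0) (Rbar_locally p_infty) (fun p => p.1 <= p.2).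
Proof.
apply: (Filter_prod _ _ _ (fun z => z < 1) (fun z => 1 < z)).
- apply at_right_lt; lra.
- by exists 1.
- simpl; intros; lra.
Qed.

Lemma filterlim_at_right (F : R -> R) (x : R) : ex_derive F x ->
  filterlim F (at_right x) (locally (F x)).
Proof.
intros H. apply: (filterlim_filter_le_1 _ (filter_le_within _)).
exact: (ex_derive_continuous F).
Qed.

Lemma is_RInt_gen_exp (l : R) : 0 < l ->
  is_RInt_gen (fun z => exp (- l * z)) (at_right 0) (Rbar_locally p_infty) (/ l).
Proof.
intros Hl.
set (F := fun z => - / l * exp (- l * z)).
replace (/ l) with (0 - F 0) by (unfold F; rewrite Rmult_0_r exp_0; ring).
apply (is_RInt_gen_antiderivative positive_convex at_right_positive p_infty_positive
  (F := F)); unfold F.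
- intros z _. auto_derive; [done|field; lra].
- intros z _. apply: ex_derive_continuous; by auto_derive.
- apply: filterlim_at_right. by auto_derive.
- apply/filterlim_norm => eps He. exists (/ (l * l * eps)) => z Hz.
  assert (Hll : 0 < l * l * eps) by (repeat apply Rmult_lt_0_compat; lra).
  assert (Hz0 : 0 < z) by (assert (H := Rinv_0_lt_compat _ Hll); lra).
  unfold norm, minus, plus, opp; simpl; unfold abs; simpl.
  replace (- / l * exp (- l * z) + - 0) with (- (/ l * exp (- l * z))) by ring.
  rewrite Rabs_Ropp Rabs_pos_eq.
  2: { apply Rmult_le_pos; left; [by apply Rinv_0_lt_compat|apply exp_pos]. }
  replace (- l * z) with (- (l * z)) by ring. rewrite exp_Ropp.
  assert (H1 := exp_ineq1_le (l * z)).
  assert (Hlz : 0 < l * z) by by apply Rmult_lt_0_compat.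
  apply Rle_lt_trans with (/ l * / (l * z)).
  { apply Rmult_le_compat_l; [left; by apply Rinv_0_lt_compat|]. apply Rinv_le_contravar; lra. }
  rewrite -Rinv_mult. apply (Rmult_lt_reg_r (l * (l * z))); [by apply Rmult_lt_0_compat|].
  rewrite Rinv_l; [|nra].
  apply (Rmult_lt_compat_r (l * l * eps)) in Hz => //. rewrite Rinv_l in Hz; [|lra]. lra.
Qed.

Lemma is_RInt_gen_inv_sqr :
  is_RInt_gen (fun p => / (1 + p) ^ 2) (at_right 0) (Rbar_locally p_infty) 1.
Proof.
set (F := fun z => - / (1 + z)).
assert (E : 0 - F 0 = 1) by (unfold F; rewrite Rplus_0_r Rinv_1; ring).
assert (H : is_RInt_gen (fun p => / (1 + p) ^ 2) (at_right 0) (Rbar_locally p_infty) (0 - F 0));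
  [clear E|by rewrite E in H].
apply (is_RInt_gen_antiderivative positive_convex at_right_positive p_infty_positive
  (F := F)); unfold F.
- intros z Hz; unfold positive in Hz. auto_derive; [lra|field; lra].
- intros z Hz; unfold positive in Hz.
  apply: ex_derive_continuous. auto_derive. nra.
- apply: filterlim_at_right. auto_derive. lra.
- apply/filterlim_norm => eps He. exists (/ eps) => z Hz.
  assert (H := Rinv_0_lt_compat _ He).
  unfold norm, minus, plus, opp; simpl; unfold abs; simpl.
  replace (- / (1 + z) + - 0) with (- / (1 + z)) by ring.
  assert (H1 : 0 < / (1 + z)) by (apply Rinv_0_lt_compat; lra).
  rewrite Rabs_Ropp Rabs_pos_eq; [|lra].
  rewrite -(Rinv_inv eps). apply Rinv_lt_contravar; [nra|lra].
Qed.

(** * The stable density: exponential bound and Lipschitz continuity *)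

Section Density.

Variable beta : R.
Hypothesis Hbeta : 0 < beta < 1.
Let k := cos (PI * beta / 2).

(** The third power leaves the integrable (1 + p)^(-2) even after a factor p, which appears when the
    density is differentiated in x. *)
Lemma exp_decay : exists C, 0 <= C /\ forall p, 0 < p ->
  exp (- k * exp (beta * ln p)) * (1 + p) ^ 3 <= C.
Proof.
assert (Hk : 0 < k) by by apply cos_beta_pos.
(* For p > 1 and y = ln p, (1 + p)^3 <= 8 exp(3 y) and exp(beta y) >= (beta y)^2 / 4; the maximum of
   3 y - k (beta y)^2 / 4 is 9 / (k beta^2). *)
exists (8 * exp (9 / (k * beta ^ 2))); split.
{ apply Rmult_le_pos; [lra|left; apply exp_pos]. }
intros p Hp. set (y := ln p).
assert (He := exp_pos (beta * y)).
assert (Hkb : 0 < k * beta ^ 2) by (apply Rmult_lt_0_compat => //; nra).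
assert (H9 : 0 < 9 / (k * beta ^ 2)) by (apply Rdiv_lt_0_compat; lra).
destruct (Rle_dec p 1) as [H1|H1].
- apply Rle_trans with (1 * 8).
  + apply Rmult_le_compat; [left; apply exp_pos|apply pow_le; lra| |].
    * rewrite -exp_0; apply exp_le; nra.
    * replace 8 with (2 ^ 3) by ring. apply pow_incr; lra.
  + assert (1 < exp (9 / (k * beta ^ 2))) by (rewrite -exp_0; by apply exp_increasing). lra.
- assert (Hy : 0 < y) by (unfold y; rewrite -ln_1; apply ln_increasing; lra).
  apply Rle_trans with (exp (- k * exp (beta * y)) * (8 * exp (3 * y))).
  + apply Rmult_le_compat_l; [left; apply exp_pos|].
    replace (exp (3 * y)) with (p ^ 3).
    2: { replace (3 * y) with (y + y + y) by ring. rewrite !exp_plus /y exp_ln //. ring. }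
    replace (8 * p ^ 3) with ((2 * p) ^ 3) by ring. apply pow_incr; lra.
  + replace (exp (- k * exp (beta * y)) * (8 * exp (3 * y)))
      with (8 * (exp (- k * exp (beta * y)) * exp (3 * y))) by ring.
    rewrite -exp_plus. apply Rmult_le_compat_l; [lra|]. apply exp_le.
    assert (Hb : (beta * y) ^ 2 / 4 <= exp (beta * y)).
    { replace (beta * y) with (beta * y / 2 + beta * y / 2) at 2 by field.
      rewrite exp_plus. assert (H := exp_ineq1_le (beta * y / 2)).
      assert (0 < beta * y) by nra. nra. }
    apply (Rmult_le_reg_r (k * beta ^ 2)) => //.
    replace (9 / (k * beta ^ 2) * (k * beta ^ 2)) with 9 by (field; nra).
    assert (k * ((beta * y) ^ 2 / 4) <= k * exp (beta * y)) by nra.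
    assert (0 <= (k * beta ^ 2 * y - 6) ^ 2) by apply pow2_ge_0.
    assert (- k * exp (beta * y) + 3 * y <= 3 * y - k * ((beta * y) ^ 2 / 4)) by lra.
    apply Rle_trans with ((3 * y - k * ((beta * y) ^ 2 / 4)) * (k * beta ^ 2)); [nra|]. nra.
Qed.

Lemma log_mod_0 (p : R) : 0 < p -> log_mod 0 p = ln p.
Proof.
intros Hp. unfold log_mod. replace (0 ^ 2 + p ^ 2) with (p * p) by ring.
rewrite ln_mult //. field.
Qed.

Lemma angle_0 (p : R) : angle 0 p = PI / 2.
Proof. unfold angle. rewrite /Rdiv Rmult_0_l atan_0. ring. Qed.

Lemma re_exponent_0 (x p : R) : 0 < p -> re_exponent beta x 0 0 p = - k * exp (beta * ln p).
Proof.
intros Hp. unfold re_exponent. rewrite log_mod_0 // angle_0.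
replace (beta * (PI / 2)) with (PI * beta / 2) by field. fold k. ring.
Qed.

Lemma im_exponent_0 (x p : R) : 0 < p ->
  im_exponent beta x 0 0 p = p * x - exp (beta * ln p) * sin (PI * beta / 2).
Proof.
intros Hp. unfold im_exponent. rewrite log_mod_0 // angle_0.
replace (beta * (PI / 2)) with (PI * beta / 2) by field. ring.
Qed.

(** The factor 1 is the time argument, kept so that the term unfolds to the integrand of
    [stable_density] at t = 1. *)
Definition density_integrand (x p : R) : C :=
  Cexp (Ci * RtoC (p * x) - RtoC (1 * Rpower p beta) * Cexp (Ci * RtoC (PI * beta / 2)))%C.

(** For s = i p one has s^beta = p^beta exp(i pi beta / 2), so the density is an integral of exp(s x
    - s^beta) along the imaginary axis. *)
Lemma density_integrand_eq (x p : R) : 0 < p ->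
  density_integrand x p = (re_integrand beta x 0 0 p, im_integrand beta x 0 0 p).
Proof.
intros Hp. unfold density_integrand, re_integrand, im_integrand.
rewrite re_exponent_0 // im_exponent_0 //.
set (y := PI * beta / 2).
assert (E : Cexp (Ci * RtoC y) = (k, sin y)).
{ unfold Cexp, Ci, RtoC, Cmult, Re, Im; simpl.
  replace (0 * y - 1 * 0) with 0 by ring. replace (0 * 0 + 1 * y) with y by ring.
  rewrite exp_0 !Rmult_1_l //. }
rewrite E. unfold Rpower.
unfold Cexp, Ci, RtoC, Cmult, Cminus, Cplus, Copp, Re, Im; simpl.
set (q := exp (beta * ln p)).
replace (0 * (p * x) - 1 * 0 + - (1 * q * k - 0 * sin y)) with (- k * q) by ring.
by replace (0 * 0 + 1 * (p * x) + - (1 * q * sin y + 0 * k)) with (p * x - q * sin y) by ring.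
Qed.

Lemma inv_sqr_bound (C e p : R) : 0 < p -> e * (1 + p) ^ 3 <= C -> 0 <= e -> p * e <= C * / (1 + p) ^ 2.
Proof.
intros Hp H He. apply (Rmult_le_reg_r ((1 + p) ^ 2)); [apply pow_lt; lra|].
rewrite (Rmult_assoc C) Rinv_l ?Rmult_1_r; [|apply pow_nonzero; lra].
apply Rle_trans with (2 := H).
assert (0 <= e * (1 + p) ^ 2) by (apply Rmult_le_pos => //; apply pow_le; lra).
simpl in *. nra.
Qed.

Lemma inv_sqr_bound' (C e p : R) : 0 < p -> e * (1 + p) ^ 3 <= C -> 0 <= e -> e <= C * / (1 + p) ^ 2.
Proof.
intros Hp H He. apply (Rmult_le_reg_r ((1 + p) ^ 2)); [apply pow_lt; lra|].
rewrite (Rmult_assoc C) Rinv_l ?Rmult_1_r; [|apply pow_nonzero; lra].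
apply Rle_trans with (2 := H).
assert (0 <= e * (1 + p) ^ 2) by (apply Rmult_le_pos => //; apply pow_le; lra).
simpl in *. nra.
Qed.

Lemma continuous_inv_sqr (C x : R) : positive x -> continuous (fun p => C * / (1 + p) ^ 2) x.
Proof.
intros Hx; unfold positive in Hx. apply: ex_derive_continuous. auto_derive. nra.
Qed.

(** [RInt_gen] is total, so its value in the definition means something only once the complex
    integral is known to converge. Domination by [exp_decay] gives that, and Re, being linear,
    passes under the integral. *)
Lemma is_RInt_gen_density (x : R) :
  is_RInt_gen (re_integrand beta x 0 0) (at_right 0) (Rbar_locally p_infty)
    (PI * stable_density beta 1 x).
Proof.
destruct exp_decay as [C [HC Hd]].
assert (Hphi := is_RInt_gen_scal _ C _ is_RInt_gen_inv_sqr).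
assert (Hcont : forall p, positive p -> continuous (im_integrand beta x 0 0) p).
{ intros p Hp. apply: ex_derive_continuous. eexists. by apply is_derive_im_integrand. }
assert (Hi : is_RInt_gen (V := C_R_CompleteNormedModule) (density_integrand x) (at_right 0) (Rbar_locally p_infty)
   (RInt_gen (V := C_R_CompleteNormedModule) (density_integrand x) (at_right 0) (Rbar_locally p_infty))).
{ apply RInt_gen_correct.
  set (f := fun p => ((re_integrand beta x 0 0 p, im_integrand beta x 0 0 p) : C_R_CompleteNormedModule)).
  assert (Hf : is_RInt_gen f (at_right 0) (Rbar_locally p_infty) (RInt_gen f (at_right 0) (Rbar_locally p_infty))).
  { refine (proj1 (dominated_is_RInt_gen positive_convex at_right_positive p_infty_positive
      positive_ends_le (phi := fun p => C * / (1 + p) ^ 2) _ Hphi _)).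
    - intros p Hp. by apply: continuous_inv_sqr.
    - intros p Hp; split.
      + move=> P [eps HP].
        assert (C1 := @continuous_re_integrand beta x 0 0 p Hp). assert (C2 := Hcont p Hp).
        assert (D1 := proj1 (filterlim_locally _ _) C1 eps).
        assert (D2 := proj1 (filterlim_locally _ _) C2 eps).
        apply: (filter_imp _ _ _ (filter_and _ _ D1 D2)) => q [Q1 Q2]. apply HP. by split.
      + assert (Hn : norm (f p) = exp (re_exponent beta x 0 0 p)).
        { change (sqrt (Rabs (f p).1 ^ 2 + Rabs (f p).2 ^ 2) = exp (re_exponent beta x 0 0 p)).
          rewrite !pow2_abs. unfold f, re_integrand, im_integrand; simpl.
          set (E := exp _). set (y := im_exponent beta x 0 0 p).
          replace (E * cos y * (E * cos y * 1) + E * sin y * (E * sin y * 1))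
            with (E² * (Rsqr (sin y) + Rsqr (cos y))) by (unfold Rsqr; ring).
          rewrite sin2_cos2 Rmult_1_r sqrt_Rsqr //. left; apply exp_pos. }
        rewrite Hn re_exponent_0 //.
        apply: inv_sqr_bound' => //; [by apply Hd|left; apply exp_pos]. }
  eexists. apply: is_RInt_gen_ext Hf.
  apply: (Filter_prod _ _ _ positive positive at_right_positive p_infty_positive).
  intros p q Hp Hq y Hy; simpl in Hy. unfold positive in *. symmetry; apply density_integrand_eq.
  assert (0 < Rmin p q) by by apply Rmin_pos. lra. }
assert (HRe : is_linear (U := C_R_CompleteNormedModule) (V := R_CompleteNormedModule) Re).
{ split => //. exists 1; split; [lra|]. intros z. rewrite Rmult_1_l. exact: (norm_le_prod_norm_1 (U := R_NormedModule) (V := R_NormedModule) z). }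
assert (H := is_RInt_gen_linear (V := R_CompleteNormedModule) HRe Hi).
replace (PI * stable_density beta 1 x) with
  (Re (RInt_gen (V:=C_R_CompleteNormedModule) (density_integrand x) (at_right 0) (Rbar_locally p_infty))).
2: { unfold stable_density. rewrite -Rmult_assoc Rinv_r ?Rmult_1_l //. assert (H1 := PI_RGT_0); lra. }
apply: is_RInt_gen_ext H.
apply: (Filter_prod _ _ _ positive positive at_right_positive p_infty_positive).
intros p q Hp Hq y Hy; simpl in Hy. unfold positive in *. rewrite density_integrand_eq //.
assert (0 < Rmin p q) by by apply Rmin_pos. lra.
Qed.

(** The terms with the coefficient A tend to 0 as the truncation of the integral is removed. *)
Lemma stable_density_le : exists C, 0 <= C /\ forall x, 0 < x ->
  Rabs (stable_density beta 1 x) <=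
  C * (/ x ^ 2 * exp ((1 - beta) * ln x) * exp (- k / 2 * exp (- beta * ln x))).
Proof.
destruct (RInt_re_integrand_le Hbeta) as [K [HK Hx]].
assert (HPI := PI_RGT_0). assert (Hk : 0 < k) by by apply cos_beta_pos.
exists (K / PI); split; [by apply Rdiv_le_0_compat|].
intros x Hx0. destruct (Hx x Hx0) as [A [HA Her]]. clear Hx.
fold k in Her.
set (q := / x ^ 2 * exp ((1 - beta) * ln x) * exp (- k / 2 * exp (- beta * ln x))) in *.
set (g := stable_density beta 1 x).
apply (Rmult_le_reg_l PI) => //. replace (PI * (K / PI * q)) with (K * q) by (field; lra).
rewrite -{1}(Rabs_pos_eq PI); [|lra]. rewrite -Rabs_mult.
apply le_epsilon => eps He.
assert (Hi := @is_RInt_gen_density x).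
(* The target for the two vanishing terms together; A + 1 avoids dividing by zero. *)
set (d := eps / (2 * (A + 1))).
assert (Hd : 0 < d) by (apply Rdiv_lt_0_compat; lra).
assert (He2 : 0 < eps / 2) by lra.
assert (He4 : 0 < d / 2) by lra.
destruct (proj1 (filterlimi_locally _ _) Hi (mkposreal _ He2)) as [P Q HP HQ H].
assert (F1 : at_right 0 (fun e => 0 < e <= 1 /\ exp (beta * ln e) <= d / 2)).
{ assert (H1 : 0 < Rmin 1 (exp (ln (d / 2) / beta))).
  { apply Rmin_pos; [lra|apply exp_pos]. }
  apply: (filter_imp _ _ _ (filter_and _ _ at_right_positive (at_right_lt H1))).
  intros e [Hp Hl]; unfold positive in Hp.
  assert (A1 := Rmin_l 1 (exp (ln (d / 2) / beta))).
  assert (A2 := Rmin_r 1 (exp (ln (d / 2) / beta))).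
  split; [lra|].
  rewrite -(exp_ln (d / 2)) //. apply exp_le.
  replace (ln (d / 2)) with (beta * ln (exp (ln (d / 2) / beta))).
  2: { rewrite ln_exp. field; lra. }
  apply Rmult_le_compat_l; [lra|]. apply ln_le; lra. }
assert (F2 : Rbar_locally p_infty (fun r => 1 < r /\ exp (- k * exp (beta * ln r)) <= d / 2)).
{ exists (Rmax 1 (exp (ln (2 / (k * d)) / beta))). intros r Hr.
  assert (A1 := Rmax_l 1 (exp (ln (2 / (k * d)) / beta))).
  assert (A2 := Rmax_r 1 (exp (ln (2 / (k * d)) / beta))).
  split; [lra|].
  assert (Hkd : 0 < k * d) by by apply Rmult_lt_0_compat.
  assert (H2 : 2 / (k * d) <= exp (beta * ln r)).
  { rewrite -(exp_ln (2 / (k * d))); [|apply Rdiv_lt_0_compat; lra]. apply exp_le.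
    replace (ln (2 / (k * d))) with (beta * ln (exp (ln (2 / (k * d)) / beta))).
    2: { rewrite ln_exp. field; lra. }
    apply Rmult_le_compat_l; [lra|]. apply ln_le; [apply exp_pos|lra]. }
  replace (- k * exp (beta * ln r)) with (- (k * exp (beta * ln r))) by ring.
  rewrite exp_Ropp.
  assert (H3 := exp_ineq1_le (k * exp (beta * ln r))).
  assert (H4 : 2 / d <= k * exp (beta * ln r)).
  { replace (2 / d) with (k * (2 / (k * d))) by (field; lra). apply Rmult_le_compat_l; lra. }
  assert (H5 : 0 < 2 / d) by (apply Rdiv_lt_0_compat; lra).
  replace (d / 2) with (/ (2 / d)) by (field; lra).
  apply Rinv_le_contravar; lra. }
destruct (filter_ex _ (filter_and _ _ HP F1)) as [e [He' [H1 H2]]].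
destruct (filter_ex _ (filter_and _ _ HQ F2)) as [r [Hr' [H3 H4]]].
destruct (H e r He' Hr') as [v [Hv Hb]]. simpl in Hv.
assert (Hb' := Her e r H1 H3). rewrite (is_RInt_unique _ _ _ _ Hv) in Hb'.
apply ball_Rabs in Hb; simpl in Hb.
fold g in Hb. apply Rabs_def2 in Hb.
assert (A * (exp (beta * ln e) + exp (- k * exp (beta * ln r))) <= eps / 2).
{ apply Rle_trans with ((A + 1) * d); [apply Rmult_le_compat; try lra|].
  - apply Rplus_le_le_0_compat; left; apply exp_pos.
  - right; unfold d; field; lra. }
assert (Rabs v <= K * q + eps / 2) by lra.
revert H5; unfold Rabs; destruct Rcase_abs; destruct Rcase_abs; lra.
Qed.

(** Moving x changes the phase by p |x - y|, and the extra factor p is absorbed by [exp_decay]. What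
    is wanted is the continuity of the weights built from the density. *)
Lemma stable_density_lipschitz : exists C, 0 <= C /\ forall x y,
  Rabs (stable_density beta 1 x - stable_density beta 1 y) <= C * Rabs (x - y).
Proof.
destruct exp_decay as [C [HC Hd]].
assert (HPI := PI_RGT_0).
exists (C / PI); split; [by apply Rdiv_le_0_compat|].
intros x y.
apply (Rmult_le_reg_l PI) => //. rewrite -{1}(Rabs_pos_eq PI); [|lra].
rewrite -Rabs_mult Rmult_minus_distr_l.
replace (PI * (C / PI * Rabs (x - y))) with (C * Rabs (x - y) * 1) by (field; lra).
assert (Hi := is_RInt_gen_minus _ _ _ _ (@is_RInt_gen_density x) (@is_RInt_gen_density y)).
assert (Hphi := is_RInt_gen_scal _ (C * Rabs (x - y)) _ is_RInt_gen_inv_sqr).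
apply: (RInt_gen_norm (V := R_CompleteNormedModule) _ _ _ _ positive_ends_le _ Hi Hphi).
apply: (Filter_prod _ _ _ positive positive at_right_positive p_infty_positive).
intros e r He Hr p Hp; simpl in Hp. unfold positive in *. assert (Hp0 : 0 < p) by lra.
unfold norm, minus, plus, opp, scal; simpl. unfold abs, mult; simpl.
unfold re_integrand. rewrite !re_exponent_0 // !im_exponent_0 //.
set (E := exp _). assert (HE : 0 < E) by apply exp_pos.
set (s := exp _ * sin _).
replace (E * cos (p * x - s) + - (E * cos (p * y - s))) with (E * (cos (p * x - s) - cos (p * y - s))) by ring.
rewrite Rabs_mult (Rabs_pos_eq E); [|lra].
assert (Hc : Rabs (cos (p * x - s) - cos (p * y - s)) <= p * Rabs (x - y)).
{ destruct (MVT_gen cos (p * y - s) (p * x - s) (fun z => - sin z)) as [z [_ Hz]].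
  - intros z _. auto_derive => //. ring.
  - intros z _. apply ex_derive_continuity_pt. by auto_derive.
  - rewrite Hz. replace (p * x - s - (p * y - s)) with (p * (x - y)) by ring.
    rewrite !Rabs_mult Rabs_Ropp (Rabs_pos_eq p); [|lra].
    assert (Rabs (sin z) <= 1) by apply Rabs_le, SIN_bound.
    assert (0 <= p * Rabs (x - y)) by (apply Rmult_le_pos; [lra|apply Rabs_pos]). nra. }
apply Rle_trans with (E * (p * Rabs (x - y))); [apply Rmult_le_compat_l; lra|].
assert (H := inv_sqr_bound Hp0 (Hd p Hp0)). fold E in H.
assert (H1 := Rabs_pos (x - y)).
replace (E * (p * Rabs (x - y))) with (p * E * Rabs (x - y)) by ring.
replace (C * Rabs (x - y) * / ((1 + p) * ((1 + p) * 1))) with (C * / (1 + p) ^ 2 * Rabs (x - y)) by (simpl; ring).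
apply Rmult_le_compat_r => //. apply H; lra.
Qed.

(* beta times the M-Wright function, the density of E_beta in terms of the
   semigroup. *)
Definition wright (z : R) : R :=
  Rpower z (- 1 - / beta) * stable_density beta 1 (Rpower z (- / beta)).

(** For x = z^(-1/beta) the bound x^(-1-beta) is z^(1+1/beta) and cancels the prefactor exactly,
    while x^(-beta) = z makes the stretched exponential an ordinary one, with l = k / 2. *)
Lemma wright_le : exists C l, 0 <= C /\ 0 < l /\ forall z, 0 < z ->
  Rabs (wright z) <= C * exp (- l * z).
Proof.
destruct stable_density_le as [C [HC Hx]].
assert (Hk : 0 < k) by by apply cos_beta_pos.
exists C, (k / 2); split => //; split; [lra|]. intros z Hz.
unfold wright. rewrite Rabs_mult Rabs_pos_eq; [|left; apply exp_pos].
set (x := Rpower z (- / beta)).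
assert (Hlx : ln x = - / beta * ln z) by (unfold x, Rpower; by rewrite ln_exp).
assert (Hx0 : 0 < x) by apply exp_pos.
apply Rle_trans with (Rpower z (- 1 - / beta) *
   (C * (/ x ^ 2 * exp ((1 - beta) * ln x) * exp (- k / 2 * exp (- beta * ln x))))).
{ apply Rmult_le_compat_l; [left; apply exp_pos|by apply Hx]. }
replace (exp (- beta * ln x)) with z.
2: { rewrite Hlx. replace (- beta * (- / beta * ln z)) with (ln z) by (field; lra). by rewrite exp_ln. }
replace (- (k / 2) * z) with (- k / 2 * z) by field.
replace (Rpower z (- 1 - / beta) * (C * (/ x ^ 2 * exp ((1 - beta) * ln x) * exp (- k / 2 * z))))
  with (C * exp (- k / 2 * z) * (Rpower z (- 1 - / beta) * (/ x ^ 2 * exp ((1 - beta) * ln x)))) by ring.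
replace (Rpower z (- 1 - / beta) * (/ x ^ 2 * exp ((1 - beta) * ln x))) with 1; [lra|].
replace (/ x ^ 2) with (exp (- ln x + - ln x)).
2: { rewrite exp_plus exp_Ropp exp_ln //. field; lra. }
unfold Rpower. rewrite -!exp_plus Hlx.
transitivity (exp 0); [by rewrite exp_0|f_equal; field; lra].
Qed.

Lemma continuous_wright (z : R) : 0 < z -> continuous wright z.
Proof.
intros Hz. destruct stable_density_lipschitz as [C [HC HL]].
unfold wright. apply: continuous_mult.
- apply: ex_derive_continuous. unfold Rpower. auto_derive. lra.
- apply: (continuous_comp (fun z => Rpower z (- / beta))).
  + apply: ex_derive_continuous. unfold Rpower. auto_derive. lra.
  + set (x := Rpower _ _). apply/filterlim_norm => eps He.
    assert (Hd : 0 < eps / (C + 1)) by (apply Rdiv_lt_0_compat; lra).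
    exists (mkposreal _ Hd) => y Hy. apply: Rle_lt_trans; [apply: HL|].
    apply ball_Rabs in Hy; simpl in Hy.
    apply Rle_lt_trans with ((C + 1) * Rabs (y - x)).
    * apply Rmult_le_compat_r; [apply Rabs_pos|lra].
    * apply (Rmult_lt_compat_l (C + 1)) in Hy; [|lra].
      replace ((C + 1) * (eps / (C + 1))) with eps in Hy by (field; lra). exact Hy.
Qed.

End Density.

Lemma filterlim_scal_2 (T : Type) (F : (T -> Prop) -> Prop) {FF : Filter F}
    (V : NormedModule R_AbsRing) (k : T -> R) (x : T -> V) (k0 : R) (x0 : V) :
  filterlim k F (locally k0) -> filterlim x F (locally x0) ->
  filterlim (fun t => scal (k t) (x t)) F (locally (scal k0 x0)).
Proof.
intros Hk Hx. exact: (filterlim_comp_2 _ _ _ Hk Hx (filterlim_scal k0 x0)).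
Qed.

Lemma filterlim_mult_2 (T : Type) (F : (T -> Prop) -> Prop) {FF : Filter F}
    (k x : T -> R) (k0 x0 : R) :
  filterlim k F (locally k0) -> filterlim x F (locally x0) ->
  filterlim (fun t => k t * x t) F (locally (k0 * x0)).
Proof. exact: filterlim_scal_2. Qed.

Lemma filterlim_plus_2 (T : Type) (F : (T -> Prop) -> Prop) {FF : Filter F}
    (V : NormedModule R_AbsRing) (x y : T -> V) (x0 y0 : V) :
  filterlim x F (locally x0) -> filterlim y F (locally y0) ->
  filterlim (fun t => plus (x t) (y t)) F (locally (plus x0 y0)).
Proof.
intros Hx Hy. exact: (filterlim_comp_2 _ _ _ Hx Hy (filterlim_plus x0 y0)).
Qed.

Lemma linear_opp (U W : banach) (L : U -> W) (x : U) :
  is_linear L -> L (opp x) = opp (L x).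
Proof. intros HL. by rewrite -(scal_opp_one x) (linear_scal _ HL) scal_opp_one. Qed.

Lemma linear_minus (U W : banach) (L : U -> W) (x y : U) :
  is_linear L -> L (minus x y) = minus (L x) (L y).
Proof. intros HL. by rewrite /minus (linear_plus _ HL) linear_opp. Qed.

Lemma filterlim_comp_derive (T : Type) (F : (T -> Prop) -> Prop)
    (k : T -> R) (k0 : R) (f : R -> R) :
  filterlim k F (locally k0) -> ex_derive f k0 ->
  filterlim (fun t => f (k t)) F (locally (f k0)).
Proof.
intros Hk Hf. exact: (filterlim_comp _ _ _ _ f _ _ _ Hk (ex_derive_continuous f k0 Hf)).
Qed.

(** * Averages of a curve against an exponentially decaying weight *)

Section Subordination.

(** [Theta] is the set of admissible tau. It must stay away from 0 when P is the orbit in B1 of an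
    element of B, which is singular at 0, but contains 0 for initial values in B1. *)
Variables (V : banach) (P : R -> V) (w : R -> R) (A l : R) (Theta : R -> Prop).
Hypothesis Hl : 0 < l.
Hypothesis w_cont : forall z, 0 < z -> continuous w z.
Hypothesis P_cont : forall tau z, Theta tau -> 0 < z -> continuous P (tau * z).
Hypothesis wP_le : forall tau z, Theta tau -> 0 < z ->
  Rabs (w z) * norm (P (tau * z)) <= A * exp (- l * z).

Definition subordinate (tau : R) : V :=
  RInt_gen (fun z => scal (w z) (P (tau * z))) (at_right 0) (Rbar_locally p_infty).

Lemma subordinate_dominated (tau : R) : Theta tau ->
  dominated positive (fun z => A * exp (- l * z)) (fun z => scal (w z) (P (tau * z))).
Proof.
intros Ht z Hz; split.
- apply: filterlim_scal_2; [by apply w_cont|].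
  apply: (continuous_comp (fun z => tau * z) P); [|by apply P_cont].
  apply: continuous_scal_r. exact: continuous_id.
- apply: Rle_trans; [apply: norm_scal|]. exact: wP_le.
Qed.

Lemma exp_dominator_continuous (z : R) : positive z -> continuous (fun z => A * exp (- l * z)) z.
Proof. intros _. apply: ex_derive_continuous. by auto_derive. Qed.

Lemma is_RInt_gen_exp_dominator :
  is_RInt_gen (fun z => A * exp (- l * z)) (at_right 0) (Rbar_locally p_infty) (A * / l).
Proof. apply: is_RInt_gen_scal. by apply is_RInt_gen_exp. Qed.

Lemma is_RInt_gen_subordinate (tau : R) : Theta tau ->
  is_RInt_gen (fun z => scal (w z) (P (tau * z))) (at_right 0) (Rbar_locally p_infty)
    (subordinate tau) /\ norm (subordinate tau) <= A * / l.
Proof.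
intros Ht.
exact: (dominated_is_RInt_gen positive_convex at_right_positive p_infty_positive
  positive_ends_le exp_dominator_continuous is_RInt_gen_exp_dominator (subordinate_dominated Ht)).
Qed.

(** The dominating function is the same for all tau in [Theta], so dominated convergence applies. *)
Lemma subordinate_continuous (tau : R) : Theta tau ->
  filterlim subordinate (within Theta (locally tau)) (locally (subordinate tau)).
Proof.
intros Ht.
apply: (dominated_convergence_prod positive_convex at_right_positive p_infty_positive
  positive_ends_le exp_dominator_continuous is_RInt_gen_exp_dominator (subordinate_dominated Ht)
  (F := fun tau z => scal (w z) (P (tau * z)))).
- exists (mkposreal _ Rlt_0_1) => t _ Ht'. by apply subordinate_dominated.
- intros z Hz. apply: filterlim_scal_2.
  + apply: (filterlim_comp _ _ _ snd w); [exact: filterlim_snd|exact: w_cont].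
  + apply: (filterlim_comp _ _ _ (fun p => p.1 * p.2) P _ (locally (tau * z))); [|exact: P_cont].
    apply: filterlim_mult_2; [|exact: filterlim_snd].
    apply: (filterlim_filter_le_2 _ (filter_le_within _)).
    exact: filterlim_fst.
Qed.

End Subordination.

(** * The Mittag-Leffler operators with values in B1 *)

Section Kernel.

Variables (B1 B : banach) (j1 : B1 -> B) (E : R -> B -> B) (E1 : R -> B1 -> B1).
Variables (M1 m1 kappa omega beta Cw l : R).
Hypothesis Hbeta : 0 < beta < 1.
Hypothesis Homega : 0 < omega < 1.
Hypothesis Hkappa : 0 < kappa.
Hypothesis HM1 : 0 <= M1.
Hypothesis Hm1 : 0 <= m1.
Hypothesis j1_linear : is_linear j1.
Hypothesis j1_inj : injective j1.
Hypothesis E_linear : forall t, 0 <= t -> is_linear (E t).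
Hypothesis E_plus : forall s t x, 0 <= s -> 0 <= t -> E (s + t) x = E s (E t x).
Hypothesis E1_linear : forall t, 0 <= t -> is_linear (E1 t).
Hypothesis E1_cont : forall x, continuous_on (fun t => 0 <= t) (fun t => E1 t x).
Hypothesis E1_E : forall t x, 0 <= t -> j1 (E1 t x) = E t (j1 x).
Hypothesis E1_le : forall t x, 0 <= t -> norm (E1 t x) <= M1 * exp (m1 * t) * norm x.
Hypothesis Hsmooth : smoothing j1 E kappa omega.
Hypothesis HCw : 0 <= Cw.
Hypothesis Hl : 0 < l.
Hypothesis wright_bound : forall z, 0 < z -> Rabs (wright beta z) <= Cw * exp (- l * z).

(** The smoothing hypothesis only asserts that a preimage of [E t x] in B1 exists, hence the choice
    operator; injectivity of [j1] makes the preimage unique. *)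
Definition smoothed (t : R) (x : B) : B1 :=
  epsilon (inhabits zero) (fun y => j1 y = E t x).

Lemma j1_smoothed (t : R) (x : B) : 0 < t -> j1 (smoothed t x) = E t x.
Proof.
intros Ht. apply (epsilon_spec (inhabits zero) (fun y => j1 y = E t x)). by apply Hsmooth.
Qed.

Lemma smoothed_minus (t : R) (x y : B) : 0 < t ->
  smoothed t (minus x y) = minus (smoothed t x) (smoothed t y).
Proof.
intros Ht. apply j1_inj.
rewrite (linear_minus _ _ j1_linear) !j1_smoothed //.
apply linear_minus, E_linear; lra.
Qed.

Lemma smoothed_plus_time (s t : R) (x : B) : 0 <= s -> 0 < t ->
  smoothed (s + t) x = E1 s (smoothed t x).
Proof.
intros Hs Ht. apply j1_inj. rewrite E1_E // !j1_smoothed; try lra. apply E_plus; lra.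
Qed.

(** [E1] is controlled for t >= 0 only; truncating at 0 gives a function that is continuous from
    both sides even at t = 0. *)
Lemma E1_continuous (y : B1) (t : R) : 0 <= t -> continuous (fun t => E1 (Rmax 0 t) y) t.
Proof.
intros Ht.
apply: (filterlim_comp _ _ _ (Rmax 0) (fun r => E1 r y)
  _ (within (fun r => 0 <= r) (locally (Rmax 0 t)))).
- move=> P [eps HP]. exists eps => s Hs. apply HP; [|apply Rmax_l].
  unfold ball in *; simpl in *; unfold AbsRing_ball, abs, minus, plus, opp in *; simpl in *.
  apply: Rle_lt_trans Hs. unfold Rmax.
  repeat destruct Rle_dec; unfold Rabs; repeat destruct Rcase_abs; lra.
- apply E1_cont. apply Rmax_l.
Qed.

(** The orbit is split at time t / 2: exp(A t / 2) x already lies in B1, and from there on the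
    semigroup of B1 is strongly continuous. *)
Lemma smoothed_continuous (x : B) (t : R) : 0 < t -> continuous (fun t => smoothed t x) t.
Proof.
intros Ht.
assert (Hh : 0 < t / 2) by lra.
apply: (filterlim_ext_loc (fun s => E1 (Rmax 0 (s - t / 2)) (smoothed (t / 2) x))).
{ exists (mkposreal _ Hh) => s Hs.
  apply ball_Rabs in Hs; simpl in Hs.
  apply Rabs_def2 in Hs. rewrite Rmax_right; [|lra].
  rewrite -smoothed_plus_time; [|lra|lra]. f_equal; ring. }
assert (Et : smoothed t x = E1 (Rmax 0 (t - t / 2)) (smoothed (t / 2) x)).
{ rewrite Rmax_right; [|lra]. rewrite -smoothed_plus_time; [|lra|lra]. f_equal; field. }
rewrite Et.
apply: (continuous_comp (fun s => s - t / 2) (fun r => E1 (Rmax 0 r) (smoothed (t / 2) x))).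
- apply: ex_derive_continuous. by auto_derive.
- apply E1_continuous. lra.
Qed.

Lemma Rpower_neg_mul_exp_ge (t : R) : 1 < t -> 1 <= Rpower t (- omega) * exp t.
Proof.
intros Ht. unfold Rpower. rewrite -exp_plus -exp_0. apply exp_le.
assert (H := exp_ineq1_le (ln t)). rewrite exp_ln in H; [|lra].
assert (0 < ln t) by (rewrite -ln_1; apply ln_increasing; lra). nra.
Qed.

(** The smoothing estimate is given up to time 1. Beyond it, exp(At) = exp(A(t - 1)) exp(A), and the
    extra factor exp(t) compensates for t^(-omega), so that one formula covers all times. *)
Lemma smoothed_le (t : R) (x : B) : 0 < t ->
  norm (smoothed t x) <=
  kappa * (1 + M1) * Rpower t (- omega) * exp ((m1 + 1) * t) * norm x.
Proof.
assert (H01 : forall t x, 0 < t <= 1 -> norm (smoothed t x) <= kappa * Rpower t (- omega) * norm x).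
{ clear t x; intros t x Ht. destruct Hsmooth as [_ Hs].
  destruct (Hs t Ht x) as [y [Hy Hn]].
  replace (smoothed t x) with y; [exact Hn|].
  apply j1_inj. rewrite Hy j1_smoothed //; lra. }
intros Ht. assert (Hx := norm_ge_0 x).
assert (Hp : 0 < Rpower t (- omega)) by apply exp_pos.
destruct (Rle_dec t 1) as [H1|H1].
- apply: Rle_trans; [apply H01; lra|].
  apply Rmult_le_compat_r => //.
  assert (1 <= exp ((m1 + 1) * t)) by (apply Rle_trans with (exp 0); [rewrite exp_0; lra|apply exp_le; nra]).
  assert (Hk : 0 < kappa * Rpower t (- omega)) by by apply Rmult_lt_0_compat.
  replace (kappa * (1 + M1) * Rpower t (- omega) * exp ((m1 + 1) * t))
    with (kappa * Rpower t (- omega) * ((1 + M1) * exp ((m1 + 1) * t))) by ring.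
  rewrite -{1}(Rmult_1_r (kappa * _)). apply Rmult_le_compat_l; [lra|]. nra.
- replace t with ((t - 1) + 1) at 1 by ring.
  rewrite smoothed_plus_time; [|lra|lra].
  apply: Rle_trans; [apply E1_le; lra|].
  assert (H2 : norm (smoothed 1 x) <= kappa * norm x).
  { replace kappa with (kappa * Rpower 1 (- omega)); [apply H01; lra|].
    unfold Rpower. rewrite ln_1 Rmult_0_r exp_0; ring. }
  assert (H3 : 1 <= Rpower t (- omega) * exp t) by (apply Rpower_neg_mul_exp_ge; lra).
  assert (H4 : exp (m1 * (t - 1)) <= exp (m1 * t)) by (apply exp_le; nra).
  assert (H5 := exp_pos (m1 * t)). assert (H6 := exp_pos (m1 * (t - 1))).
  apply Rle_trans with (M1 * exp (m1 * t) * (kappa * norm x)).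
  + apply Rmult_le_compat => //; [|apply norm_ge_0|].
    * apply Rmult_le_pos; lra.
    * by apply Rmult_le_compat_l.
  + replace ((m1 + 1) * t) with (m1 * t + t) by ring. rewrite exp_plus.
    replace (kappa * (1 + M1) * Rpower t (- omega) * (exp (m1 * t) * exp t) * norm x)
     with (((1 + M1) * (Rpower t (- omega) * exp t)) * (exp (m1 * t) * (kappa * norm x))) by ring.
    rewrite Rmult_assoc. apply Rmult_le_compat_r.
    * repeat apply Rmult_le_pos; lra.
    * nra.
Qed.

(** For tau up to this value the growth exp((m1 + 1) tau z) in [smoothed_le] costs at most a quarter
    of the decay exp(-l z) of the weight. *)
Definition rate : R := l / (4 * (m1 + 1)).

Lemma rate_pos : 0 < rate.
Proof. apply Rdiv_lt_0_compat; lra. Qed.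

Lemma rate_le (tau z : R) : tau <= rate -> 0 < z -> (m1 + 1) * (tau * z) <= l / 4 * z.
Proof.
intros Ht Hz.
assert ((m1 + 1) * tau <= l / 4).
{ apply (Rmult_le_compat_l (m1 + 1)) in Ht; [|lra].
  replace ((m1 + 1) * rate) with (l / 4) in Ht by (unfold rate; field; lra). exact Ht. }
nra.
Qed.

(* The weight of E'_beta relative to that of E_beta. *)
Definition weight (z : R) : R := z * wright beta z.

Lemma weight_continuous (z : R) : 0 < z -> continuous weight z.
Proof.
intros Hz. apply: continuous_mult; [exact: continuous_id|exact: continuous_wright].
Qed.

Definition kernel_const : R := Cw * (kappa * (1 + M1)) * (1 + 4 / l).

Lemma kernel_const_ge_0 : 0 <= kernel_const.
Proof.
assert (0 < 4 / l) by (apply Rdiv_lt_0_compat; lra).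
unfold kernel_const. repeat apply Rmult_le_pos; lra.
Qed.

Lemma Rpower_decr (t s : R) : 0 < t <= s -> Rpower s (- omega) <= Rpower t (- omega).
Proof.
intros H. unfold Rpower. apply exp_le.
assert (ln t <= ln s) by (apply ln_le; lra). nra.
Qed.

(** Budget for exp(-l z): a quarter of the exponent pays for the growth of the semigroup, a quarter
    for z^(1-omega), and half remains. The lower bound theta makes the estimate uniform in tau. *)
Lemma weight_smoothed_le (theta tau z : R) (v : B) :
  0 < theta -> theta <= tau <= rate -> 0 < z ->
  Rabs (weight z) * norm (smoothed (tau * z) v) <=
  kernel_const * Rpower theta (- omega) * norm v * exp (- (l / 2) * z).
Proof.
intros Hth Ht Hz.
assert (Htz : 0 < tau * z) by nra.
assert (H1 := smoothed_le v Htz). assert (H2 := wright_bound Hz).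
assert (H3 : exp ((m1 + 1) * (tau * z)) <= exp (l / 4 * z)) by (apply exp_le, rate_le; lra).
assert (H4 : Rpower (tau * z) (- omega) <= Rpower theta (- omega) * Rpower z (- omega)).
{ rewrite -Rpower_mult_distr //; [|lra].
  apply Rmult_le_compat_r; [left; apply exp_pos|apply Rpower_decr; lra]. }
(* z^(1-omega) <= 1 + z for every z > 0, and exp(l z / 4) dominates both 1 and l z / 4. *)
assert (H5 : z * Rpower z (- omega) <= (1 + 4 / l) * exp (l / 4 * z)).
{ assert (H6 : z * Rpower z (- omega) <= 1 + z).
  { rewrite -{1}(exp_ln z) //. unfold Rpower. rewrite -exp_plus.
    destruct (Rle_dec 0 (ln z)).
    - apply Rle_trans with (exp (ln z)); [apply exp_le; nra|rewrite exp_ln //; lra].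
    - apply Rle_trans with (exp 0); [apply exp_le; nra|rewrite exp_0; lra]. }
  assert (H7 := exp_ineq1_le (l / 4 * z)).
  assert (H8 : 0 < 4 / l) by (apply Rdiv_lt_0_compat; lra).
  assert (H9 : 0 < l / 4 * z) by nra.
  assert (z = 4 / l * (l / 4 * z)) by (field; lra).
  nra. }
assert (Hn := norm_ge_0 v).
assert (P1 := exp_pos (- l * z)). assert (P2 := exp_pos (l / 4 * z)).
assert (P3 : 0 < Rpower theta (- omega)) by apply exp_pos.
assert (P4 : 0 < Rpower z (- omega)) by apply exp_pos.
assert (P5 : 0 < Rpower (tau * z) (- omega)) by apply exp_pos.
assert (P6 := exp_pos ((m1 + 1) * (tau * z))).
unfold weight. rewrite Rabs_mult (Rabs_pos_eq z); [|lra].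
apply Rle_trans with (z * (Cw * exp (- l * z)) *
  (kappa * (1 + M1) * (Rpower theta (- omega) * Rpower z (- omega)) * exp (l / 4 * z) * norm v)).
- apply Rmult_le_compat.
  + apply Rmult_le_pos; [lra|apply Rabs_pos].
  + apply norm_ge_0.
  + apply Rmult_le_compat_l; lra.
  + apply: (Rle_trans _ _ _ H1). apply Rmult_le_compat_r => //.
    apply Rmult_le_compat => //; [|lra|].
    * repeat apply Rmult_le_pos; lra.
    * apply Rmult_le_compat_l => //. repeat apply Rmult_le_pos; lra.
- replace (z * (Cw * exp (- l * z)) *
  (kappa * (1 + M1) * (Rpower theta (- omega) * Rpower z (- omega)) * exp (l / 4 * z) * norm v))
  with (Cw * (kappa * (1 + M1)) * Rpower theta (- omega) * norm v * exp (- l * z) * exp (l / 4 * z) *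
    (z * Rpower z (- omega))) by ring.
  replace (- (l / 2) * z) with (- l * z + (l / 4 * z + l / 4 * z)) by field.
  rewrite !exp_plus. unfold kernel_const.
  replace (Cw * (kappa * (1 + M1)) * (1 + 4 / l) * Rpower theta (- omega) * norm v *
    (exp (- l * z) * (exp (l / 4 * z) * exp (l / 4 * z)))) with
   (Cw * (kappa * (1 + M1)) * Rpower theta (- omega) * norm v * exp (- l * z) * exp (l / 4 * z) *
    ((1 + 4 / l) * exp (l / 4 * z))) by ring.
  apply Rmult_le_compat_l => //. repeat apply Rmult_le_pos; lra.
Qed.

(** This is beta E'_beta(A tau), averaged directly in B1 so that its norm there is controlled. *)
Definition kernel (tau : R) (v : B) : B1 := subordinate (fun t => smoothed t v) weight tau.

Lemma half_l_pos : 0 < l / 2.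
Proof. lra. Qed.

Lemma kernel_aux (theta : R) (v : B) : 0 < theta ->
  (forall tau z, theta <= tau <= rate -> 0 < z -> continuous (fun t => smoothed t v) (tau * z)).
Proof. intros Hth tau z Ht Hz. apply smoothed_continuous. nra. Qed.

Lemma is_RInt_gen_kernel (tau : R) (v : B) : 0 < tau <= rate ->
  is_RInt_gen (fun z => scal (weight z) (smoothed (tau * z) v))
    (at_right 0) (Rbar_locally p_infty) (kernel tau v) /\
  norm (kernel tau v) <= 2 / l * kernel_const * Rpower tau (- omega) * norm v.
Proof.
intros [Ht0 Ht].
destruct (is_RInt_gen_subordinate half_l_pos weight_continuous (kernel_aux (v := v) Ht0)
  (fun t z Htt Hz => weight_smoothed_le v Ht0 Htt Hz) (conj (Rle_refl tau) Ht)) as [H1 H2].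
split; [exact H1|]. apply: (Rle_trans _ _ _ H2). right; field; lra.
Qed.

(** Near tau > 0 the times are kept above tau / 2, where the singular factor is bounded by (tau /
    2)^(-omega). *)
Lemma kernel_continuous_time (tau : R) (v : B) : 0 < tau <= rate ->
  filterlim (fun t => kernel t v) (within (fun t => tau / 2 <= t <= rate) (locally tau))
    (locally (kernel tau v)).
Proof.
intros Ht. assert (Ht0 : 0 < tau / 2) by lra.
apply: (subordinate_continuous half_l_pos weight_continuous (kernel_aux (v := v) Ht0)
  (fun t z Htt Hz => weight_smoothed_le v Ht0 Htt Hz)). lra.
Qed.

Lemma kernel_minus (tau : R) (v w : B) : 0 < tau <= rate ->
  kernel tau (minus v w) = minus (kernel tau v) (kernel tau w).
Proof.
intros Ht.
refine (is_RInt_gen_unique (fun z => scal (weight z) (smoothed (tau * z) (minus v w))) _ _).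
assert (H := is_RInt_gen_minus _ _ _ _ (proj1 (is_RInt_gen_kernel v Ht)) (proj1 (is_RInt_gen_kernel w Ht))).
apply: is_RInt_gen_ext H.
apply: (Filter_prod _ _ _ positive positive at_right_positive p_infty_positive).
intros p q Hp Hq z Hz; simpl in Hz. unfold positive in *.
assert (0 < Rmin p q) by by apply Rmin_pos.
rewrite smoothed_minus; [|nra]. by rewrite scal_minus_distr_l.
Qed.

(** Joint continuity from continuity in time, linearity in v and an operator norm that is bounded
    for times above tau / 2. *)
Lemma kernel_continuous (tau : R) (v : B) : 0 < tau <= rate ->
  filterlim (fun p => kernel p.1 p.2)
    (filter_prod (within (fun t => tau / 2 <= t <= rate) (locally tau)) (locally v))
    (locally (kernel tau v)).
Proof.
intros Ht. apply/filterlim_norm => eps He.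
set (N := 2 / l * kernel_const * Rpower (tau / 2) (- omega)).
assert (HN : 0 <= N).
{ unfold N. apply Rmult_le_pos; [|left; apply exp_pos].
  apply Rmult_le_pos; [left; apply Rdiv_lt_0_compat; lra|apply kernel_const_ge_0]. }
assert (He2 : 0 < eps / 2) by lra.
assert (Hd : 0 < eps / 2 / (N + 1)) by (apply Rdiv_lt_0_compat; lra).
apply: (Filter_prod _ _ _
  (fun t => tau / 2 <= t <= rate /\ norm (minus (kernel t v) (kernel tau v)) < eps / 2)
  (fun x => norm (minus x v) < eps / 2 / (N + 1))).
- apply: filter_and.
  + by exists (mkposreal _ Rlt_0_1).
  + exact: (proj1 (filterlim_norm _ _) (@kernel_continuous_time tau v Ht) _ He2).
- apply: (proj1 (filterlim_norm _ _) (@continuous_id _ v) _ Hd).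
- intros t x [Ht1 Ht2] Hx; simpl.
  assert (Ht0 : 0 < t <= rate) by lra.
  apply: (Rle_lt_trans _ _ _ (norm_minus_trans (kernel t v) _ _)).
  replace eps with (eps / 2 + eps / 2) by field.
  apply Rplus_lt_compat; [|exact Ht2].
  rewrite -kernel_minus //.
  apply: (Rle_lt_trans _ _ _ (proj2 (is_RInt_gen_kernel _ Ht0))).
  apply Rle_lt_trans with (N * norm (minus x v)).
  + apply Rmult_le_compat_r; [apply norm_ge_0|].
    apply Rmult_le_compat_l; [|apply Rpower_decr; lra].
    apply Rmult_le_pos; [|apply kernel_const_ge_0]. left; apply Rdiv_lt_0_compat; lra.
  + assert (H0 := norm_ge_0 (minus x v)).
    apply (Rmult_lt_compat_l (N + 1)) in Hx; [|lra].
    replace ((N + 1) * (eps / 2 / (N + 1))) with (eps / 2) in Hx by (field; lra).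
    apply: Rle_lt_trans Hx. apply Rmult_le_compat_r => //. lra.
Qed.

(** [j1] passes under the integral over B1, and z^(-1/beta) = z z^(-1-1/beta) identifies the
    weights. *)
Lemma mittag_leffler'_kernel (tau : R) (v : B) : 0 < tau <= rate ->
  mittag_leffler' beta E tau v = j1 (scal (/ beta) (kernel tau v)).
Proof.
intros Ht. unfold mittag_leffler'. rewrite (linear_scal _ j1_linear). f_equal.
apply is_RInt_gen_unique.
assert (H := is_RInt_gen_linear j1_linear (proj1 (is_RInt_gen_kernel v Ht))).
apply: is_RInt_gen_ext H.
apply: (Filter_prod _ _ _ positive positive at_right_positive p_infty_positive).
intros p q Hp Hq z Hz; simpl in Hz. unfold positive in *.
assert (0 < Rmin p q) by by apply Rmin_pos.
assert (Hz0 : 0 < z) by lra.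
rewrite (linear_scal _ j1_linear) j1_smoothed; [|nra]. f_equal.
unfold weight, wright. rewrite -Rmult_assoc. f_equal.
rewrite -{1}(Rpower_1 z) // -Rpower_plus. f_equal; ring.
Qed.

(** This is beta E_beta(A tau) on B1. It uses the semigroup of B1 instead of smoothing, so tau = 0
    is allowed. *)
Definition initial (tau : R) (y : B1) : B1 :=
  subordinate (fun t => E1 (Rmax 0 t) y) (wright beta) tau.

Lemma initial_aux (y : B1) (tau z : R) : 0 <= tau <= rate -> 0 < z ->
  continuous (fun t => E1 (Rmax 0 t) y) (tau * z) /\
  Rabs (wright beta z) * norm (E1 (Rmax 0 (tau * z)) y) <=
  Cw * M1 * norm y * exp (- (l / 2) * z).
Proof.
intros Ht Hz. assert (Htz : 0 <= tau * z) by nra. split; [by apply E1_continuous|].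
rewrite Rmax_right //.
assert (H1 := E1_le y Htz). assert (H2 := wright_bound Hz).
assert (H3 : exp (m1 * (tau * z)) <= exp (l / 2 * z)).
{ apply exp_le. assert (H := rate_le (proj2 Ht) Hz). nra. }
apply Rle_trans with ((Cw * exp (- l * z)) * (M1 * exp (l / 2 * z) * norm y)).
- apply Rmult_le_compat => //; [apply Rabs_pos|apply norm_ge_0|].
  apply: (Rle_trans _ _ _ H1). apply Rmult_le_compat_r; [apply norm_ge_0|].
  by apply Rmult_le_compat_l.
- replace (- (l / 2) * z) with (- l * z + l / 2 * z) by field. rewrite exp_plus.
  right; ring.
Qed.

Lemma is_RInt_gen_initial (tau : R) (y : B1) : 0 <= tau <= rate ->
  is_RInt_gen (fun z => scal (wright beta z) (E1 (Rmax 0 (tau * z)) y))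
    (at_right 0) (Rbar_locally p_infty) (initial tau y) /\
  norm (initial tau y) <= 2 / l * (Cw * M1) * norm y.
Proof.
intros Ht.
destruct (is_RInt_gen_subordinate half_l_pos (fun z Hz => continuous_wright Hbeta Hz)
  (fun t z Htt Hz => proj1 (initial_aux y Htt Hz))
  (fun t z Htt Hz => proj2 (initial_aux y Htt Hz)) Ht) as [H1 H2].
split; [exact H1|]. apply: (Rle_trans _ _ _ H2). right; field; lra.
Qed.

Lemma initial_continuous (tau : R) (y : B1) : 0 <= tau <= rate ->
  filterlim (fun t => initial t y) (within (fun t => 0 <= t <= rate) (locally tau))
    (locally (initial tau y)).
Proof.
intros Ht.
exact: (subordinate_continuous half_l_pos (fun z Hz => continuous_wright Hbeta Hz)
  (fun t z Htt Hz => proj1 (initial_aux y Htt Hz))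
  (fun t z Htt Hz => proj2 (initial_aux y Htt Hz)) Ht).
Qed.

Lemma initial_minus (tau : R) (v w : B1) : 0 <= tau <= rate ->
  initial tau (minus v w) = minus (initial tau v) (initial tau w).
Proof.
intros Ht.
refine (is_RInt_gen_unique (fun z => scal (wright beta z) (E1 (Rmax 0 (tau * z)) (minus v w))) _ _).
assert (H := is_RInt_gen_minus _ _ _ _ (proj1 (is_RInt_gen_initial v Ht)) (proj1 (is_RInt_gen_initial w Ht))).
apply: is_RInt_gen_ext H.
apply: filter_forall => p z Hz.
rewrite -scal_minus_distr_l. f_equal. symmetry. apply linear_minus, E1_linear, Rmax_l.
Qed.

Lemma mittag_leffler_initial (tau : R) (y : B1) : 0 <= tau <= rate ->
  mittag_leffler beta E tau (j1 y) = j1 (scal (/ beta) (initial tau y)).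
Proof.
intros Ht. unfold mittag_leffler. rewrite (linear_scal _ j1_linear). f_equal.
apply is_RInt_gen_unique.
assert (H := is_RInt_gen_linear j1_linear (proj1 (is_RInt_gen_initial y Ht))).
apply: is_RInt_gen_ext H.
apply: (Filter_prod _ _ _ positive positive at_right_positive p_infty_positive).
intros p q Hp Hq z Hz; simpl in Hz. unfold positive in *.
assert (0 < Rmin p q) by by apply Rmin_pos.
assert (Hz0 : 0 < z) by lra.
assert (0 <= tau * z) by nra.
rewrite (linear_scal _ j1_linear) Rmax_right // E1_E //.
Qed.

(** * Convolution with the weakly singular kernel *)

Definition unit_interval (x : R) : Prop := 0 < x < 1.

(** The kernel of the mild equation has size r^(beta-1) (r^beta)^(-omega) = r^([decay] - 1) at
    distance r = t - s. *)
Definition decay : R := beta * (1 - omega).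

Lemma decay_pos : 0 < decay.
Proof. unfold decay. apply Rmult_lt_0_compat; lra. Qed.

Lemma unit_interval_convex (x y z : R) :
  unit_interval x -> unit_interval y -> x <= z <= y -> unit_interval z.
Proof. unfold unit_interval; lra. Qed.

Lemma at_right_unit_interval : at_right 0 unit_interval.
Proof. exact: (filter_and _ _ at_right_positive (at_right_lt Rlt_0_1)). Qed.

Lemma at_left_unit_interval : at_left 1 unit_interval.
Proof.
apply: filter_and; [apply at_left_gt, Rlt_0_1|]. by exists (mkposreal _ Rlt_0_1).
Qed.

Lemma unit_interval_ends_le : filter_prod (at_right 0) (at_left 1) (fun p => p.1 <= p.2).
Proof.
apply: (Filter_prod _ _ _ (fun z => z < / 2) (fun z => / 2 < z)).
- apply at_right_lt; lra.
- apply at_left_gt; lra.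
- simpl; intros; lra.
Qed.

Lemma continuous_Rpower (x q : R) : 0 < x -> continuous (fun y => Rpower y q) x.
Proof. intros Hx. apply: ex_derive_continuous. unfold Rpower. by auto_derive. Qed.

Lemma power_le (x y q : R) : 0 < q -> x <= y -> power x q <= power y q.
Proof.
intros Hq Hxy. unfold power. destruct (Rlt_dec 0 x) as [Hx|Hx]; destruct (Rlt_dec 0 y) as [Hy|Hy].
- apply Rle_Rpower_l; lra.
- lra.
- simpl; left; apply exp_pos.
- simpl; lra.
Qed.

Lemma power_ge_0 (x q : R) : 0 <= power x q.
Proof. unfold power. destruct Rlt_dec; simpl; [left; apply exp_pos|lra]. Qed.

Lemma power_pos (x q : R) : 0 < x -> power x q = Rpower x q.
Proof. intros Hx. unfold power. by destruct Rlt_dec. Qed.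

Lemma power_0 (q : R) : power 0 q = 0.
Proof. unfold power. destruct Rlt_dec; simpl; lra. Qed.

Lemma power_small (q eps : R) : 0 < q -> 0 < eps ->
  exists d, 0 < d /\ forall x, x < d -> power x q < eps.
Proof.
intros Hq He. exists (Rpower eps (/ q)). split; [apply exp_pos|].
intros x Hx. unfold power. destruct Rlt_dec; simpl; [|lra].
replace eps with (Rpower (Rpower eps (/ q)) q).
- unfold Rpower. apply exp_increasing. apply Rmult_lt_compat_l => //.
  by apply ln_increasing.
- rewrite Rpower_mult Rinv_l; [|lra]. by apply Rpower_1.
Qed.

Lemma continuous_power (x q : R) : 0 < q -> 0 <= x -> continuous (fun y => power y q) x.
Proof.
intros Hq [Hx| <-].
- apply: (continuous_ext_loc _ (fun y => Rpower y q)).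
  + exists (mkposreal _ Hx) => y Hy.
    apply ball_Rabs in Hy; simpl in Hy.
    apply Rabs_def2 in Hy. rewrite power_pos //; lra.
  + by apply continuous_Rpower.
- apply/filterlim_norm => eps He. rewrite power_0.
  destruct (power_small Hq He) as [d [Hd H]].
  exists (mkposreal _ Hd) => y Hy.
  apply ball_Rabs in Hy; simpl in Hy.
  apply Rabs_def2 in Hy.
  unfold norm, minus, plus, opp; simpl; unfold abs; simpl.
  rewrite Ropp_0 Rplus_0_r Rabs_pos_eq; [|apply power_ge_0]. apply H; lra.
Qed.

Lemma is_RInt_gen_singular (A : R) :
  is_RInt_gen (fun s => A * Rpower (1 - s) (decay - 1)) (at_right 0) (at_left 1) (A / decay).
Proof.
assert (Hd := decay_pos).
(* [power] rather than [Rpower]: the antiderivative must vanish at s = 1, whereas [Rpower] takes the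
   value 1 at base 0. *)
set (F := fun s => - A / decay * power (1 - s) decay).
assert (E0 : 0 - F 0 = A / decay).
{ unfold F. rewrite Rminus_0_r power_pos; [|lra]. unfold Rpower. rewrite ln_1 Rmult_0_r exp_0. field; lra. }
assert (FC : forall s, s <= 1 -> continuous F s).
{ intros s Hs. apply: continuous_mult; [exact: continuous_const|].
  apply: (continuous_comp (fun s => 1 - s) (fun y => power y decay)).
  - apply: ex_derive_continuous. by auto_derive.
  - apply continuous_power => //. lra. }
rewrite -E0.
apply (is_RInt_gen_antiderivative unit_interval_convex at_right_unit_interval at_left_unit_interval
  (F := F)).
- intros s Hs; unfold unit_interval in Hs.
  apply (is_derive_ext_loc (fun s => - A / decay * Rpower (1 - s) decay)).
  { assert (H1 : 0 < 1 - s) by lra. exists (mkposreal _ H1) => y Hy.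
    apply ball_Rabs in Hy; simpl in Hy.
    apply Rabs_def2 in Hy. unfold F. rewrite power_pos //; lra. }
  unfold Rpower. auto_derive; [lra|].
  replace ((decay - 1) * ln (1 - s)) with (decay * ln (1 + - s) + - ln (1 - s)) by (unfold Rminus; ring).
  rewrite exp_plus exp_Ropp exp_ln; [|lra]. field. lra.
- intros s Hs; unfold unit_interval in Hs. apply: continuous_mult; [exact: continuous_const|].
  apply: ex_derive_continuous. unfold Rpower. auto_derive. lra.
- apply: (filterlim_filter_le_1 _ (filter_le_within _)). apply: FC; lra.
- replace 0 with (F 1) by (unfold F; rewrite Rminus_diag power_0; ring).
  apply: (filterlim_filter_le_1 _ (filter_le_within _)). apply: FC; lra.
Qed.

(* The integrand of the convolution over [a, t], transported to [0, 1]. *)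
Definition volterra_integrand (a : R) (g : R -> B) (t s : R) : B1 :=
  scal ((t - a) * Rpower ((t - a) * (1 - s)) (beta - 1))
    (scal (/ beta) (kernel (Rpower ((t - a) * (1 - s)) beta) (g (a + (t - a) * s)))).

(** Over [0, 1] the range is independent of t, so continuity in t becomes a case of dominated
    convergence. *)
Definition volterra (a : R) (g : R -> B) (t : R) : B1 :=
  RInt_gen (volterra_integrand a g t) (at_right 0) (at_left 1).

Definition volterra_const : R := / beta * (2 / l * kernel_const).

Lemma volterra_const_ge_0 : 0 <= volterra_const.
Proof.
unfold volterra_const. apply Rmult_le_pos; [left; apply Rinv_0_lt_compat; lra|].
apply Rmult_le_pos; [left; apply Rdiv_lt_0_compat; lra|apply kernel_const_ge_0].
Qed.

Section Volterra.

Variables (a T : R).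
Hypothesis HaT : a < T.
Hypothesis HT : Rpower (T - a) beta <= rate.

Lemma Rpower_le_rate (r : R) : 0 < r <= T - a -> 0 < Rpower r beta <= rate.
Proof.
intros Hr. split; [apply exp_pos|]. apply Rle_trans with (2 := HT). apply Rle_Rpower_l; lra.
Qed.

Lemma unit_interval_time (t s : R) : a < t <= T -> unit_interval s ->
  0 < (t - a) * (1 - s) <= T - a /\ a < a + (t - a) * s < T.
Proof. unfold unit_interval; intros Ht Hs. repeat split; nra. Qed.

Lemma curve_interior (V : banach) (g : R -> V) (s : R) :
  curve a T g -> a < s < T -> continuous g s.
Proof.
intros Hg Hs. assert (Hs' : on_interval a T s) by (unfold on_interval; lra).
assert (H := Hg s Hs'). move=> P HP.
assert (Hd : 0 < Rmin (s - a) (T - s)) by (apply Rmin_pos; lra).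
assert (HL : locally s (on_interval a T)).
{ exists (mkposreal _ Hd) => y Hy.
  apply ball_Rabs in Hy; simpl in Hy.
  apply Rabs_def2 in Hy. assert (A1 := Rmin_l (s - a) (T - s)). assert (A2 := Rmin_r (s - a) (T - s)).
  unfold on_interval; lra. }
assert (H1 : locally s (fun y => on_interval a T y -> P (g y))) by exact: (H P HP).
apply: (filter_imp _ _ _ (filter_and _ _ H1 HL)) => y [Hy1 Hy2]. by apply Hy1.
Qed.

(** With r = (t - a)(1 - s), the factors t - a, r^(beta-1) and r^(-beta omega) multiply to (t -
    a)^decay (1 - s)^(decay - 1). The first power is the source of all smallness for short times. *)
Lemma volterra_integrand_le (g : R -> B) (G t s : R) :
  (forall r, on_interval a T r -> norm (g r) <= G) ->
  on_interval a T t -> unit_interval s ->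
  norm (volterra_integrand a g t s) <=
  volterra_const * G * power (t - a) decay * Rpower (1 - s) (decay - 1).
Proof.
intros HG [Ht1 Ht2] Hs. unfold volterra_integrand.
destruct Ht1 as [Ht1| <-].
2: { rewrite Rminus_diag Rmult_0_l scal_zero_l norm_zero power_0. lra. }
assert (Ht : a < t <= T) by lra.
destruct (unit_interval_time Ht Hs) as [Hr Hx].
set (r := (t - a) * (1 - s)) in *.
assert (Hk := Rpower_le_rate Hr).
assert (Hg : norm (g (a + (t - a) * s)) <= G) by (apply HG; unfold on_interval; lra).
assert (Hn := proj2 (is_RInt_gen_kernel (g (a + (t - a) * s)) Hk)).
assert (Hb : 0 < / beta) by (apply Rinv_0_lt_compat; lra).
assert (Hr1 : 0 < Rpower r (beta - 1)) by apply exp_pos.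
assert (Hr2 : 0 < Rpower (Rpower r beta) (- omega)) by apply exp_pos.
assert (H2l : 0 < 2 / l) by (apply Rdiv_lt_0_compat; lra).
assert (Hkc := kernel_const_ge_0).
set (x := kernel _ _) in *.
apply: Rle_trans; [apply: norm_scal|].
change (abs ((t - a) * Rpower r (beta - 1))) with (Rabs ((t - a) * Rpower r (beta - 1))).
rewrite Rabs_pos_eq; [|nra].
apply Rle_trans with ((t - a) * Rpower r (beta - 1) * (/ beta * (2 / l * kernel_const * Rpower (Rpower r beta) (- omega) * G))).
- apply Rmult_le_compat_l; [nra|].
  apply: Rle_trans; [apply: norm_scal|].
  change (abs (/ beta)) with (Rabs (/ beta)). rewrite Rabs_pos_eq; [|lra].
  apply Rmult_le_compat_l; [lra|].
  apply: (Rle_trans _ _ _ Hn). apply Rmult_le_compat_l => //.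
  repeat apply Rmult_le_pos; lra.
- rewrite power_pos; [|lra]. unfold volterra_const.
  assert (Ep : (t - a) * (Rpower r (beta - 1) * Rpower (Rpower r beta) (- omega)) =
     Rpower (t - a) decay * Rpower (1 - s) (decay - 1)).
  { rewrite Rpower_mult -Rpower_plus.
    replace (beta - 1 + beta * - omega) with (decay - 1) by (unfold decay; ring).
    unfold unit_interval in Hs.
    unfold r. rewrite -Rpower_mult_distr; [|lra|lra].
    rewrite -Rmult_assoc -{1}(Rpower_1 (t - a)); [|lra]. rewrite -Rpower_plus.
    do 2 f_equal; ring. }
  replace ((t - a) * Rpower r (beta - 1) * (/ beta * (2 / l * kernel_const * Rpower (Rpower r beta) (- omega) * G)))
   with ((t - a) * (Rpower r (beta - 1) * Rpower (Rpower r beta) (- omega)) * (/ beta * (2 / l * kernel_const) * G)) by ring.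
  rewrite Ep. right; ring.
Qed.

Lemma volterra_integrand_continuous (g : R -> B) (t s : R) :
  curve a T g -> a < t <= T -> unit_interval s ->
  filterlim (fun p => volterra_integrand a g p.1 p.2)
    (filter_prod (within (on_interval a T) (locally t)) (locally s))
    (locally (volterra_integrand a g t s)).
Proof.
intros Hg Ht Hs.
set (FP := filter_prod (within (on_interval a T) (locally t)) (locally s)).
destruct (unit_interval_time Ht Hs) as [Hr Hx].
assert (L1 : filterlim (fun p : R * R => p.1) FP (locally t)).
{ apply: (filterlim_filter_le_2 _ (filter_le_within _)). exact: filterlim_fst. }
assert (L2 : filterlim (fun p : R * R => p.2) FP (locally s)) by exact: filterlim_snd.
assert (L3 : filterlim (fun p : R * R => p.1 - a) FP (locally (t - a))).
{ apply: (filterlim_comp_derive (f := fun x => x - a) L1). by auto_derive. }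
assert (L4 : filterlim (fun p : R * R => 1 - p.2) FP (locally (1 - s))).
{ apply: (filterlim_comp_derive (f := fun x => 1 - x) L2). by auto_derive. }
assert (L5 := filterlim_mult_2 L3 L4).
assert (L6 := filterlim_comp _ _ _ _ _ _ _ _ L5 (@continuous_Rpower _ (beta - 1) (proj1 Hr))).
assert (L7 := filterlim_comp _ _ _ _ _ _ _ _ L5 (@continuous_Rpower _ beta (proj1 Hr))).
assert (L8 : filterlim (fun p : R * R => a + (p.1 - a) * p.2) FP (locally (a + (t - a) * s))).
{ apply: (filterlim_comp_derive (f := fun x => a + x) (filterlim_mult_2 L3 L2)). by auto_derive. }
assert (L9 := filterlim_comp _ _ _ _ _ _ _ _ L8 (curve_interior Hg Hx)).
unfold volterra_integrand.
apply: filterlim_scal_2; [exact: (filterlim_mult_2 L3 L6)|].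
apply: filterlim_scal_2; [exact: filterlim_const|].
set (th := Rpower ((t - a) * (1 - s)) beta) in *.
assert (Hth : 0 < th <= rate) by by apply Rpower_le_rate.
apply: (filterlim_comp_2 (G := within (fun x => th / 2 <= x <= rate) (locally th))
   (H := locally (g (a + (t - a) * s))) _ _ (fun x y => kernel x y) _ L9 (@kernel_continuous th _ Hth)).
move=> P HP.
(* [kernel_continuous] speaks of times in [th / 2, rate] only. The lower end holds near (t, s) by
   continuity, the upper one because t <= T. *)
assert (Hth2 : 0 < th / 2) by lra.
assert (N1 : FP (fun p => th / 2 <= Rpower ((p.1 - a) * (1 - p.2)) beta <= rate ->
  P (Rpower ((p.1 - a) * (1 - p.2)) beta))) by exact: (L7 _ HP).
assert (N2 : FP (fun p => Rabs (Rpower ((p.1 - a) * (1 - p.2)) beta - th) < th / 2))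
  by exact: (proj1 (filterlim_norm _ _) L7 _ Hth2).
assert (Hta : 0 < t - a) by lra.
assert (N3 : FP (fun p : R * R => a < p.1 <= T /\ unit_interval p.2)).
{ apply: (Filter_prod _ _ _ (fun x => a < x <= T) unit_interval) => //.
  - exists (mkposreal _ Hta) => y Hy [Hy1 Hy2].
    apply ball_Rabs in Hy; simpl in Hy.
    apply Rabs_def2 in Hy. lra.
  - assert (Hd : 0 < Rmin s (1 - s)) by (unfold unit_interval in Hs; apply Rmin_pos; lra).
    exists (mkposreal _ Hd) => y Hy.
    apply ball_Rabs in Hy; simpl in Hy.
    apply Rabs_def2 in Hy. assert (A1 := Rmin_l s (1 - s)). assert (A2 := Rmin_r s (1 - s)).
    unfold unit_interval; lra. }
apply: (filter_imp _ _ _ (filter_and _ _ N1 (filter_and _ _ N2 N3))).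
intros p [H1 [H2 [H3 H4]]]. apply H1.
apply Rabs_def2 in H2. split; [lra|].
apply Rpower_le_rate. by apply unit_interval_time.
Qed.

Lemma volterra_dominated (g : R -> B) (G t : R) :
  curve a T g -> (forall r, on_interval a T r -> norm (g r) <= G) ->
  on_interval a T t ->
  dominated unit_interval
    (fun s => volterra_const * G * power (t - a) decay * Rpower (1 - s) (decay - 1))
    (volterra_integrand a g t).
Proof.
intros Hg HG Ht s Hs; split; [|exact: volterra_integrand_le].
destruct Ht as [[Ht1| <-] Ht2].
- assert (Ht : a < t <= T) by lra.
  move=> P HP. destruct (volterra_integrand_continuous Hg Ht Hs HP) as [Q1 Q2 H1 H2 H3].
  apply: filter_imp H2 => y Hy. apply: (H3 t y _ Hy).
  apply: (locally_singleton t _ H1). unfold on_interval; lra.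
- apply (continuous_ext (fun _ : R => (zero : B1))); [|exact: continuous_const].
  intros y. by rewrite /volterra_integrand Rminus_diag Rmult_0_l scal_zero_l.
Qed.

Lemma continuous_singular (A s : R) : unit_interval s ->
  continuous (fun s => A * Rpower (1 - s) (decay - 1)) s.
Proof.
intros Hs; unfold unit_interval in Hs. apply: continuous_mult; [exact: continuous_const|].
apply: ex_derive_continuous. unfold Rpower. auto_derive. lra.
Qed.

Lemma is_RInt_gen_volterra (g : R -> B) (G t : R) :
  curve a T g -> (forall r, on_interval a T r -> norm (g r) <= G) ->
  on_interval a T t ->
  is_RInt_gen (volterra_integrand a g t) (at_right 0) (at_left 1) (volterra a g t) /\
  norm (volterra a g t) <= volterra_const * G * power (t - a) decay / decay.
Proof.
intros Hg HG Ht.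
exact: (dominated_is_RInt_gen unit_interval_convex at_right_unit_interval at_left_unit_interval
  unit_interval_ends_le (@continuous_singular _) (@is_RInt_gen_singular _)
  (volterra_dominated Hg HG Ht)).
Qed.

(** Clamping the argument to [a, T] turns the curve into a function continuous at every point of the
    interval in the full topology, to which compactness applies. *)
Lemma curve_bounded (V : banach) (g : R -> V) : curve a T g ->
  exists G, 0 <= G /\ forall r, on_interval a T r -> norm (g r) <= G.
Proof.
intros Hg. set (clamp := fun r => Rmax a (Rmin T r)).
assert (Hc : forall r, on_interval a T (clamp r)).
{ intros r. unfold on_interval, clamp. split; [apply Rmax_l|].
  apply Rmax_lub; [lra|apply Rmin_l]. }
assert (Hid : forall r, on_interval a T r -> clamp r = r).
{ intros r [H1 H2]. unfold clamp. rewrite Rmin_right // Rmax_right //. }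
destruct (bounded_continuity (fun r => g (clamp r)) a T) as [M HM].
- intros r Hr.
  apply: (filterlim_comp _ _ _ clamp g _ (within (on_interval a T) (locally (clamp r)))); [|exact: Hg].
  move=> P [eps HP]. exists eps => s Hs. apply HP => //.
  unfold ball in *; simpl in *; unfold AbsRing_ball, abs, minus, plus, opp in *; simpl in *.
  apply: Rle_lt_trans Hs. unfold clamp, Rmax, Rmin.
  repeat destruct Rle_dec; unfold Rabs; repeat destruct Rcase_abs; lra.
- exists M. split.
  + assert (Ha : a <= a <= T) by lra. apply Rle_trans with (1 := norm_ge_0 (g (clamp a))).
    left; exact: HM.
  + intros r Hr. rewrite -{1}(Hid r Hr). left; exact: HM.
Qed.

(** At t > a this is dominated convergence. At t = a the kernel would be taken at time 0, where it
    is singular; there the norm bound with its factor (t - a)^decay tends to 0. *)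
Lemma volterra_curve (g : R -> B) : curve a T g -> curve a T (volterra a g).
Proof.
intros Hg. destruct (curve_bounded Hg) as [G [HG0 HG]].
assert (Hd := decay_pos). assert (Hvc := volterra_const_ge_0).
intros t0 [[Ht1| <-] Ht2].
- apply: (dominated_convergence_prod unit_interval_convex at_right_unit_interval at_left_unit_interval
    unit_interval_ends_le (@continuous_singular (volterra_const * G * power (T - a) decay))
    (@is_RInt_gen_singular _) (F := volterra_integrand a g)).
  + intros s Hs. assert (Ht : on_interval a T t0) by (unfold on_interval; lra).
    destruct (volterra_dominated Hg HG Ht Hs) as [H1 H2]. split => //.
    apply: (Rle_trans _ _ _ H2). apply Rmult_le_compat_r; [left; apply exp_pos|].
    apply Rmult_le_compat_l; [apply Rmult_le_pos; lra|]. apply power_le => //. lra.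
  + exists (mkposreal _ Rlt_0_1) => t _ Ht s Hs.
    destruct (volterra_dominated Hg HG Ht Hs) as [H1 H2]. split => //.
    apply: (Rle_trans _ _ _ H2). apply Rmult_le_compat_r; [left; apply exp_pos|].
    apply Rmult_le_compat_l; [apply Rmult_le_pos; lra|]. apply power_le => //.
    unfold on_interval in Ht; lra.
  + intros s Hs. apply volterra_integrand_continuous => //; lra.
- apply/filterlim_norm => eps He.
  assert (HK : 0 <= volterra_const * G / decay).
  { apply Rmult_le_pos; [by apply Rmult_le_pos|left; by apply Rinv_0_lt_compat]. }
  set (K := volterra_const * G / decay) in *.
  assert (He' : 0 < eps / (K + 1)) by (apply Rdiv_lt_0_compat; lra).
  destruct (power_small Hd He') as [d [Hd0 Hpow]].
  exists (mkposreal _ Hd0) => t Ht HtT.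
  apply ball_Rabs in Ht; simpl in Ht.
  apply Rabs_def2 in Ht.
  assert (Ea : volterra a g a = zero).
  { apply: norm_eq_zero. apply Rle_antisym; [|apply norm_ge_0].
    assert (Ha : on_interval a T a) by (unfold on_interval; lra).
    apply: (Rle_trans _ _ _ (proj2 (is_RInt_gen_volterra Hg HG Ha))).
    rewrite Rminus_diag power_0. lra. }
  rewrite Ea minus_zero_r.
  apply: (Rle_lt_trans _ _ _ (proj2 (is_RInt_gen_volterra Hg HG HtT))).
  assert (Hp : power (t - a) decay < eps / (K + 1)) by (apply Hpow; lra).
  assert (Hp0 := power_ge_0 (t - a) decay).
  apply Rle_lt_trans with ((K + 1) * power (t - a) decay).
  + replace (volterra_const * G * power (t - a) decay / decay) with
      (K * power (t - a) decay) by (unfold K; field; lra).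
    apply Rmult_le_compat_r; lra.
  + apply (Rmult_lt_compat_l (K + 1)) in Hp; [|lra].
    replace ((K + 1) * (eps / (K + 1))) with eps in Hp;
      [exact Hp|field; lra].
Qed.

Lemma volterra_minus (g h : R -> B) (t : R) : curve a T g -> curve a T h ->
  on_interval a T t ->
  volterra a (fun s => minus (g s) (h s)) t = minus (volterra a g t) (volterra a h t).
Proof.
intros Hg Hh Ht.
destruct (curve_bounded Hg) as [G [_ HG]]. destruct (curve_bounded Hh) as [G' [_ HG']].
refine (is_RInt_gen_unique (volterra_integrand a (fun s => minus (g s) (h s)) t) _ _).
assert (H := is_RInt_gen_minus _ _ _ _ (proj1 (is_RInt_gen_volterra Hg HG Ht))
  (proj1 (is_RInt_gen_volterra Hh HG' Ht))).
apply: is_RInt_gen_ext H.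
apply: (Filter_prod _ _ _ _ _ at_right_unit_interval at_left_unit_interval).
intros p q Hp Hq s Hs; simpl in Hs.
assert (Hs' : unit_interval s).
{ revert Hs; unfold unit_interval, Rmin, Rmax in *; destruct Rle_dec; lra. }
unfold volterra_integrand.
destruct Ht as [[Ht1| <-] Ht2].
- assert (Ht : a < t <= T) by lra.
  rewrite kernel_minus ?scal_minus_distr_l //.
  apply Rpower_le_rate. by apply unit_interval_time.
- rewrite Rminus_diag !Rmult_0_l !scal_zero_l minus_zero_r //.
Qed.

Lemma filterlim_affine_right (x y u v : R) : 0 < u -> u * x + v = y ->
  filterlim (fun z => u * z + v) (at_right x) (at_right y).
Proof.
intros Hu <- P [eps HP]. destruct eps as [e He]; simpl in HP.
assert (Hd : 0 < e / u) by by apply Rdiv_lt_0_compat.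
exists (mkposreal _ Hd) => z Hz Hxz.
unfold ball in *; simpl in *; unfold AbsRing_ball, abs, minus, plus, opp in *; simpl in *.
apply HP; [|nra].
replace (u * z + v + - (u * x + v)) with (u * (z + - x)) by ring.
rewrite Rabs_mult (Rabs_pos_eq u); [|lra].
apply (Rmult_lt_compat_l u) in Hz => //.
replace (u * (e / u)) with e in Hz by (field; lra). exact Hz.
Qed.

Lemma filterlim_affine_left (x y u v : R) : 0 < u -> u * x + v = y ->
  filterlim (fun z => u * z + v) (at_left x) (at_left y).
Proof.
intros Hu <- P [eps HP]. destruct eps as [e He]; simpl in HP.
assert (Hd : 0 < e / u) by by apply Rdiv_lt_0_compat.
exists (mkposreal _ Hd) => z Hz Hxz.
unfold ball in *; simpl in *; unfold AbsRing_ball, abs, minus, plus, opp in *; simpl in *.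
apply HP; [|nra].
replace (u * z + v + - (u * x + v)) with (u * (z + - x)) by ring.
rewrite Rabs_mult (Rabs_pos_eq u); [|lra].
apply (Rmult_lt_compat_l u) in Hz => //.
replace (u * (e / u)) with e in Hz by (field; lra). exact Hz.
Qed.

Lemma at_right_between (x y : R) : x < y -> at_right x (fun z => x < z < y).
Proof.
intros H. apply: filter_and; [|by apply at_right_lt]. by exists (mkposreal _ Rlt_0_1).
Qed.

Lemma at_left_between (x y : R) : x < y -> at_left y (fun z => x < z < y).
Proof.
intros H. apply: filter_and; [by apply at_left_gt|]. by exists (mkposreal _ Rlt_0_1).
Qed.

(** The substitution s -> (s - a) / (t - a) returns to [a, t]. At t = a the convolution vanishes, in
    agreement with the convention of [is_integral]. *)
Lemma is_integral_volterra (g : R -> B) (t : R) : curve a T g -> on_interval a T t ->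
  is_integral (fun s => scal (Rpower (t - s) (beta - 1))
    (mittag_leffler' beta E (power (t - s) beta) (g s))) a t (j1 (volterra a g t)).
Proof.
intros Hg Ht. destruct (curve_bounded Hg) as [G [HG0 HG]].
assert (H := is_RInt_gen_volterra Hg HG Ht).
destruct Ht as [[Ht1| <-] Ht2].
- left; split => //.
  assert (Hta : 0 < t - a) by lra. assert (Hu := Rinv_0_lt_compat _ Hta).
  have H0 : / (t - a) * a + - a / (t - a) = 0 by field; lra.
  have H1 : / (t - a) * t + - a / (t - a) = 1 by field; lra.
  assert (Hi := is_RInt_gen_comp_lin (u := / (t - a)) (v := - a / (t - a))
    (Ga := at_right a) (Gb := at_left t)
    (filterlim_affine_right Hu H0) (filterlim_affine_left Hu H1)
    (is_RInt_gen_linear j1_linear (proj1 H))).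
  apply: is_RInt_gen_ext Hi.
  apply: (Filter_prod _ _ _ _ _ (at_right_between Ht1) (at_left_between Ht1)).
  intros p q Hp Hq s Hs; simpl in Hs.
  assert (Hs' : a < s < t).
  { revert Hs; unfold Rmin, Rmax in *; destruct Rle_dec; lra. }
  unfold volterra_integrand.
  replace ((t - a) * (1 - (/ (t - a) * s + - a / (t - a)))) with (t - s) by (field; lra).
  replace (a + (t - a) * (/ (t - a) * s + - a / (t - a))) with s by (field; lra).
  rewrite (linear_scal _ j1_linear) power_pos; [|lra].
  rewrite mittag_leffler'_kernel; [|apply Rpower_le_rate; lra].
  rewrite scal_assoc. f_equal. unfold mult; simpl. field; lra.
- right; split => //.
  replace (volterra a g a) with (zero : B1).
  + assert (H1 := linear_scal _ j1_linear 0 zero). by rewrite !scal_zero_l in H1.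
  + symmetry. apply: norm_eq_zero. apply Rle_antisym; [|apply norm_ge_0].
    apply: (Rle_trans _ _ _ (proj2 H)). rewrite Rminus_diag power_0; lra.
Qed.

(** * The mild formulas as identities in B1 *)

Definition mild (y : B1) (g : R -> B) (t : R) : B1 :=
  plus (scal (/ beta) (initial (power (t - a) beta) y)) (scal beta (volterra a g t)).

Lemma is_integral_unique (V : banach) (g : R -> V) (s t : R) (v w : V) :
  is_integral g s t v -> is_integral g s t w -> v = w.
Proof.
intros [[H1 H2]|[H1 H2]] [[H3 H4]|[H3 H4]]; try lra.
- by rewrite -(is_RInt_gen_unique _ _ H2) -(is_RInt_gen_unique _ _ H4).
- by rewrite H2 H4.
Qed.

Lemma power_rate (t : R) : on_interval a T t -> 0 <= power (t - a) beta <= rate.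
Proof.
intros [Ht1 Ht2]. split; [apply power_ge_0|].
apply Rle_trans with (2 := HT). rewrite -power_pos; [|lra]. apply power_le; lra.
Qed.

(** Both terms of the formula are images under [j1], which can be cancelled; uniqueness of the
    integral identifies the existentially quantified value. *)
Lemma forward_mild_iff (y : B1) (g : R -> B) (x : R -> B1) : curve a T g ->
  forward_mild beta E a T (j1 y) g (fun t => j1 (x t)) <->
  forall t, on_interval a T t -> x t = mild y g t.
Proof.
intros Hg. split.
- intros Hm t Ht. destruct (Hm t Ht) as [v [Hv Hx]].
  rewrite (is_integral_unique Hv (is_integral_volterra Hg Ht)) in Hx.
  rewrite (mittag_leffler_initial y (power_rate Ht)) in Hx.
  apply j1_inj. rewrite Hx /mild (linear_plus _ j1_linear) (linear_scal _ j1_linear beta) //.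
- intros Hm t Ht. exists (j1 (volterra a g t)); split; [exact: is_integral_volterra|].
  rewrite (mittag_leffler_initial y (power_rate Ht)) Hm // /mild (linear_plus _ j1_linear)
    (linear_scal _ j1_linear beta) //.
Qed.

Lemma is_integral_reflect (V : banach) (g : R -> V) (c s t : R) (v : V) :
  is_integral g s t v -> is_integral (fun x => g (c - x)) (c - t) (c - s) v.
Proof.
intros [[H1 H2]|[-> ->]]; [left|right; by split].
split; [lra|].
assert (L1 : filterlim (fun x => -1 * x + c) (at_left (c - s)) (at_right s)).
{ move=> P [eps HP]. exists eps => z Hz Hlt. apply HP; [|lra].
  unfold ball in *; simpl in *; unfold AbsRing_ball, abs, minus, plus, opp in *; simpl in *.
  apply: Rle_lt_trans Hz. rewrite -Rabs_Ropp. right; f_equal; ring. }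
assert (L2 : filterlim (fun x => -1 * x + c) (at_right (c - t)) (at_left t)).
{ move=> P [eps HP]. exists eps => z Hz Hlt. apply HP; [|lra].
  unfold ball in *; simpl in *; unfold AbsRing_ball, abs, minus, plus, opp in *; simpl in *.
  apply: Rle_lt_trans Hz. rewrite -Rabs_Ropp. right; f_equal; ring. }
assert (H3 := is_RInt_gen_opp _ _ (is_RInt_gen_swap _ _ (is_RInt_gen_comp_lin L1 L2 H2))).
rewrite opp_opp in H3.
apply: is_RInt_gen_ext H3. apply: filter_forall => p x _.
replace (-1 * x + c) with (c - x) by ring.
rewrite -scal_opp_l. rewrite -[RHS]scal_one. f_equal. unfold opp, one; simpl. ring.
Qed.

Lemma is_integral_ext (V : banach) (g h : R -> V) (s t : R) (v : V) :
  (forall x, s < x < t -> g x = h x) -> is_integral g s t v -> is_integral h s t v.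
Proof.
intros He [[H1 H2]|[H1 H2]]; [left; split => //|by right].
apply: is_RInt_gen_ext H2.
apply: (Filter_prod _ _ _ _ _ (at_right_between H1) (at_left_between H1)).
intros p q Hp Hq x Hx; simpl in Hx. apply He.
revert Hx; unfold Rmin, Rmax in *; destruct Rle_dec; lra.
Qed.

Lemma is_integral_opp (V : banach) (g : R -> V) (s t : R) (v : V) :
  is_integral g s t v -> is_integral (fun x => opp (g x)) s t (opp v).
Proof.
intros [[H1 H2]|[H1 ->]]; [left; split => //|right; split => //].
- by apply: is_RInt_gen_opp.
- by rewrite opp_zero.
Qed.

Lemma kernel_opp (tau : R) (v : B) : 0 < tau <= rate -> kernel tau (opp v) = opp (kernel tau v).
Proof.
intros Ht. assert (H0 := kernel_minus v v Ht). rewrite !minus_eq_zero in H0.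
assert (H1 := kernel_minus zero v Ht). by rewrite H0 /minus !plus_zero_l in H1.
Qed.

Lemma curve_reflect (V : banach) (g : R -> V) : curve a T g -> curve a T (fun t => g (a + T - t)).
Proof.
intros Hg t Ht.
assert (Ht' : on_interval a T (a + T - t)) by (unfold on_interval in *; lra).
apply: (filterlim_comp _ _ _ (fun t => a + T - t) g _ _ _ _ (Hg _ Ht')).
move=> P [eps HP]. exists eps => s Hs HsT. apply HP; [|unfold on_interval in *; lra].
unfold ball in *; simpl in *; unfold AbsRing_ball, abs, minus, plus, opp in *; simpl in *.
apply: Rle_lt_trans Hs. rewrite -Rabs_Ropp. right; f_equal; ring.
Qed.

Lemma curve_opp (V : banach) (g : R -> V) : curve a T g -> curve a T (fun t => opp (g t)).
Proof.
intros Hg t Ht. exact: (filterlim_comp _ _ _ g opp _ _ _ (Hg t Ht) (filterlim_opp (g t))).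
Qed.

(** The reflection t -> a + T - t turns the backward formula into a forward one. Its minus sign
    moves into the source, hence [opp]. *)
Lemma backward_mild_iff (z : B1) (g : R -> B) (x : R -> B1) : curve a T g ->
  backward_mild beta E a T (j1 z) g (fun t => j1 (x t)) <->
  forall t, on_interval a T t -> x t = mild z (fun s => opp (g (a + T - s))) (a + T - t).
Proof.
intros Hg. set (h := fun s => opp (g (a + T - s))).
assert (Hh : curve a T h) by by apply: curve_opp; apply: curve_reflect.
assert (Hi : forall t, on_interval a T t ->
  is_integral (fun s => scal (Rpower (s - t) (beta - 1))
                            (mittag_leffler' beta E (power (s - t) beta) (g s))) t T
    (opp (j1 (volterra a h (a + T - t))))).
{ intros t Ht.
  assert (Ht' : on_interval a T (a + T - t)) by (unfold on_interval in *; lra).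
  assert (H := is_integral_opp (is_integral_reflect (a + T) (is_integral_volterra Hh Ht'))).
  replace (a + T - (a + T - t)) with t in H by ring.
  replace (a + T - a) with T in H by ring.
  apply: is_integral_ext H => s Hs.
  replace (a + T - t - (a + T - s)) with (s - t) by ring.
  unfold h. replace (a + T - (a + T - s)) with s by ring.
  unfold on_interval in Ht.
  assert (Hr : 0 < power (s - t) beta <= rate).
  { rewrite power_pos; [|lra]. apply Rpower_le_rate; lra. }
  rewrite !(mittag_leffler'_kernel _ Hr) kernel_opp // scal_opp_r (linear_opp _ j1_linear).
  by rewrite -scal_opp_r opp_opp. }
assert (Hml : forall t, on_interval a T t ->
  mittag_leffler beta E (power (T - t) beta) (j1 z) =
  j1 (scal (/ beta) (initial (power (a + T - t - a) beta) z))).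
{ intros t Ht. replace (a + T - t - a) with (T - t) by ring.
  apply mittag_leffler_initial. replace (T - t) with (a + T - t - a) by ring.
  apply power_rate. unfold on_interval in *; lra. }
assert (Hs : forall t p, minus (p : B) (scal beta (opp (j1 (volterra a h (a + T - t))))) =
  plus p (j1 (scal beta (volterra a h (a + T - t))))).
{ intros t p. by rewrite (linear_scal _ j1_linear) /minus scal_opp_r opp_opp. }
split.
- intros Hm t Ht. destruct (Hm t Ht) as [v [Hv Hx]].
  rewrite (is_integral_unique Hv (Hi t Ht)) Hml // Hs in Hx.
  apply j1_inj. by rewrite Hx /mild (linear_plus _ j1_linear).
- intros Hm t Ht. eexists; split; [exact: Hi|].
  by rewrite Hml // Hs Hm // /mild (linear_plus _ j1_linear).
Qed.

Lemma mild_curve (y : B1) (g : R -> B) : curve a T g -> curve a T (mild y g).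
Proof.
intros Hg t Ht. unfold mild.
apply: filterlim_plus_2; apply: filterlim_scal_2; try exact: filterlim_const.
- assert (Hr := power_rate Ht).
  apply: (filterlim_comp _ _ _ (fun t => power (t - a) beta) (fun r => initial r y) _ _ _ _
    (@initial_continuous _ y Hr)).
  move=> P HP.
  assert (Hc : continuous (fun t => power (t - a) beta) t).
  { apply: (continuous_comp (fun t => t - a) (fun r => power r beta)).
    - apply: ex_derive_continuous. by auto_derive.
    - apply continuous_power; unfold on_interval in Ht; lra. }
  assert (H1 : locally t (fun s => 0 <= power (s - a) beta <= rate ->
    P (power (s - a) beta))) by exact: (Hc _ HP).
  change (locally t (fun s => on_interval a T s -> P (power (s - a) beta))).
  apply: filter_imp H1 => s Hs HsT. apply Hs. exact: power_rate.
- exact: volterra_curve.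
Qed.

Definition initial_bound : R := / beta * (2 / l * (Cw * M1)).
Definition source_bound : R := beta * (volterra_const / decay).

Lemma mild_le (y : B1) (g : R -> B) (G t : R) : curve a T g ->
  (forall r, on_interval a T r -> norm (g r) <= G) -> on_interval a T t ->
  norm (mild y g t) <= initial_bound * norm y + source_bound * power (T - a) decay * G.
Proof.
intros Hg HG Ht.
assert (HG0 : 0 <= G) by (apply: Rle_trans; [apply: norm_ge_0|exact: (HG t Ht)]).
assert (Hd := decay_pos). assert (Hvc := volterra_const_ge_0).
assert (H1 := proj2 (is_RInt_gen_initial y (power_rate Ht))).
assert (H2 := proj2 (is_RInt_gen_volterra Hg HG Ht)).
assert (H3 : power (t - a) decay <= power (T - a) decay).
{ apply power_le => //. unfold on_interval in Ht; lra. }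
assert (Hb : 0 < / beta) by (apply Rinv_0_lt_compat; lra).
unfold mild. apply: Rle_trans; [apply: norm_triangle|].
apply Rplus_le_compat; (apply: Rle_trans; [apply: norm_scal|]).
- change (abs (/ beta)) with (Rabs (/ beta)). rewrite Rabs_pos_eq; [|lra].
  unfold initial_bound. rewrite (Rmult_assoc (/ beta)). apply Rmult_le_compat_l; [lra|exact H1].
- change (abs beta) with (Rabs beta). rewrite Rabs_pos_eq; [|lra].
  unfold source_bound. rewrite !(Rmult_assoc beta). apply Rmult_le_compat_l; [lra|].
  apply: (Rle_trans _ _ _ H2).
  replace (volterra_const * G * power (t - a) decay / decay) with
    (volterra_const / decay * (power (t - a) decay * G)) by (field; lra).
  rewrite (Rmult_assoc (volterra_const / decay)).
  apply Rmult_le_compat_l; [by apply Rdiv_le_0_compat|]. by apply Rmult_le_compat_r.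
Qed.

Lemma minus_plus_plus (V : banach) (p q p' q' : V) :
  minus (plus p q) (plus p' q') = plus (minus p p') (minus q q').
Proof.
unfold minus. rewrite opp_plus -!plus_assoc. f_equal.
by rewrite plus_assoc (plus_comm q) -plus_assoc.
Qed.

Lemma curve_minus (V : banach) (g h : R -> V) : curve a T g -> curve a T h ->
  curve a T (fun t => minus (g t) (h t)).
Proof.
intros Hg Hh t Ht. apply: filterlim_plus_2; [exact: Hg|exact: (curve_opp Hh)].
Qed.

Lemma mild_minus_le (y y' : B1) (g g' : R -> B) (G t : R) : curve a T g -> curve a T g' ->
  (forall r, on_interval a T r -> norm (minus (g r) (g' r)) <= G) -> on_interval a T t ->
  norm (minus (mild y g t) (mild y' g' t)) <=
  initial_bound * norm (minus y y') + source_bound * power (T - a) decay * G.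
Proof.
intros Hg Hg' HG Ht.
replace (minus (mild y g t) (mild y' g' t)) with
  (mild (minus y y') (fun s => minus (g s) (g' s)) t).
- apply mild_le => //. by apply: curve_minus.
- unfold mild. rewrite volterra_minus // initial_minus; [|exact: power_rate].
  by rewrite minus_plus_plus !scal_minus_distr_l.
Qed.

End Volterra.

End Kernel.

(* Sol a y g is the mild solution on [a, T], for any T close to a, of the linear
   equation with initial value y and source g. *)
Record mild_operator (B1 B : banach) (j1 : B1 -> B) (E : R -> B -> B)
    (beta q C d : R) (Sol : R -> B1 -> (R -> B) -> R -> B1) : Prop := {
  mild_operator_forward : forall a T y g x, a < T <= a + d -> curve a T g ->
    forward_mild beta E a T (j1 y) g (fun t => j1 (x t)) <->
    forall t, on_interval a T t -> x t = Sol a y g t;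
  mild_operator_backward : forall a T z g x, a < T <= a + d -> curve a T g ->
    backward_mild beta E a T (j1 z) g (fun t => j1 (x t)) <->
    forall t, on_interval a T t ->
      x t = Sol a z (fun s => opp (g (a + T - s))) (a + T - t);
  mild_operator_curve : forall a T y g, a < T <= a + d -> curve a T g ->
    curve a T (Sol a y g);
  mild_operator_le : forall a T y g G t, a < T <= a + d -> curve a T g ->
    (forall r, on_interval a T r -> norm (g r) <= G) -> on_interval a T t ->
    norm (Sol a y g t) <= C * norm y + C * power (T - a) q * G;
  mild_operator_minus_le : forall a T y y' g g' G t, a < T <= a + d ->
    curve a T g -> curve a T g' ->
    (forall r, on_interval a T r -> norm (minus (g r) (g' r)) <= G) ->
    on_interval a T t ->
    norm (minus (Sol a y g t) (Sol a y' g' t)) <=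
    C * norm (minus y y') + C * power (T - a) q * G }.

(** From here on only this interface is used, once for A and once for A^b. The exponent beta (1 -
    omega) is the gain of the singular convolution. *)
Lemma mild_operator_exists (beta kappa omega : R) (B2 B1 B : banach)
    (j2 : B2 -> B1) (j1 : B1 -> B) (A : B2 -> B) (E : R -> B -> B)
    (E1 : R -> B1 -> B1) (M m M1 m1 : R) :
  0 < beta < 1 -> 0 < omega < 1 -> 0 < kappa ->
  banach_triple j2 j1 -> generated_semigroup j2 j1 A E E1 M m M1 m1 ->
  smoothing j1 E kappa omega ->
  exists Sol C d, 0 <= C /\ 0 < d /\
    mild_operator j1 E beta (beta * (1 - omega)) C d Sol.
Proof.
intros Hbeta Homega Hkappa [_ [[Hlin [Hinj _]] _]]
  [_ [[El [_ [Ep _]]] [[E1l [_ [_ E1c]]] [HE [_ [[_ [_ [HM1 Hm1]]] [_ E1n]]]]]]] Hs.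
destruct (wright_le Hbeta) as [Cw [l [HCw [Hl Hw]]]].
assert (E1n' : forall t x, 0 <= t -> norm (E1 t x) <= M1 * exp (m1 * t) * norm x).
{ intros t x Ht. by apply E1n. }
set (Ci := initial_bound M1 beta Cw l).
set (Cs := source_bound M1 kappa omega beta Cw l).
assert (HC : 0 <= Ci /\ 0 <= Cs).
{ assert (H2l : 0 < 2 / l) by (apply Rdiv_lt_0_compat; lra).
  assert (Hb : 0 < / beta) by (apply Rinv_0_lt_compat; lra).
  split.
  - unfold Ci, initial_bound. apply Rmult_le_pos; [lra|]. apply Rmult_le_pos; [lra|].
    by apply Rmult_le_pos.
  - unfold Cs, source_bound. apply Rmult_le_pos; [lra|]. apply Rdiv_le_0_compat.
    + by apply volterra_const_ge_0.
    + by apply decay_pos. }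
(* The length rate^(1/beta) is what makes (T - a)^beta <= rate; the sum serves as a single constant
   for the initial value and the source. *)
exists (mild j1 E E1 beta), (Ci + Cs), (Rpower (rate m1 l) (/ beta)).
split; [lra|]. split; [apply exp_pos|].
assert (HT : forall a T, a < T <= a + Rpower (rate m1 l) (/ beta) ->
  a < T /\ Rpower (T - a) beta <= rate m1 l).
{ intros a T HaT. split; [lra|].
  apply Rle_trans with (Rpower (Rpower (rate m1 l) (/ beta)) beta).
  - apply Rle_Rpower_l; lra.
  - rewrite Rpower_mult Rinv_l; [|lra]. rewrite Rpower_1; [lra|exact: (rate_pos Hbeta Hm1 Hl)]. }
assert (Hle : forall x y p : R, 0 <= x -> 0 <= y -> 0 <= p ->
  Ci * x + Cs * p * y <= (Ci + Cs) * x + (Ci + Cs) * p * y).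
{ intros x y p Hx Hy Hp. assert (0 <= Cs * x) by nra. assert (0 <= Ci * (p * y)).
  { apply Rmult_le_pos; [lra|by apply Rmult_le_pos]. } nra. }
split.
- intros a T y g x HaT Hg. destruct (HT a T HaT). by apply (@forward_mild_iff B1 B j1 E E1 M1 m1 kappa omega beta Cw l Hbeta Homega Hkappa HM1 Hm1 Hlin Hinj El Ep E1c HE E1n' Hs HCw Hl Hw a T).
- intros a T y g x HaT Hg. destruct (HT a T HaT). by apply (@backward_mild_iff B1 B j1 E E1 M1 m1 kappa omega beta Cw l Hbeta Homega Hkappa HM1 Hm1 Hlin Hinj El Ep E1c HE E1n' Hs HCw Hl Hw a T).
- intros a T y g HaT Hg. destruct (HT a T HaT). by apply (@mild_curve B1 B j1 E E1 M1 m1 kappa omega beta Cw l Hbeta Homega Hkappa HM1 Hm1 Hlin Hinj El Ep E1c HE E1n' Hs HCw Hl Hw a T).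
- intros a T y g G t HaT Hg HG Ht. destruct (HT a T HaT).
  apply Rle_trans with (Ci * norm y + Cs * power (T - a) (beta * (1 - omega)) * G).
  + by apply (@mild_le B1 B j1 E E1 M1 m1 kappa omega beta Cw l Hbeta Homega Hkappa HM1 Hm1 Hlin Hinj El Ep E1c HE E1n' Hs HCw Hl Hw a T).
  + apply Hle; [apply norm_ge_0| |apply power_ge_0].
    apply: Rle_trans (HG t Ht). apply norm_ge_0.
- intros a T y y' g g' G t HaT Hg Hg' HG Ht. destruct (HT a T HaT).
  apply Rle_trans with (Ci * norm (minus y y') + Cs * power (T - a) (beta * (1 - omega)) * G).
  + by apply (@mild_minus_le B1 B j1 E E1 M1 m1 kappa omega beta Cw l Hbeta Homega Hkappa HM1 Hm1 Hlin Hinj El Ep E1l E1c HE E1n' Hs HCw Hl Hw a T).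
  + apply Hle; [apply norm_ge_0| |apply power_ge_0].
    apply: Rle_trans (HG t Ht). apply norm_ge_0.
Qed.

(** Lets the forward and the backward equation share C and d. *)
Lemma mild_operator_weaken (B1 B : banach) (j1 : B1 -> B) (E : R -> B -> B)
    (beta q C d C' d' : R) (Sol : R -> B1 -> (R -> B) -> R -> B1) :
  C <= C' -> d' <= d -> mild_operator j1 E beta q C d Sol ->
  mild_operator j1 E beta q C' d' Sol.
Proof.
intros HC Hd [H1 H2 H3 H4 H5].
assert (Hle : forall x y p : R, 0 <= x -> 0 <= y -> 0 <= p ->
  C * x + C * p * y <= C' * x + C' * p * y).
{ intros x y p Hx Hy Hp. assert (0 <= p * y) by by apply Rmult_le_pos. nra. }
split.
- intros a T y g x HaT. apply H1; lra.
- intros a T y g x HaT. apply H2; lra.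
- intros a T y g HaT. apply H3; lra.
- intros a T y g G t HaT Hg HG Ht.
  apply Rle_trans with (C * norm y + C * power (T - a) q * G); [apply H4 => //; lra|].
  apply Hle; [apply norm_ge_0| |apply power_ge_0].
  apply: Rle_trans (HG t Ht). apply norm_ge_0.
- intros a T y y' g g' G t HaT Hg Hg' HG Ht.
  apply Rle_trans with (C * norm (minus y y') + C * power (T - a) q * G); [apply H5 => //; lra|].
  apply Hle; [apply norm_ge_0| |apply power_ge_0].
  apply: Rle_trans (HG t Ht). apply norm_ge_0.
Qed.

(** * The sup-norm and uniform limits of curves *)

Section SupNorm.

Variables (V : banach) (a T : R).
Hypothesis HaT : a < T.

(** [sup_norm] is the [real] part of an extended supremum and would be 0 by default if that were
    infinite. The bound G and the point a of the interval make it finite. *)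
Lemma sup_norm_spec (v : R -> V) (G : R) :
  (forall t, on_interval a T t -> norm (v t) <= G) ->
  (forall t, on_interval a T t -> norm (v t) <= sup_norm a T v) /\ sup_norm a T v <= G.
Proof.
intros HG. unfold sup_norm.
assert (HL := Lub_Rbar_correct (fun r => exists t, on_interval a T t /\ r = norm (v t))).
destruct HL as [H1 H2].
assert (Ha : on_interval a T a) by (unfold on_interval; lra).
assert (H3 : Rbar_le (Lub_Rbar (fun r => exists t, on_interval a T t /\ r = norm (v t))) G).
{ apply H2. intros r [t [Ht ->]]. exact: HG. }
assert (H4 : forall t, on_interval a T t ->
  Rbar_le (norm (v t)) (Lub_Rbar (fun r => exists t, on_interval a T t /\ r = norm (v t)))).
{ intros t Ht. apply H1. by exists t. }
destruct (Lub_Rbar _) as [r| |]; simpl in *.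
- by split.
- by [].
- by destruct (H4 a Ha).
Qed.

(** Completeness of C([a,T], V) for geometric increments: limits are taken pointwise in V, and the
    uniform rate carries continuity over. *)
Lemma uniform_limit (v : nat -> R -> V) (K : R) : 0 <= K ->
  (forall k, curve a T (v k)) ->
  (forall k t, on_interval a T t -> norm (minus (v (S k) t) (v k t)) <= K * (/ 2) ^ k) ->
  exists w, curve a T w /\
    forall k t, on_interval a T t -> norm (minus (w t) (v k t)) <= 2 * K * (/ 2) ^ k.
Proof.
intros HK Hc Hd.
assert (Hp : forall k, 0 < (/ 2) ^ k) by (intros k; apply pow_lt; lra).
(* The subtracted term makes the induction on j exact: each increment K 2^(-(j+k)) is half of it. *)
assert (Hj : forall t, on_interval a T t -> forall k j,
  norm (minus (v (j + k)%nat t) (v k t)) <= 2 * K * (/ 2) ^ k - 2 * K * (/ 2) ^ (j + k)).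
{ intros t Ht k j. induction j as [|j IH].
  - rewrite /= minus_eq_zero norm_zero. lra.
  - apply: (Rle_trans _ _ _ (norm_minus_trans (v (j + k)%nat t) _ _)).
    assert (H := Hd (j + k)%nat t Ht).
    replace ((/ 2) ^ (S j + k)) with (/ 2 * (/ 2) ^ (j + k)) by reflexivity.
    apply Rle_trans with (K * (/ 2) ^ (j + k) + (2 * K * (/ 2) ^ k - 2 * K * (/ 2) ^ (j + k))).
    + apply Rplus_le_compat; [exact H|exact IH].
    + lra. }
assert (Hsmall : forall eps, 0 < eps -> exists k, 2 * K * (/ 2) ^ k < eps).
{ intros eps He.
  assert (He' : 0 < eps / (2 * K + 1)) by (apply Rdiv_lt_0_compat; lra).
  assert (H2 : Rabs (/ 2) < 1) by (rewrite Rabs_pos_eq; lra).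
  destruct (pow_lt_1_zero (/ 2) H2 _ He') as [k Hk].
  exists k. specialize (Hk k (le_n k)). rewrite Rabs_pos_eq in Hk; [|left; apply Hp].
  apply (Rmult_lt_compat_l (2 * K + 1)) in Hk; [|lra].
  replace ((2 * K + 1) * (eps / (2 * K + 1))) with eps in Hk by (field; lra).
  specialize (Hp k). lra. }
assert (Hlim : forall t, exists w, on_interval a T t ->
  forall k, norm (minus w (v k t)) <= 2 * K * (/ 2) ^ k).
{ intros t. destruct (classic (on_interval a T t)) as [Ht|Ht]; [|by exists zero].
  destruct (proj1 (filterlim_locally_cauchy (F := eventually) (fun k => v k t))) as [w Hw].
  - intros [eps He]. destruct (Hsmall (eps / 2)) as [k Hk]; [lra|].
    exists (fun i => (k <= i)%nat). split; [by exists k|].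
    intros i j Hi Hj'. apply: norm_compat1. simpl.
    assert (N : forall i, (k <= i)%nat -> norm (minus (v i t) (v k t)) <= 2 * K * (/ 2) ^ k).
    { clear i j Hi Hj'. intros i Hi. assert (H := Hj t Ht k (i - k)%nat).
      rewrite PeanoNat.Nat.sub_add in H => //.
      apply: (Rle_trans _ _ _ H). specialize (Hp i). assert (0 <= K * (/ 2) ^ i) by nra. lra. }
    apply: (Rle_lt_trans _ _ _ (norm_minus_trans (v k t) _ _)).
    replace eps with (eps / 2 + eps / 2) by field.
    apply Rplus_lt_compat; [|rewrite norm_minus_sym];
      (apply: Rle_lt_trans Hk; exact: N).
  - exists w => _ k. apply le_epsilon => eps He.
    destruct (proj1 (filterlim_norm _ _) Hw _ He) as [i Hi].
    set (j := (i + k)%nat).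
    apply: (Rle_trans _ _ _ (norm_minus_trans (v j t) _ _)).
    rewrite Rplus_comm. apply Rplus_le_compat.
    + apply: (Rle_trans _ _ _ (Hj t Ht k i)). specialize (Hp (i + k)%nat).
      assert (0 <= K * (/ 2) ^ (i + k)) by nra. lra.
    + left. rewrite norm_minus_sym. apply Hi. unfold j. apply PeanoNat.Nat.le_add_r. }
(* Choice assembles the pointwise limits into one function; off [a,T] its values are arbitrary. *)
set (w := fun t => epsilon (inhabits zero) (fun w : V => on_interval a T t ->
  forall k, norm (minus w (v k t)) <= 2 * K * (/ 2) ^ k)).
assert (Hw : forall t, on_interval a T t ->
  forall k, norm (minus (w t) (v k t)) <= 2 * K * (/ 2) ^ k).
{ intros t. exact: (epsilon_spec (inhabits zero) _ (Hlim t)). }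
exists w; split; [|by intros; apply Hw].
intros t Ht. apply/filterlim_norm => eps He.
assert (He3 : 0 < eps / 3) by lra.
destruct (Hsmall (eps / 3) He3) as [k Hk].
assert (H := proj1 (filterlim_norm _ _) (Hc k t Ht) _ He3).
change (locally t (fun s => on_interval a T s -> norm (minus (v k s) (v k t)) < eps / 3)) in H.
change (locally t (fun s => on_interval a T s -> norm (minus (w s) (w t)) < eps)).
apply: filter_imp H => s Hs HsT.
apply: (Rle_lt_trans _ _ _ (norm_minus_trans (v k s) _ _)).
replace eps with (eps / 3 + (eps / 3 + eps / 3)) by field.
apply Rplus_lt_compat; [by apply: Rle_lt_trans Hk; apply Hw|].
apply: (Rle_lt_trans _ _ _ (norm_minus_trans (v k t) _ _)).
apply Rplus_lt_compat; [exact: Hs|].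
rewrite norm_minus_sym. by apply: Rle_lt_trans Hk; apply Hw.
Qed.

End SupNorm.

Lemma sum_norm_le (V : banach) (n : nat) (v : 'I_n -> V) (K : R) :
  (forall i, norm (v i) <= K) -> sum_norm v <= INR n * K.
Proof.
intros Hv. unfold sum_norm.
apply Rle_trans with (\big[Rplus/0]_(i < n) K).
- apply: (big_ind2 (fun x y => x <= y)); [lra|intros; lra|intros i _; exact: Hv].
- rewrite big_const_ord. right. clear v Hv. induction n as [|n IH].
  + rewrite /= Rmult_0_l //.
  + rewrite ssrnat.iterS IH S_INR. ring.
Qed.

Lemma sum_norm_ge_0 (V : banach) (n : nat) (v : 'I_n -> V) : 0 <= sum_norm v.
Proof.
unfold sum_norm. apply: (big_ind (fun x => 0 <= x)); [lra|intros; lra|intros; apply norm_ge_0].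
Qed.

Lemma filterlim_pair_locally (T : Type) (F : (T -> Prop) -> Prop) {FF : Filter F}
    (U V : UniformSpace) (f : T -> U) (g : T -> V) (x : U) (y : V) :
  filterlim f F (locally x) -> filterlim g F (locally y) ->
  filterlim (fun t => (f t, g t)) F (locally (x, y)).
Proof.
intros Hf Hg P [eps HP].
assert (H1 := proj1 (filterlim_locally _ _) Hf eps).
assert (H2 := proj1 (filterlim_locally _ _) Hg eps).
change (F (fun t => P (f t, g t))). apply: (filter_imp _ _ _ (filter_and _ _ H1 H2)) => t [A1 A2]. apply HP. split; [exact: A1|exact: A2].
Qed.

Lemma filterlim_gradient (T : Type) (F : (T -> Prop) -> Prop) {FF : Filter F}
    (U V : banach) (n : nat) (D : 'I_n -> U -> V) (b : T -> U) (x : U) :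
  (forall i, op_norm_le (D i) 1) -> filterlim b F (locally x) ->
  filterlim (fun t => ((fun i => D i (b t)) : 'I_n -> V)) F (locally (fun i => D i x)).
Proof.
intros HD Hb P [[eps He] HP].
assert (H := proj1 (filterlim_norm _ _) Hb _ He).
change (F (fun t => P (fun i => D i (b t)))).
apply: filter_imp H => t Ht. apply HP => i. apply: norm_compat1.
destruct (HD i) as [Hl Hn].
change (norm (minus (D i (b t)) (D i x)) < eps).
rewrite -(linear_minus _ _ Hl). apply: Rle_lt_trans Ht. rewrite -[X in _ <= X]Rmult_1_l. exact: Hn.
Qed.

Lemma curve_linear (U V : banach) (L : U -> V) (a T : R) (b : R -> U) :
  is_linear L -> curve a T b -> curve a T (fun t => L (b t)).
Proof.
intros HL Hb t Ht. exact: (filterlim_comp _ _ _ b L _ _ _ (Hb t Ht) (linear_cont L (b t) HL)).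
Qed.

Lemma le_Rabs_mul (L x y : R) : 0 <= x -> x <= y -> L * x <= Rabs L * y.
Proof.
intros Hx Hxy. assert (H := Rle_abs L). assert (H0 := Rabs_pos L).
apply Rle_trans with (Rabs L * x); [by apply Rmult_le_compat_r|by apply Rmult_le_compat_l].
Qed.

(* The constants L and L' in the hypotheses carry no sign. *)
Lemma le_Rabs_mul_affine (L L' x x' y y' z : R) : 0 <= x <= x' -> 0 <= y <= y' ->
  z <= L * x * (1 + L' * y) -> z <= Rabs L * x' * (1 + Rabs L' * y').
Proof.
intros Hx Hy Hz. apply: (Rle_trans _ _ _ Hz).
assert (H0 := Rabs_pos L). assert (H1 := Rabs_pos L').
assert (H2 : Rabs (1 + L' * y) <= 1 + Rabs L' * y').
{ apply: Rle_trans; [apply Rabs_triang|]. rewrite Rabs_R1 Rabs_mult (Rabs_pos_eq y); [|lra].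
  apply Rplus_le_compat_l, Rmult_le_compat_l; lra. }
apply: (Rle_trans _ _ _ (Rle_abs _)). rewrite !Rabs_mult (Rabs_pos_eq x); [|lra].
apply Rmult_le_compat => //; [apply Rmult_le_pos; lra|apply Rabs_pos|].
apply Rmult_le_compat_l; lra.
Qed.

(** * The coupled system: growth and Lipschitz estimates of the sources *)

Section System.

Variables (beta a q C d : R).
Variables (B1 B B1b Bb Bcon : banach) (j1 : B1 -> B) (j1b : B1b -> Bb).
Variables (n : nat) (D : 'I_n -> B1 -> B) (Db : 'I_n -> B1b -> Bb).
Variables (E : R -> B -> B) (Eb : R -> Bb -> Bb).
Variables (H : R -> B -> ('I_n -> B) -> Bcon -> B) (LH LH' LHpar : R).
Variables (Hb : R -> R -> Bb -> ('I_n -> Bb) -> (R -> B) -> Bb) (LHb LHb' : R).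
Variables (u : R -> Bb -> ('I_n -> Bb) -> Bcon) (Lu : R).
Variables (Sol : R -> B1 -> (R -> B) -> R -> B1).
Variables (Solb : R -> B1b -> (R -> Bb) -> R -> B1b).
Hypothesis Hq : 0 < q.
Hypothesis HC : 0 <= C.
Hypothesis Hd : 0 < d.
Hypothesis j1_linear : is_linear j1.
Hypothesis j1b_linear : is_linear j1b.
Hypothesis j1_norm : forall x, norm (j1 x) <= norm x.
Hypothesis j1b_norm : forall x, norm (j1b x) <= norm x.
Hypothesis HD : forall i, op_norm_le (D i) 1.
Hypothesis HDb : forall i, op_norm_le (Db i) 1.
Hypothesis HH : forward_source H LH LH' LHpar.
Hypothesis HHb : forall T, a < T -> backward_source a T (Hb T) LHb LHb'.
Hypothesis Hu : control u Lu.
Hypothesis HSol : mild_operator j1 E beta q C d Sol.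
Hypothesis HSolb : mild_operator j1b Eb beta q C d Solb.

Let solution := mild_solution j1 j1b D Db E Eb H.

Definition source (b : R -> B1) (f : R -> B1b) (s : R) : B :=
  H s (j1 (b s)) (fun i => D i (b s)) (u s (j1b (f s)) (fun i => Db i (f s))).

Definition source_b (T : R) (b : R -> B1) (f : R -> B1b) (s : R) : Bb :=
  Hb T s (j1b (f s)) (fun i => Db i (f s)) (fun r => j1 (b r)).

Definition next (Y : B1) (b : R -> B1) (f : R -> B1b) : R -> B1 :=
  Sol a Y (source b f).

(** Time is reversed as in [mild_operator_backward], but the curve b is passed unreversed, because
    H^b reads it in the original time. *)
Definition next_b (T : R) (Z : B1b) (b : R -> B1) (f : R -> B1b) (t : R) : B1b :=
  Solb a Z (fun s => opp (source_b T b f (a + T - s))) (a + T - t).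

(** One constant for all estimates: the summands come from H in its state, H through the control,
    H^b in its state and H^b in the curve. The factors 1 + n count the value and the n
    derivatives. *)
Definition source_const : R :=
  Rabs LH * (1 + INR n) * (1 + Rabs LH' * INR n) +
  Rabs LHpar * (Rabs Lu * (1 + INR n)) * (1 + INR n) +
  Rabs LHb * (1 + INR n) * (1 + Rabs LHb' * INR n) +
  Rabs LHb * (2 + INR n).

Lemma source_const_ge_0 : 0 <= source_const.
Proof.
assert (Hn := pos_INR n).
assert (A1 := Rabs_pos LH). assert (A2 := Rabs_pos LHpar). assert (A3 := Rabs_pos Lu).
assert (A4 := Rabs_pos LHb). assert (A5 := Rabs_pos LHb'). assert (A6 := Rabs_pos LH').
assert (0 <= Rabs LH' * INR n) by by apply Rmult_le_pos.
assert (0 <= Rabs LHb' * INR n) by by apply Rmult_le_pos.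
unfold source_const. repeat apply Rplus_le_le_0_compat; repeat apply Rmult_le_pos; lra.
Qed.

Lemma gradient_sum_norm_le (U V : banach) (G : 'I_n -> U -> V) (x : U) :
  (forall i, op_norm_le (G i) 1) -> sum_norm (fun i => G i x) <= INR n * norm x.
Proof.
intros HG. apply sum_norm_le => i. rewrite -[X in _ <= X]Rmult_1_l. apply HG.
Qed.

Lemma gradient_vdist_le (U V : banach) (G : 'I_n -> U -> V) (x y : U) :
  (forall i, op_norm_le (G i) 1) ->
  vdist (fun i => G i x) (fun i => G i y) <= INR n * norm (minus x y).
Proof.
intros HG. apply sum_norm_le => i. destruct (HG i) as [Hl Hn].
rewrite -(linear_minus _ _ Hl) -[X in _ <= X]Rmult_1_l. apply Hn.
Qed.

Lemma embedded_dist_le (U V : banach) (j : U -> V) (G : 'I_n -> U -> V) (x y : U) :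
  is_linear j -> (forall x, norm (j x) <= norm x) -> (forall i, op_norm_le (G i) 1) ->
  0 <= norm (minus (j x) (j y)) + vdist (fun i => G i x) (fun i => G i y) <=
  (1 + INR n) * norm (minus x y).
Proof.
intros Hj Hjn HG. split.
- apply Rplus_le_le_0_compat; [apply norm_ge_0|apply sum_norm_ge_0].
- rewrite Rmult_plus_distr_r Rmult_1_l. apply Rplus_le_compat.
  + rewrite -(linear_minus _ _ Hj). exact: Hjn.
  + exact: gradient_vdist_le.
Qed.

(** The growth bound on H is homogeneous in the gradients. Hence the source is controlled by b
    alone, without an additive constant, and the two equations decouple in the a priori bound. *)
Lemma source_le (b : R -> B1) (f : R -> B1b) (s : R) :
  norm (source b f s) <= source_const * norm (b s).
Proof.
destruct HH as [_ [_ [_ H4]]]. apply: (Rle_trans _ _ _ (H4 _ _ _ _)).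
apply: Rle_trans.
- apply: le_Rabs_mul; [apply sum_norm_ge_0|]. exact: gradient_sum_norm_le.
- rewrite -Rmult_assoc. apply Rmult_le_compat_r; [apply norm_ge_0|].
  assert (Hn := pos_INR n).
  assert (A1 := Rabs_pos LH). assert (A2 := Rabs_pos LHpar). assert (A3 := Rabs_pos Lu).
  assert (A4 := Rabs_pos LHb). assert (A5 := Rabs_pos LHb'). assert (A6 := Rabs_pos LH').
  assert (0 <= Rabs LH' * INR n) by by apply Rmult_le_pos.
  assert (0 <= Rabs LHb' * INR n) by by apply Rmult_le_pos.
  assert (0 <= Rabs LHpar * (Rabs Lu * (1 + INR n)) * (1 + INR n)) by (repeat apply Rmult_le_pos; lra).
  assert (0 <= Rabs LHb * (1 + INR n) * (1 + Rabs LHb' * INR n)) by (repeat apply Rmult_le_pos; lra).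
  assert (0 <= Rabs LHb * (2 + INR n)) by (apply Rmult_le_pos; lra).
  assert (0 <= Rabs LH * (1 + INR n) * (Rabs LH' * INR n)) by (repeat apply Rmult_le_pos; lra).
  unfold source_const. lra.
Qed.

Lemma source_b_le (T : R) (b : R -> B1) (f : R -> B1b) (s : R) : a < T -> curve a T b ->
  norm (source_b T b f s) <= source_const * norm (f s).
Proof.
intros HT Hcb. destruct (HHb HT) as [_ [_ [_ [_ H4]]]].
apply: (Rle_trans _ _ _ (H4 _ _ _ _ (curve_linear j1_linear Hcb))).
apply: Rle_trans.
- apply: le_Rabs_mul; [apply sum_norm_ge_0|]. exact: gradient_sum_norm_le.
- rewrite -Rmult_assoc. apply Rmult_le_compat_r; [apply norm_ge_0|].
  assert (Hn := pos_INR n).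
  assert (A1 := Rabs_pos LH). assert (A2 := Rabs_pos LHpar). assert (A3 := Rabs_pos Lu).
  assert (A4 := Rabs_pos LHb). assert (A5 := Rabs_pos LHb'). assert (A6 := Rabs_pos LH').
  assert (0 <= Rabs LH' * INR n) by by apply Rmult_le_pos.
  assert (0 <= Rabs LHb' * INR n) by by apply Rmult_le_pos.
  assert (0 <= Rabs LHpar * (Rabs Lu * (1 + INR n)) * (1 + INR n)) by (repeat apply Rmult_le_pos; lra).
  assert (0 <= Rabs LH * (1 + INR n) * (1 + Rabs LH' * INR n)) by (repeat apply Rmult_le_pos; lra).
  assert (0 <= Rabs LHb * (2 + INR n)) by (apply Rmult_le_pos; lra).
  assert (0 <= Rabs LHb * (1 + INR n) * (Rabs LHb' * INR n)) by (repeat apply Rmult_le_pos; lra).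
  unfold source_const. lra.
Qed.

Lemma affine_le (x y r : R) : 0 <= x -> 0 <= y -> 0 <= r -> 1 + x * (y * r) <= (1 + x * y) * (1 + r).
Proof. intros Hx Hy Hr. assert (0 <= x * y) by by apply Rmult_le_pos. nra. Qed.

(** The intermediate point has the state of c and the control of f. The growth factors of both steps
    then involve only b and c, which r bounds. *)
Lemma source_minus_le (b c : R -> B1) (f g : R -> B1b) (r s : R) :
  norm (b s) <= r -> norm (c s) <= r ->
  norm (minus (source b f s) (source c g s)) <=
  source_const * (1 + r) * (norm (minus (b s) (c s)) + norm (minus (f s) (g s))).
Proof.
intros Hbr Hcr. destruct HH as [_ [H2 [H3 _]]]. destruct Hu as [_ Hu2].
assert (Hn := pos_INR n).
assert (Hr : 0 <= r) by (apply: Rle_trans Hbr; apply norm_ge_0).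
apply: (Rle_trans _ _ _ (norm_minus_trans (H s (j1 (c s)) (fun i => D i (c s))
   (u s (j1b (f s)) (fun i => Db i (f s)))) _ _)).
set (x := norm (minus (b s) (c s))). set (y := norm (minus (f s) (g s))).
assert (Hx : 0 <= x) by apply norm_ge_0. assert (Hy : 0 <= y) by apply norm_ge_0.
assert (Sb : 0 <= sum_norm (fun i => D i (b s)) <= INR n * r).
{ split; [apply sum_norm_ge_0|]. apply: (Rle_trans _ _ _ (gradient_sum_norm_le _ HD)).
  by apply Rmult_le_compat_l. }
assert (Sc : 0 <= sum_norm (fun i => D i (c s)) <= INR n * r).
{ split; [apply sum_norm_ge_0|]. apply: (Rle_trans _ _ _ (gradient_sum_norm_le _ HD)).
  by apply Rmult_le_compat_l. }
assert (N1 := le_Rabs_mul_affine (embedded_dist_le (b s) (c s) j1_linear j1_norm HD) Sb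
  (H2 s (j1 (b s)) (fun i => D i (b s)) (j1 (c s)) (fun i => D i (c s))
    (u s (j1b (f s)) (fun i => Db i (f s))))).
assert (Nu : 0 <= norm (minus (u s (j1b (f s)) (fun i => Db i (f s)))
   (u s (j1b (g s)) (fun i => Db i (g s)))) <= Rabs Lu * ((1 + INR n) * y)).
{ split; [apply norm_ge_0|]. apply: (Rle_trans _ _ _ (Hu2 _ _ _ _ _)).
  destruct (embedded_dist_le (f s) (g s) j1b_linear j1b_norm HDb) as [G1 G2].
  exact: le_Rabs_mul. }
assert (N2 := H3 s (j1 (c s)) (fun i => D i (c s)) (u s (j1b (f s)) (fun i => Db i (f s)))
  (u s (j1b (g s)) (fun i => Db i (g s)))).
rewrite -(Rmult_1_l (sum_norm _)) in N2.
assert (N3 := le_Rabs_mul_affine Nu Sc N2). rewrite Rabs_R1 in N3.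
apply: Rle_trans; [exact: (Rplus_le_compat _ _ _ _ N1 N3)|]. fold x.
assert (A1 := Rabs_pos LH). assert (A2 := Rabs_pos LHpar). assert (A3 := Rabs_pos Lu).
assert (A4 := Rabs_pos LHb). assert (A5 := Rabs_pos LHb'). assert (A6 := Rabs_pos LH').
assert (0 <= Rabs LH' * INR n) by by apply Rmult_le_pos.
assert (0 <= Rabs LHb' * INR n) by by apply Rmult_le_pos.
set (K1 := Rabs LH * (1 + INR n) * (1 + Rabs LH' * INR n)).
set (K2 := Rabs LHpar * (Rabs Lu * (1 + INR n)) * (1 + INR n)).
assert (HK1 : 0 <= K1) by (unfold K1; repeat apply Rmult_le_pos; lra).
assert (HK2 : 0 <= K2) by (unfold K2; repeat apply Rmult_le_pos; lra).
assert (HK : K1 + K2 <= source_const).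
{ assert (0 <= Rabs LHb * (1 + INR n) * (1 + Rabs LHb' * INR n)) by (repeat apply Rmult_le_pos; lra).
  assert (0 <= Rabs LHb * (2 + INR n)) by (apply Rmult_le_pos; lra).
  unfold source_const, K1, K2. lra. }
apply Rle_trans with (K1 * (1 + r) * x + K2 * (1 + r) * y).
- apply Rplus_le_compat.
  + unfold K1. assert (G := affine_le A6 Hn Hr).
    replace (Rabs LH * (1 + INR n) * (1 + Rabs LH' * INR n) * (1 + r) * x)
      with (Rabs LH * ((1 + INR n) * x) * ((1 + Rabs LH' * INR n) * (1 + r))) by ring.
    apply Rmult_le_compat_l => //. repeat apply Rmult_le_pos; lra.
  + unfold K2. assert (G := affine_le Rle_0_1 Hn Hr).
    replace (Rabs LHpar * (Rabs Lu * (1 + INR n)) * (1 + INR n) * (1 + r) * y)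
      with (Rabs LHpar * (Rabs Lu * ((1 + INR n) * y)) * ((1 + 1 * INR n) * (1 + r))) by ring.
    apply Rmult_le_compat_l => //. repeat apply Rmult_le_pos; lra.
- assert (0 <= (1 + r) * x) by (apply Rmult_le_pos; lra).
  assert (0 <= (1 + r) * y) by (apply Rmult_le_pos; lra).
  assert (0 <= K2 * ((1 + r) * x)) by by apply Rmult_le_pos.
  assert (0 <= K1 * ((1 + r) * y)) by by apply Rmult_le_pos.
  apply Rle_trans with ((K1 + K2) * ((1 + r) * (x + y))).
  + lra.
  + rewrite Rmult_assoc. apply Rmult_le_compat_r => //. lra.
Qed.

(** The state moves from f to g under the curve b, and then the curve moves to c. As H^b depends on
    a whole curve, the distance of b and c enters through the uniform bound p. *)
Lemma source_b_minus_le (T : R) (b c : R -> B1) (f g : R -> B1b) (r p s : R) :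
  a < T -> curve a T b -> curve a T c ->
  (forall t, on_interval a T t -> norm (minus (b t) (c t)) <= p) ->
  norm (f s) <= r -> norm (g s) <= r ->
  norm (minus (source_b T b f s) (source_b T c g s)) <=
  source_const * (1 + r) * (norm (minus (f s) (g s)) + p).
Proof.
intros HT Hcb Hcc Hp Hfr Hgr. destruct (HHb HT) as [_ [_ [H2 [H3 _]]]].
assert (Hn := pos_INR n).
assert (Hr : 0 <= r) by (apply: Rle_trans Hfr; apply norm_ge_0).
assert (Hjb := curve_linear j1_linear Hcb). assert (Hjc := curve_linear j1_linear Hcc).
apply: (Rle_trans _ _ _ (norm_minus_trans (Hb T s (j1b (g s)) (fun i => Db i (g s))
   (fun r => j1 (b r))) _ _)).
set (y := norm (minus (f s) (g s))).
assert (Hy : 0 <= y) by apply norm_ge_0.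
assert (Hp0 : 0 <= p).
{ assert (Ha : on_interval a T a) by (unfold on_interval; lra).
  apply: Rle_trans (Hp a Ha). apply norm_ge_0. }
assert (Sf : 0 <= sum_norm (fun i => Db i (f s)) <= INR n * r).
{ split; [apply sum_norm_ge_0|]. apply: (Rle_trans _ _ _ (gradient_sum_norm_le _ HDb)).
  by apply Rmult_le_compat_l. }
assert (Sg : 0 <= norm (j1b (g s)) + sum_norm (fun i => Db i (g s)) <= (1 + INR n) * r).
{ split; [apply Rplus_le_le_0_compat; [apply norm_ge_0|apply sum_norm_ge_0]|].
  rewrite Rmult_plus_distr_r Rmult_1_l. apply Rplus_le_compat.
  - exact: (Rle_trans _ _ _ (j1b_norm _)).
  - apply: (Rle_trans _ _ _ (gradient_sum_norm_le _ HDb)). by apply Rmult_le_compat_l. }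
assert (N1 := le_Rabs_mul_affine (embedded_dist_le (f s) (g s) j1b_linear j1b_norm HDb) Sf
  (H2 s (j1b (f s)) (fun i => Db i (f s)) (j1b (g s)) (fun i => Db i (g s)) _ Hjb)).
assert (Hjp : forall t, on_interval a T t -> norm (minus (j1 (b t)) (j1 (c t))) <= p).
{ intros t Ht. rewrite -(linear_minus _ _ j1_linear). apply: Rle_trans (Hp t Ht). exact: j1_norm. }
assert (Nd : 0 <= curve_dist a T (fun r => j1 (b r)) (fun r => j1 (c r)) <= p).
{ destruct (sup_norm_spec HT Hjp) as [G1 G2]. split; [|exact G2].
  assert (Ha : on_interval a T a) by (unfold on_interval; lra).
  apply: Rle_trans (G1 a Ha). apply norm_ge_0. }
assert (N2 := H3 s (j1b (g s)) (fun i => Db i (g s)) _ _ Hjb Hjc).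
rewrite -(Rmult_1_l (norm _ + sum_norm _)) in N2.
assert (N3 := le_Rabs_mul_affine Nd Sg N2). rewrite Rabs_R1 in N3.
apply: Rle_trans; [exact: (Rplus_le_compat _ _ _ _ N1 N3)|]. fold y.
assert (A1 := Rabs_pos LH). assert (A2 := Rabs_pos LHpar). assert (A3 := Rabs_pos Lu).
assert (A4 := Rabs_pos LHb). assert (A5 := Rabs_pos LHb'). assert (A6 := Rabs_pos LH').
assert (0 <= Rabs LH' * INR n) by by apply Rmult_le_pos.
assert (0 <= Rabs LHb' * INR n) by by apply Rmult_le_pos.
set (K1 := Rabs LHb * (1 + INR n) * (1 + Rabs LHb' * INR n)).
set (K2 := Rabs LHb * (2 + INR n)).
assert (HK1 : 0 <= K1) by (unfold K1; repeat apply Rmult_le_pos; lra).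
assert (HK2 : 0 <= K2) by (unfold K2; repeat apply Rmult_le_pos; lra).
assert (HK : K1 + K2 <= source_const).
{ assert (0 <= Rabs LH * (1 + INR n) * (1 + Rabs LH' * INR n)) by (repeat apply Rmult_le_pos; lra).
  assert (0 <= Rabs LHpar * (Rabs Lu * (1 + INR n)) * (1 + INR n)) by (repeat apply Rmult_le_pos; lra).
  unfold source_const, K1, K2. lra. }
apply Rle_trans with (K1 * (1 + r) * y + K2 * (1 + r) * p).
- apply Rplus_le_compat.
  + unfold K1. assert (G := affine_le A5 Hn Hr).
    replace (Rabs LHb * (1 + INR n) * (1 + Rabs LHb' * INR n) * (1 + r) * y)
      with (Rabs LHb * ((1 + INR n) * y) * ((1 + Rabs LHb' * INR n) * (1 + r))) by ring.
    apply Rmult_le_compat_l => //. repeat apply Rmult_le_pos; lra.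
  + unfold K2.
    replace (Rabs LHb * (2 + INR n) * (1 + r) * p)
      with (Rabs LHb * p * ((2 + INR n) * (1 + r))) by ring.
    apply Rmult_le_compat_l; [by apply Rmult_le_pos|].
    assert (0 <= INR n * r) by by apply Rmult_le_pos. lra.
- assert (0 <= (1 + r) * y) by (apply Rmult_le_pos; lra).
  assert (0 <= (1 + r) * p) by (apply Rmult_le_pos; lra).
  assert (0 <= K2 * ((1 + r) * y)) by by apply Rmult_le_pos.
  assert (0 <= K1 * ((1 + r) * p)) by by apply Rmult_le_pos.
  apply Rle_trans with ((K1 + K2) * ((1 + r) * (y + p))).
  + lra.
  + rewrite Rmult_assoc. apply Rmult_le_compat_r => //. lra.
Qed.

Lemma source_curve (T : R) (b : R -> B1) (f : R -> B1b) :
  curve a T b -> curve a T f -> curve a T (source b f).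
Proof.
intros Hcb Hcf t Ht. destruct HH as [Hc _]. destruct Hu as [Huc _].
set (F := within (on_interval a T) (locally t)).
assert (FF : Filter F) by exact: within_filter.
assert (Lt : filterlim (fun s : R => s) F (locally t)).
{ apply: (filterlim_filter_le_1 _ (filter_le_within _)). exact: filterlim_id. }
assert (Lb := curve_linear j1_linear Hcb Ht). assert (Lf := curve_linear j1b_linear Hcf Ht).
assert (LDb := filterlim_gradient HD (Hcb t Ht)). assert (LDf := filterlim_gradient HDb (Hcf t Ht)).
fold F in Lb, Lf, LDb, LDf.
assert (Lu1 := filterlim_comp _ _ _ _ _ _ _ _
  (filterlim_pair_locally (filterlim_pair_locally Lt Lf) LDf)
  (Huc (t, j1b (f t), (fun i => Db i (f t))))).
exact: (filterlim_comp _ _ _ _ _ _ _ _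
  (filterlim_pair_locally (filterlim_pair_locally (filterlim_pair_locally Lt Lb) LDb) Lu1)
  (Hc (t, j1 (b t), (fun i => D i (b t)), u t (j1b (f t)) (fun i => Db i (f t))))).
Qed.

Lemma source_b_curve (T : R) (b : R -> B1) (f : R -> B1b) :
  a < T -> curve a T b -> curve a T f -> curve a T (source_b T b f).
Proof.
intros HT Hcb Hcf t Ht. destruct (HHb HT) as [Hc _].
assert (Hjb := curve_linear j1_linear Hcb).
apply/filterlim_norm => eps He.
destruct (Hc t (j1b (f t)) (fun i => Db i (f t)) _ Hjb eps He) as [del [Hdel Hcc]].
assert (Hn := pos_INR n).
assert (Hdn : 0 < del / (1 + INR n)) by (apply Rdiv_lt_0_compat; lra).
assert (N := proj1 (filterlim_norm _ _) (Hcf t Ht) _ Hdn).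
change (locally t (fun s => on_interval a T s -> norm (minus (f s) (f t)) < del / (1 + INR n))) in N.
change (locally t (fun s => on_interval a T s ->
  norm (minus (source_b T b f s) (source_b T b f t)) < eps)).
assert (Nt : locally t (fun s => Rabs (s - t) < del)) by by exists (mkposreal _ Hdel).
apply: (filter_imp _ _ _ (filter_and _ _ N Nt)) => s [N1 N2] Hs.
specialize (N1 Hs).
destruct (embedded_dist_le (f s) (f t) j1b_linear j1b_norm HDb) as [_ G2].
assert (G3 : (1 + INR n) * norm (minus (f s) (f t)) < del).
{ apply (Rmult_lt_compat_l (1 + INR n)) in N1; [|lra].
  replace ((1 + INR n) * (del / (1 + INR n))) with del in N1 by (field; lra). exact N1. }
assert (P1 := norm_ge_0 (minus (j1b (f s)) (j1b (f t)))).
assert (P2 : 0 <= vdist (fun i => Db i (f s)) (fun i => Db i (f t))) by apply sum_norm_ge_0.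
apply: Hcc => //.
- apply: Rle_lt_trans G3. apply: Rle_trans G2. rewrite -[X in X <= _]Rplus_0_r.
  by apply Rplus_le_compat_l.
- apply: Rle_lt_trans G3. apply: Rle_trans G2. rewrite -[X in X <= _]Rplus_0_l.
  by apply Rplus_le_compat_r.
(* The curve argument stays frozen at b as s varies, so its distance is 0. *)
- apply: Rle_lt_trans Hdel.
  assert (Hz : forall r, on_interval a T r -> norm (minus (j1 (b r)) (j1 (b r))) <= 0).
  { intros r _. rewrite minus_eq_zero norm_zero. lra. }
  exact: (proj2 (sup_norm_spec HT Hz)).
Qed.

(** * Fixed-point form, a priori bound and contraction *)

Lemma mild_solution_iff (T : R) (Y : B1) (Z : B1b) (b : R -> B1) (f : R -> B1b) :
  a < T <= a + d ->
  solution (Hb T) u beta a T Y Z b f <->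
  curve a T b /\ curve a T f /\
  (forall t, on_interval a T t -> b t = next Y b f t) /\
  (forall t, on_interval a T t -> f t = next_b T Z b f t).
Proof.
intros HT. assert (HaT : a < T) by lra. unfold solution, mild_solution. split.
- intros [Hcb [Hcf [Hf Hbw]]]. split => //. split => //. split.
  + exact: (proj1 (mild_operator_forward HSol Y b HT (source_curve Hcb Hcf)) Hf).
  + exact: (proj1 (mild_operator_backward HSolb Z f HT (source_b_curve HaT Hcb Hcf)) Hbw).
- intros [Hcb [Hcf [Hf Hbw]]]. split => //. split => //. split.
  + exact: (proj2 (mild_operator_forward HSol Y b HT (source_curve Hcb Hcf)) Hf).
  + exact: (proj2 (mild_operator_backward HSolb Z f HT (source_b_curve HaT Hcb Hcf)) Hbw).
Qed.

(** 2 C N is the radius r with C N + r / 2 = r, and [source_const] (1 + 2 C N) is the Lipschitz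
    constant of the sources on that ball. The factor 4 gives contraction by 1/2, since the
    differences of b and of f both enter. *)
Definition small (T N : R) : Prop :=
  a < T <= a + d /\ 0 <= N /\
  4 * C * source_const * (1 + 2 * C * N) * power (T - a) q <= 1.

Definition bounded_curve (V : banach) (T r : R) (v : R -> V) : Prop :=
  curve a T v /\ forall t, on_interval a T t -> norm (v t) <= r.

Lemma on_interval_reflect (T t : R) : on_interval a T t -> on_interval a T (a + T - t).
Proof. unfold on_interval; lra. Qed.

Lemma next_curve (T : R) (Y : B1) (b : R -> B1) (f : R -> B1b) :
  a < T <= a + d -> curve a T b -> curve a T f -> curve a T (next Y b f).
Proof. intros HT Hcb Hcf. apply: (mild_operator_curve HSol) => //. exact: source_curve. Qed.

Lemma source_b_reflect_curve (T : R) (b : R -> B1) (f : R -> B1b) :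
  a < T -> curve a T b -> curve a T f ->
  curve a T (fun s => opp (source_b T b f (a + T - s))).
Proof.
intros HT Hcb Hcf.
exact: (curve_opp (curve_reflect (source_b_curve HT Hcb Hcf))).
Qed.

Lemma next_b_curve (T : R) (Z : B1b) (b : R -> B1) (f : R -> B1b) :
  a < T <= a + d -> curve a T b -> curve a T f -> curve a T (next_b T Z b f).
Proof.
intros HT Hcb Hcf. apply: curve_reflect. apply: (mild_operator_curve HSolb) => //.
apply: source_b_reflect_curve => //; lra.
Qed.

Lemma small_mul_le (T N r : R) : small T N -> 0 <= r ->
  C * power (T - a) q * (source_const * r) <= r / 2.
Proof.
intros [_ [HN Hs]] Hr. assert (HK := source_const_ge_0).
assert (Hp := power_ge_0 (T - a) q).
set (p := power (T - a) q) in *.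
assert (H1 : 0 <= C * source_const * p) by (repeat apply Rmult_le_pos; lra).
assert (H2 : 0 <= C * N) by by apply Rmult_le_pos.
assert (H3 : 0 <= C * source_const * p * (C * N)) by by apply Rmult_le_pos.
assert (H4 : C * source_const * p <= / 2) by lra.
apply (Rmult_le_compat_r r) in H4 => //. lra.
Qed.

Lemma small_mul_le_lipschitz (T N p : R) : small T N -> 0 <= p ->
  C * power (T - a) q * (source_const * (1 + 2 * C * N) * (p + p)) <= p / 2.
Proof.
intros [_ [HN Hs]] Hp. apply (Rmult_le_compat_r p) in Hs => //. lra.
Qed.

(** The radius r is arbitrary: by homogeneity the source costs at most half of any radius. The a
    priori bound applies this to the unknown norm of a solution. *)
Lemma next_le (T N r t : R) (Y : B1) (b : R -> B1) (f : R -> B1b) :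
  small T N -> bounded_curve T r b -> curve a T f -> on_interval a T t ->
  norm (next Y b f t) <= C * norm Y + r / 2.
Proof.
intros Hs [Hcb Hb'] Hcf Ht. assert (HK := source_const_ge_0).
assert (Hr : 0 <= r) by (apply: Rle_trans (Hb' t Ht); apply norm_ge_0).
apply Rle_trans with (C * norm Y + C * power (T - a) q * (source_const * r)).
- apply: (mild_operator_le HSol Y (proj1 Hs) (source_curve Hcb Hcf)) => // s Hs'.
  apply: (Rle_trans _ _ _ (source_le _ _ _)). apply Rmult_le_compat_l; auto.
- apply Rplus_le_compat_l. exact: (small_mul_le Hs).
Qed.

Lemma next_b_le (T N r t : R) (Z : B1b) (b : R -> B1) (f : R -> B1b) :
  small T N -> curve a T b -> bounded_curve T r f -> on_interval a T t ->
  norm (next_b T Z b f t) <= C * norm Z + r / 2.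
Proof.
intros Hs Hcb [Hcf Hf'] Ht. assert (HK := source_const_ge_0).
assert (HaT : a < T) by (destruct Hs; lra).
assert (Hr : 0 <= r) by (apply: Rle_trans (Hf' t Ht); apply norm_ge_0).
apply Rle_trans with (C * norm Z + C * power (T - a) q * (source_const * r)).
- apply: (mild_operator_le HSolb Z (proj1 Hs) (source_b_reflect_curve HaT Hcb Hcf));
    [|exact: on_interval_reflect].
  intros s Hs'. rewrite norm_opp.
  apply: (Rle_trans _ _ _ (source_b_le _ _ HaT Hcb)). apply Rmult_le_compat_l => //.
  by apply Hf', on_interval_reflect.
- apply Rplus_le_compat_l. exact: (small_mul_le Hs).
Qed.

Lemma next_minus_le (T N p t : R) (Y Y' : B1) (b c : R -> B1) (f g : R -> B1b) :
  small T N -> bounded_curve T (2 * C * N) b -> bounded_curve T (2 * C * N) c ->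
  curve a T f -> curve a T g ->
  (forall s, on_interval a T s -> norm (minus (b s) (c s)) <= p) ->
  (forall s, on_interval a T s -> norm (minus (f s) (g s)) <= p) ->
  on_interval a T t ->
  norm (minus (next Y b f t) (next Y' c g t)) <= C * norm (minus Y Y') + p / 2.
Proof.
intros Hs [Hcb Hbr] [Hcc Hcr] Hcf Hcg Hbc Hfg Ht. assert (HK := source_const_ge_0).
assert (Hp : 0 <= p) by (apply: Rle_trans (Hbc t Ht); apply norm_ge_0).
assert (Hr : 0 <= 2 * C * N) by (apply: Rle_trans (Hbr t Ht); apply norm_ge_0).
apply Rle_trans with (C * norm (minus Y Y') +
  C * power (T - a) q * (source_const * (1 + 2 * C * N) * (p + p))).
- apply: (mild_operator_minus_le HSol Y Y' (proj1 Hs) (source_curve Hcb Hcf) (source_curve Hcc Hcg))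
    => // s Hs'.
  apply: (Rle_trans _ _ _ (source_minus_le _ _ (Hbr s Hs') (Hcr s Hs'))).
  apply Rmult_le_compat_l; [apply Rmult_le_pos; lra|].
  apply Rplus_le_compat; auto.
- apply Rplus_le_compat_l. exact: small_mul_le_lipschitz.
Qed.

Lemma next_b_minus_le (T N p t : R) (Z Z' : B1b) (b c : R -> B1) (f g : R -> B1b) :
  small T N -> curve a T b -> curve a T c ->
  bounded_curve T (2 * C * N) f -> bounded_curve T (2 * C * N) g ->
  (forall s, on_interval a T s -> norm (minus (b s) (c s)) <= p) ->
  (forall s, on_interval a T s -> norm (minus (f s) (g s)) <= p) ->
  on_interval a T t ->
  norm (minus (next_b T Z b f t) (next_b T Z' c g t)) <= C * norm (minus Z Z') + p / 2.
Proof.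
intros Hs Hcb Hcc [Hcf Hfr] [Hcg Hgr] Hbc Hfg Ht. assert (HK := source_const_ge_0).
assert (HaT : a < T) by (destruct Hs; lra).
assert (Hp : 0 <= p) by (apply: Rle_trans (Hbc t Ht); apply norm_ge_0).
assert (Hr : 0 <= 2 * C * N) by (apply: Rle_trans (Hfr t Ht); apply norm_ge_0).
apply Rle_trans with (C * norm (minus Z Z') +
  C * power (T - a) q * (source_const * (1 + 2 * C * N) * (p + p))).
- apply: (mild_operator_minus_le HSolb Z Z' (proj1 Hs) (source_b_reflect_curve HaT Hcb Hcf)
    (source_b_reflect_curve HaT Hcc Hcg)); [|exact: on_interval_reflect].
  intros s Hs'. assert (Hs2 := on_interval_reflect Hs').
  rewrite /minus -opp_plus norm_opp.
  apply: (Rle_trans _ _ _ (source_b_minus_le HaT Hcb Hcc Hbc (Hfr _ Hs2) (Hgr _ Hs2))).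
  apply Rmult_le_compat_l; [apply Rmult_le_pos; lra|].
  apply Rplus_le_compat_r; auto.
- apply Rplus_le_compat_l. exact: small_mul_le_lipschitz.
Qed.

(** A solution is continuous, so its sup-norm S is finite, and being a fixed point it satisfies S <=
    C N + S / 2. *)
Lemma mild_solution_bounded (T N : R) (Y : B1) (Z : B1b) (b : R -> B1) (f : R -> B1b) :
  small T N -> norm Y <= N -> norm Z <= N ->
  solution (Hb T) u beta a T Y Z b f ->
  bounded_curve T (2 * C * N) b /\ bounded_curve T (2 * C * N) f.
Proof.
intros Hs HY HZ. rewrite (mild_solution_iff Y Z b f (proj1 Hs)).
intros [Hcb [Hcf [Hfb Hff]]].
assert (HaT : a < T) by (destruct Hs; lra).
assert (HYN : C * norm Y <= C * N) by by apply Rmult_le_compat_l.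
assert (HZN : C * norm Z <= C * N) by by apply Rmult_le_compat_l.
destruct (curve_bounded HaT Hcb) as [G [_ HG]]. destruct (curve_bounded HaT Hcf) as [G' [_ HG']].
destruct (sup_norm_spec HaT HG) as [Sb1 _]. destruct (sup_norm_spec HaT HG') as [Sf1 _].
split; split => //.
- assert (Hm : sup_norm a T b <= C * N + sup_norm a T b / 2).
  { apply sup_norm_spec => // t Ht. rewrite Hfb //.
    apply: (Rle_trans _ _ _ (next_le Y Hs (conj Hcb Sb1) Hcf Ht)). lra. }
  intros t Ht. apply: (Rle_trans _ _ _ (Sb1 t Ht)). lra.
- assert (Hm : sup_norm a T f <= C * N + sup_norm a T f / 2).
  { apply sup_norm_spec => // t Ht. rewrite Hff //.
    apply: (Rle_trans _ _ _ (next_b_le Z Hs Hcb (conj Hcf Sf1) Ht)). lra. }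
  intros t Ht. apply: (Rle_trans _ _ _ (Sf1 t Ht)). lra.
Qed.

(** The equations are coupled through both differences, so the estimate is closed for their maximum
    p, which satisfies p <= C dY + C dZ + p / 2. Equal data give uniqueness. *)
Lemma mild_solution_lipschitz (T N : R) (Y Y' : B1) (Z Z' : B1b)
    (b b' : R -> B1) (f f' : R -> B1b) :
  small T N -> norm Y <= N -> norm Z <= N -> norm Y' <= N -> norm Z' <= N ->
  solution (Hb T) u beta a T Y Z b f -> solution (Hb T) u beta a T Y' Z' b' f' ->
  forall t, on_interval a T t ->
  norm (minus (b t) (b' t)) <= 2 * C * (norm (minus Y Y') + norm (minus Z Z')) /\
  norm (minus (f t) (f' t)) <= 2 * C * (norm (minus Y Y') + norm (minus Z Z')).
Proof.
intros Hs HY HZ HY' HZ' Hsol Hsol'.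
assert (HaT : a < T) by (destruct Hs; lra).
destruct (mild_solution_bounded Hs HY HZ Hsol) as [Bb1 Bf1].
destruct (mild_solution_bounded Hs HY' HZ' Hsol') as [Bb2 Bf2].
apply (mild_solution_iff Y Z b f (proj1 Hs)) in Hsol.
apply (mild_solution_iff Y' Z' b' f' (proj1 Hs)) in Hsol'.
destruct Hsol as [Hcb [Hcf [Hfb Hff]]]. destruct Hsol' as [Hcb' [Hcf' [Hfb' Hff']]].
destruct (curve_bounded HaT (curve_minus Hcb Hcb')) as [G [_ HG]].
destruct (curve_bounded HaT (curve_minus Hcf Hcf')) as [G' [_ HG']].
destruct (sup_norm_spec HaT HG) as [Sb1 _]. destruct (sup_norm_spec HaT HG') as [Sf1 _].
set (x := sup_norm a T (fun t => minus (b t) (b' t))) in *.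
set (y := sup_norm a T (fun t => minus (f t) (f' t))) in *.
set (p := Rmax x y).
assert (Hbp : forall s, on_interval a T s -> norm (minus (b s) (b' s)) <= p).
{ intros s Hs'. apply: (Rle_trans _ _ _ (Sb1 s Hs')). apply Rmax_l. }
assert (Hfp : forall s, on_interval a T s -> norm (minus (f s) (f' s)) <= p).
{ intros s Hs'. apply: (Rle_trans _ _ _ (Sf1 s Hs')). apply Rmax_r. }
set (dY := norm (minus Y Y')). set (dZ := norm (minus Z Z')).
assert (HdY : 0 <= C * dY) by (apply Rmult_le_pos => //; apply norm_ge_0).
assert (HdZ : 0 <= C * dZ) by (apply Rmult_le_pos => //; apply norm_ge_0).
assert (Hx : x <= C * dY + p / 2).
{ apply sup_norm_spec => // t Ht. rewrite Hfb // Hfb' //. exact: (next_minus_le _ _ Hs). }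
assert (Hy : y <= C * dZ + p / 2).
{ apply sup_norm_spec => // t Ht. rewrite Hff // Hff' //. exact: (next_b_minus_le _ _ Hs). }
assert (Hp : p <= 2 * C * (dY + dZ)).
{ assert (p <= C * dY + C * dZ + p / 2) by (apply Rmax_lub; lra). lra. }
intros t Ht. split; (apply: Rle_trans Hp); auto.
Qed.

(** * Picard iteration *)

Fixpoint picard (T : R) (Y : B1) (Z : B1b) (k : nat) : (R -> B1) * (R -> B1b) :=
  match k with
  | O => (fun _ => zero, fun _ => zero)
  | S k => let x := picard T Y Z k in (next Y x.1 x.2, next_b T Z x.1 x.2)
  end.

Lemma curve_zero (V : banach) (T : R) : curve a T (fun _ => (zero : V)).
Proof. intros t Ht. exact: filterlim_const. Qed.

Lemma picard_bounded (T N : R) (Y : B1) (Z : B1b) (k : nat) :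
  small T N -> norm Y <= N -> norm Z <= N ->
  bounded_curve T (2 * C * N) (picard T Y Z k).1 /\
  bounded_curve T (2 * C * N) (picard T Y Z k).2.
Proof.
intros Hs HY HZ.
assert (HYN : C * norm Y <= C * N) by by apply Rmult_le_compat_l.
assert (HZN : C * norm Z <= C * N) by by apply Rmult_le_compat_l.
assert (HCN : 0 <= C * N) by (apply Rmult_le_pos => //; apply Hs).
induction k as [|k [IHb IHf]]; simpl.
- split; (split; [exact: curve_zero|intros t _; rewrite norm_zero; lra]).
- split; split.
  + apply next_curve; [apply Hs|apply IHb|apply IHf].
  + intros t Ht. apply: (Rle_trans _ _ _ (next_le Y Hs IHb (proj1 IHf) Ht)). lra.
  + apply next_b_curve; [apply Hs|apply IHb|apply IHf].
  + intros t Ht. apply: (Rle_trans _ _ _ (next_b_le Z Hs (proj1 IHb) IHf Ht)). lra.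
Qed.

(** The iteration starts from zero, so the first increment is bounded by the radius 2 C N; each
    later one is halved, the initial values being the same. *)
Lemma picard_minus_le (T N : R) (Y : B1) (Z : B1b) (k : nat) :
  small T N -> norm Y <= N -> norm Z <= N -> forall t, on_interval a T t ->
  norm (minus ((picard T Y Z (S k)).1 t) ((picard T Y Z k).1 t)) <= 2 * C * N * (/ 2) ^ k /\
  norm (minus ((picard T Y Z (S k)).2 t) ((picard T Y Z k).2 t)) <= 2 * C * N * (/ 2) ^ k.
Proof.
intros Hs HY HZ. induction k as [|k IH]; intros t Ht.
- destruct (picard_bounded 1 Hs HY HZ) as [[_ H1] [_ H2]].
  rewrite [(picard T Y Z 0).1 t]/= [(picard T Y Z 0).2 t]/= !minus_zero_r pow_O Rmult_1_r. auto.
- assert (Hk := picard_bounded k Hs HY HZ). assert (Hk' := picard_bounded (S k) Hs HY HZ).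
  assert (E1 : 2 * C * N * (/ 2) ^ S k = C * norm (minus Y Y) + 2 * C * N * (/ 2) ^ k / 2).
  { rewrite minus_eq_zero norm_zero. simpl. field. }
  assert (E2 : 2 * C * N * (/ 2) ^ S k = C * norm (minus Z Z) + 2 * C * N * (/ 2) ^ k / 2).
  { rewrite minus_eq_zero norm_zero. simpl. field. }
  split.
  + rewrite E1. apply: (next_minus_le _ _ Hs (proj1 Hk') (proj1 Hk) (proj1 (proj2 Hk')) (proj1 (proj2 Hk))) => //;
      intros s Hs'; by apply IH.
  + rewrite E2. apply: (next_b_minus_le _ _ Hs (proj1 (proj1 Hk')) (proj1 (proj1 Hk)) (proj2 Hk') (proj2 Hk)) => //;
      intros s Hs'; by apply IH.
Qed.

Lemma pow_half_small (K eps : R) : 0 < eps -> exists k, K * (/ 2) ^ k <= eps.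
Proof.
intros He. assert (H2 : Rabs (/ 2) < 1) by (rewrite Rabs_pos_eq; lra).
assert (HK := Rabs_pos K).
assert (He' : 0 < eps / (Rabs K + 1)) by (apply Rdiv_lt_0_compat; lra).
destruct (pow_lt_1_zero (/ 2) H2 _ He') as [k Hk].
exists k. specialize (Hk k (le_n k)).
apply: Rle_trans; [apply Rle_abs|]. rewrite Rabs_mult.
apply Rle_trans with ((Rabs K + 1) * (eps / (Rabs K + 1))).
- apply Rmult_le_compat; [lra|apply Rabs_pos|lra|lra].
- right; field; lra.
Qed.

Lemma eq_of_norm_minus_le (V : banach) (x y : V) (K : R) :
  (forall k, norm (minus x y) <= K * (/ 2) ^ k) -> x = y.
Proof.
intros Hk.
assert (H0 : minus x y = zero).
{ apply: norm_eq_zero. apply Rle_antisym; [|apply norm_ge_0].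
  apply le_epsilon => eps He. rewrite Rplus_0_l.
  destruct (pow_half_small K He) as [k Hk']. exact: (Rle_trans _ _ _ (Hk k)). }
by rewrite -[RHS]plus_zero_l -H0 /minus -plus_assoc plus_opp_l plus_zero_r.
Qed.

(** The limits inherit the bound 2 C N, so the contraction estimate compares them with the iterates
    and shows that they are fixed. *)
Lemma mild_solution_exists (T N : R) (Y : B1) (Z : B1b) :
  small T N -> norm Y <= N -> norm Z <= N ->
  exists b f, solution (Hb T) u beta a T Y Z b f.
Proof.
intros Hs HY HZ.
assert (HaT : a < T) by (destruct Hs; lra).
set (r := 2 * C * N).
assert (Hr : 0 <= r) by (unfold r; apply Rmult_le_pos; [lra|apply Hs]).
assert (Hk := fun k => picard_bounded k Hs HY HZ).
destruct (uniform_limit Hr (fun k => proj1 (proj1 (Hk k)))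
  (fun k t Ht => proj1 (picard_minus_le k Hs HY HZ Ht))) as [b [Hcb Hbk]].
destruct (uniform_limit Hr (fun k => proj1 (proj2 (Hk k)))
  (fun k t Ht => proj2 (picard_minus_le k Hs HY HZ Ht))) as [f [Hcf Hfk]].
assert (Bb1 : bounded_curve T r b).
{ split => // t Ht. apply le_epsilon => eps He.
  destruct (pow_half_small (2 * r) He) as [k Hk'].
  rewrite -(minus_zero_r (b t)). apply: (Rle_trans _ _ _ (norm_minus_trans ((picard T Y Z k).1 t) _ _)).
  rewrite minus_zero_r Rplus_comm. apply Rplus_le_compat; [by apply Hk|].
  exact: (Rle_trans _ _ _ (Hbk k t Ht)). }
assert (Bf1 : bounded_curve T r f).
{ split => // t Ht. apply le_epsilon => eps He.
  destruct (pow_half_small (2 * r) He) as [k Hk'].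
  rewrite -(minus_zero_r (f t)). apply: (Rle_trans _ _ _ (norm_minus_trans ((picard T Y Z k).2 t) _ _)).
  rewrite minus_zero_r Rplus_comm. apply Rplus_le_compat; [by apply Hk|].
  exact: (Rle_trans _ _ _ (Hfk k t Ht)). }
assert (EY : forall k, C * norm (minus Y Y) + 2 * r * (/ 2) ^ k / 2 = r * (/ 2) ^ k).
{ intros k. rewrite minus_eq_zero norm_zero. field. }
assert (EZ : forall k, C * norm (minus Z Z) + 2 * r * (/ 2) ^ k / 2 = r * (/ 2) ^ k).
{ intros k. rewrite minus_eq_zero norm_zero. field. }
exists b, f. apply (mild_solution_iff Y Z b f (proj1 Hs)).
split => //. split => //. split; intros t Ht; apply (@eq_of_norm_minus_le _ _ _ (2 * r)) => k.
- apply: (Rle_trans _ _ _ (norm_minus_trans ((picard T Y Z (S k)).1 t) _ _)).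
  (* The first summand is the distance from the limit to iterate k + 1, the second is half the
     distance from the limit to iterate k. *)
  replace (2 * r * (/ 2) ^ k) with (2 * r * (/ 2) ^ S k + r * (/ 2) ^ k) by (simpl; field).
  apply Rplus_le_compat; [by apply Hbk|]. rewrite norm_minus_sym -EY.
  apply: (next_minus_le _ _ Hs Bb1 (proj1 (Hk k)) Hcf (proj1 (proj2 (Hk k)))) => //;
    intros s Hs'; [exact: Hbk|exact: Hfk].
- apply: (Rle_trans _ _ _ (norm_minus_trans ((picard T Y Z (S k)).2 t) _ _)).
  replace (2 * r * (/ 2) ^ k) with (2 * r * (/ 2) ^ S k + r * (/ 2) ^ k) by (simpl; field).
  apply Rplus_le_compat; [by apply Hfk|]. rewrite norm_minus_sym -EZ.
  apply: (next_b_minus_le _ _ Hs Hcb (proj1 (proj1 (Hk k))) Bf1 (proj2 (Hk k))) => //;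
    intros s Hs'; [exact: Hbk|exact: Hfk].
Qed.

(** * The life span and its dependence on the size of the data *)

Definition lifespan (N : R) : R :=
  Rmin d (Rpower (/ (4 * C * source_const * (1 + 2 * C * N) + 1)) (/ q)).

Lemma lifespan_pos (N : R) : 0 < lifespan N.
Proof. apply Rmin_pos => //. apply exp_pos. Qed.

Lemma lifespan_const_ge_0 (N : R) : 0 <= N -> 0 <= 4 * C * source_const * (1 + 2 * C * N).
Proof.
intros HN. assert (HK := source_const_ge_0).
assert (0 <= C * N) by by apply Rmult_le_pos.
repeat apply Rmult_le_pos; lra.
Qed.

Lemma lifespan_decr (N N' : R) : 0 <= N <= N' -> lifespan N' <= lifespan N.
Proof.
intros HN. assert (HK := source_const_ge_0).
assert (H1 : 0 <= N) by lra. assert (H0 := lifespan_const_ge_0 H1).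
assert (H2 : 4 * C * source_const * (1 + 2 * C * N) <= 4 * C * source_const * (1 + 2 * C * N')).
{ apply Rmult_le_compat_l; [repeat apply Rmult_le_pos; lra|].
  apply Rplus_le_compat_l, Rmult_le_compat_l; lra. }
unfold lifespan. apply Rle_min_compat_l. apply Rle_Rpower_l.
- left; by apply Rinv_0_lt_compat.
- split; [apply Rinv_0_lt_compat; lra|]. apply Rinv_le_contravar; lra.
Qed.

(** [lifespan] solves K L^q <= 1 for the length L, with K + 1 in place of K so that the inverse
    exists when K = 0, and is capped by the range d of the linear theory. *)
Lemma lifespan_small (T N : R) : 0 <= N -> a < T < a + lifespan N -> small T N.
Proof.
intros HN HT. assert (H0 := lifespan_const_ge_0 HN).
unfold lifespan in HT.
set (K := 4 * C * source_const * (1 + 2 * C * N)) in *.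
assert (H1 := Rmin_l d (Rpower (/ (K + 1)) (/ q))).
assert (H2 := Rmin_r d (Rpower (/ (K + 1)) (/ q))).
split; [lra|]. split => //. fold K.
assert (H3 : power (T - a) q <= / (K + 1)).
{ rewrite power_pos; [|lra].
  apply Rle_trans with (Rpower (Rpower (/ (K + 1)) (/ q)) q).
  - apply Rle_Rpower_l; lra.
  - rewrite Rpower_mult Rinv_l; [|lra]. rewrite Rpower_1; [lra|]. apply Rinv_0_lt_compat; lra. }
apply Rle_trans with (K * / (K + 1)); [by apply Rmult_le_compat_l|].
apply (Rmult_le_reg_r (K + 1)); [lra|]. rewrite Rmult_assoc Rinv_l; lra.
Qed.

(** T0 depends on the data through the larger of the two norms and decreases with it, so data in
    bounded sets share an interval of positive length. *)
Lemma mild_solution_local :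
  exists T0 : B1 -> B1b -> R,
    (forall Y Z, a < T0 Y Z) /\
    (forall Y Z T, a < T < T0 Y Z ->
       has_unique_curves a T (solution (Hb T) u beta a T Y Z)) /\
    (forall (KY : B1 -> Prop) (KZ : B1b -> Prop),
       bounded_set KY -> bounded_set KZ ->
       (exists T1, a < T1 /\ forall Y Z, KY Y -> KZ Z -> T1 <= T0 Y Z) /\
       (forall T, a < T -> (forall Y Z, KY Y -> KZ Z -> T < T0 Y Z) ->
          exists L, forall Y Z Y' Z' b f b' f',
            KY Y -> KZ Z -> KY Y' -> KZ Z' ->
            solution (Hb T) u beta a T Y Z b f ->
            solution (Hb T) u beta a T Y' Z' b' f' ->
            curve_dist a T b b' + curve_dist a T f f'
            <= L * (norm (minus Y Y') + norm (minus Z Z')))).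
Proof.
set (size := fun (Y : B1) (Z : B1b) => Rmax (norm Y) (norm Z)).
assert (Hsize : forall Y Z, 0 <= size Y Z).
{ intros Y Z. apply: Rle_trans (Rmax_l _ _). apply norm_ge_0. }
exists (fun Y Z => a + lifespan (size Y Z)). split; [|split].
- intros Y Z. assert (H1 := lifespan_pos (size Y Z)). lra.
- intros Y Z T HT. assert (Hs := lifespan_small (Hsize Y Z) HT).
  assert (HY : norm Y <= size Y Z) by apply Rmax_l.
  assert (HZ : norm Z <= size Y Z) by apply Rmax_r.
  split; [exact: (mild_solution_exists Hs HY HZ)|].
  intros b f c g H1 H2 t Ht.
  destruct (mild_solution_lipschitz Hs HY HZ HY HZ H1 H2 Ht) as [E1 E2].
  rewrite !minus_eq_zero !norm_zero in E1, E2.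
  (* With equal data the Lipschitz bound is 0, that is, the geometric bound with constant 0. *)
  split; (apply (@eq_of_norm_minus_le _ _ _ 0) => k).
  + apply: (Rle_trans _ _ _ E1). lra.
  + apply: (Rle_trans _ _ _ E2). lra.
- intros KY KZ [rY HrY] [rZ HrZ]. split.
  + exists (a + lifespan (Rmax 0 (Rmax rY rZ))). split.
    { assert (H1 := lifespan_pos (Rmax 0 (Rmax rY rZ))). lra. }
    intros Y Z HY HZ. apply Rplus_le_compat_l, lifespan_decr. split => //.
    apply: Rle_trans (Rmax_r _ _).
    apply Rmax_lub.
    * apply: Rle_trans (Rmax_l _ _). auto.
    * apply: Rle_trans (Rmax_r _ _). auto.
  + intros T HT HTK. exists (4 * C). intros Y Z Y' Z' b f b' f' HY HZ HY' HZ' H1 H2.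
    (* The larger of the two data sizes serves as N for both solutions; T lies in its life span
       because that datum belongs to KY and KZ. This makes the constant 4 C, the sum of 2 C for b
       and 2 C for f, independent of the sets. *)
    assert (HN : exists N, small T N /\ size Y Z <= N /\ size Y' Z' <= N).
    { destruct (Rle_dec (size Y Z) (size Y' Z')).
      - exists (size Y' Z'). split; [|lra]. apply lifespan_small => //. by split; [|apply HTK].
      - exists (size Y Z). split; [|lra]. apply lifespan_small => //. by split; [|apply HTK]. }
    destruct HN as [N [Hs [HN1 HN2]]].
    assert (Hl := mild_solution_lipschitz Hs
      (Rle_trans _ _ _ (Rmax_l _ _) HN1) (Rle_trans _ _ _ (Rmax_r _ _) HN1)
      (Rle_trans _ _ _ (Rmax_l _ _) HN2) (Rle_trans _ _ _ (Rmax_r _ _) HN2) H1 H2).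
    assert (D1 := proj2 (sup_norm_spec HT (fun t Ht => proj1 (Hl t Ht)))).
    assert (D2 := proj2 (sup_norm_spec HT (fun t Ht => proj2 (Hl t Ht)))).
    apply: (Rle_trans _ _ _ (Rplus_le_compat _ _ _ _ D1 D2)). lra.
Qed.

End System.

Theorem theorem7p1
  (beta : R) (Hbeta : 0 < beta < 1) (a : R)
  (B2 B1 B B2b B1b Bb Bcon : banach)
  (j2 : B2 -> B1) (j1 : B1 -> B) (j2b : B2b -> B1b) (j1b : B1b -> Bb)
  (Htriple : banach_triple j2 j1) (Htripleb : banach_triple j2b j1b)
  (n : nat) (D : 'I_n -> B1 -> B) (Db : 'I_n -> B1b -> Bb)
  (HD : gradient j2 j1 D) (HDb : gradient j2b j1b Db)
  (A : B2 -> B) (E : R -> B -> B) (E1 : R -> B1 -> B1) (M m M1 m1 : R)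
  (HA : generated_semigroup j2 j1 A E E1 M m M1 m1)
  (Ab : B2b -> Bb) (Eb : R -> Bb -> Bb) (E1b : R -> B1b -> B1b)
  (Mb mb M1b m1b : R)
  (HAb : generated_semigroup j2b j1b Ab Eb E1b Mb mb M1b m1b)
  (H : R -> B -> ('I_n -> B) -> Bcon -> B) (LH LH' LHpar : R)
  (HH : forward_source H LH LH' LHpar)
  (* the backward source Hb T, T > a, with constants independent of T *)
  (Hb : R -> R -> Bb -> ('I_n -> Bb) -> (R -> B) -> Bb) (LHb LHb' : R)
  (HHb : forall T, a < T -> backward_source a T (Hb T) LHb LHb')
  (u : R -> Bb -> ('I_n -> Bb) -> Bcon) (Lu : R)
  (Hu : control u Lu)
  (kappa omega : R) (Hkappa : 0 < kappa) (Homega : 0 < omega < 1)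
  (Hsmooth : smoothing j1 E kappa omega)
  (Hsmoothb : smoothing j1b Eb kappa omega) :
  exists T0 : B1 -> B1b -> R,
    (forall Y Z, a < T0 Y Z) /\
    (forall Y Z T, a < T < T0 Y Z ->
       has_unique_curves a T
         (mild_solution j1 j1b D Db E Eb H (Hb T) u beta a T Y Z)) /\
    (* Lipschitz dependence for data in bounded sets KY, KZ *)
    (forall (KY : B1 -> Prop) (KZ : B1b -> Prop),
       bounded_set KY -> bounded_set KZ ->
       (exists T1, a < T1 /\ forall Y Z, KY Y -> KZ Z -> T1 <= T0 Y Z) /\
       (forall T, a < T -> (forall Y Z, KY Y -> KZ Z -> T < T0 Y Z) ->
          exists L, forall Y Z Y' Z' b f b' f',
            KY Y -> KZ Z -> KY Y' -> KZ Z' ->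
            mild_solution j1 j1b D Db E Eb H (Hb T) u beta a T Y Z b f ->
            mild_solution j1 j1b D Db E Eb H (Hb T) u beta a T Y' Z' b' f' ->
            curve_dist a T b b' + curve_dist a T f f'
            <= L * (norm (minus Y Y') + norm (minus Z Z')))).
Proof.
destruct (mild_operator_exists Hbeta Homega Hkappa Htriple HA Hsmooth)
  as [Sol [C1 [d1 [HC1 [Hd1 HSol]]]]].
destruct (mild_operator_exists Hbeta Homega Hkappa Htripleb HAb Hsmoothb)
  as [Solb [C2 [d2 [HC2 [Hd2 HSolb]]]]].
destruct Htriple as [_ [[j1l [_ j1n]] _]]. destruct Htripleb as [_ [[j1bl [_ j1bn]] _]].
assert (Hq : 0 < beta * (1 - omega)) by (apply Rmult_lt_0_compat; lra).
assert (HC : 0 <= Rmax C1 C2) by (apply: Rle_trans (Rmax_l _ _); exact HC1).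
assert (Hd : 0 < Rmin d1 d2) by by apply Rmin_pos.
exact (mild_solution_local Hq HC Hd j1l j1bl j1n j1bn (fun i => proj1 (HD i))
  (fun i => proj1 (HDb i)) HH HHb Hu
  (mild_operator_weaken (Rmax_l _ _) (Rmin_l _ _) HSol)
  (mild_operator_weaken (Rmax_r _ _) (Rmin_r _ _) HSolb)).
Qed.
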